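(* (i) For any $f\in\mathcal{A}'$, the measure $\mu(f)$ verifies $$\int_{\mathbb{R}^n}y\,d\mu(f)(y)=0.$$ (ii) For any $f\in\mathcal{A}''$, the measures $\mu(f)$ and $\sigma(f)$ verify $$\int_{\mathbb{R}^n}y\,d\mu(f)(y)+\int_{S^{n-1}}y\,d\sigma(f)(y)=0.$$
   Context: Fix $n\ge 1$. For a convex function $u:\mathbb{R}^n\to\mathbb{R}\cup\{+\infty\}$, $\mathrm{dom}(u)=\{x: u(x)\in\mathbb{R}\}$ and $u$ is proper if $\mathrm{dom}(u)\ne\emptyset$. $\mathcal{L}$ is the set of proper convex $u:\mathbb{R}^n\to\mathbb{R}\cup\{+\infty\}$ with $\lim_{\|x\|\to+\infty}u(x)=+\infty$ (and $e^{-\infty}=0$). $\mathcal{L}'$ is the set of $u\in\mathcal{L}$ such that $\mathrm{dom}(u)=\mathbb{R}^n$, $u\in C^2(\mathbb{R}^n)$ with positive definite Hessian at every point, and $\lim_{\|x\|\to+\infty}u(x)/\|x\|=+\infty$. A convex body (compact convex subset of $\mathbb{R}^n$) $K$ with nonempty interior is of class $C^2_+$ if $\partial K$ is of class $C^2$ with strictly positive Gauss curvature. $\mathcal{L}''$ is the set of $u\in\mathcal{L}$ such that $K=\mathrm{dom}(u)$ is a convex body of class $C^2_+$, $u$ is $C^2$ with positive definite Hessian at every point of $\mathrm{int}(K)$, $u$ is continuous on $K$, and $\|\nabla u(x)\|\to+\infty$ as $x\to\partial K$ (with $x\in\mathrm{int}(K)$). $\mathcal{A}'=\{e^{-u}:u\in\mathcal{L}'\}$,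 $\mathcal{A}''=\{e^{-u}:u\in\mathcal{L}''\}$. For $f=e^{-u}$ in $\mathcal{A}'$ or $\mathcal{A}''$, $\mu(f)$ is the Borel measure on $\mathbb{R}^n$ that is the push-forward under $\nabla u$ of the measure with density $f$ with respect to Lebesgue measure (on $\mathrm{int}(\mathrm{dom}(u))$). For $f=e^{-u}\in\mathcal{A}''$ with $K=\mathrm{dom}(u)$, $\sigma(f)$ is the Borel measure on $S^{n-1}$ that is the push-forward under the Gauss map $\nu_K$ (outer unit normal) of the measure $f\,\mathcal{H}^{n-1}$ restricted to $\partial K$, with $\mathcal{H}^{n-1}$ the $(n-1)$-dimensional Hausdorff measure. *)

(* Defs.v *)
From HB Require Import structures.
From mathcomp Require Import all_boot all_order all_algebra.
From mathcomp Require Import all_classical all_reals all_analysis.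
Set Implicit Arguments.
Unset Strict Implicit.
Unset Printing Implicit Defensive.
Import Order.TTheory GRing.Theory Num.Theory.
Import numFieldNormedType.Exports.
Local Open Scope classical_set_scope.
Local Open Scope ring_scope.

Section borel.
Context {R : realType} {n : nat}.
Definition rV_borel : set (set 'rV[R]_n) := <<s @open 'rV[R]_n >>.
HB.instance Definition _ := @isMeasurable.Build (sigma_display (@open 'rV[R]_n))
  'rV[R]_n rV_borel (@sigma_algebra0 _ setT _) (@sigma_algebraC _ _)
  (@sigma_algebra_bigcup _ setT _).
Lemma open_measurable_rV (A : set 'rV[R]_n) : open A -> measurable A.
Proof. exact: sub_sigma_algebra. Qed.
End borel.

Section cons.
Context {R : realType} {n : nat}.
Definition rV_cons (p : R * 'rV[R]_n) : 'rV[R]_n.+1 :=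
  \row_i if unlift ord0 i is Some j then p.2 0 j else p.1.

Definition rV_box (m : nat) (a b : 'rV[rat]_m) : set 'rV[R]_m :=
  [set x | forall i, ratr (a 0 i) < x 0 i < ratr (b 0 i)].

Lemma open_rV_box m (a b : 'rV[rat]_m) : open (rV_box a b).
Proof.
rewrite openE => x xab.
exists (fun _ i => `]ratr (a 0 i), ratr (b 0 i)[%classic).
  move=> i j; rewrite (ord1 i); apply: open_nbhs_nbhs.
  by split; [exact: interval_open|rewrite /= in_itv/=; exact: xab].
by move=> y ys i; have := ys 0 i; rewrite /= in_itv.
Qed.

Lemma open_bigcup_rV_box m (U : set 'rV[R]_m) : open U ->
  U = \bigcup_(ab in [set ab : 'rV[rat]_m * 'rV[rat]_m | rV_box ab.1 ab.2 `<=` U])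
         rV_box ab.1 ab.2.
Proof.
move=> oU; apply/seteqP; split=> [x Ux|x [ab /= abU /abU]//].
have /nbhs_ballP[e /= e0 xeU] : nbhs x U by exact: open_nbhs_nbhs.
have H i : {ab : rat * rat | x 0 i - e < ratr ab.1 < x 0 i /\ x 0 i < ratr ab.2 < x 0 i + e}.
  have /rat_in_itvoo /cid[q ] : x 0 i - e < x 0 i by rewrite ltrBlDr ltrDl.
  have /rat_in_itvoo /cid[r ] : x 0 i < x 0 i + e by rewrite ltrDl.
  by rewrite !in_itv/= => ? ?; exists (q, r).
exists (\row_i (projT1 (H i)).1, \row_i (projT1 (H i)).2).
  move=> y /= yab; apply: xeU; split=> // i j.
  have := yab j; rewrite !mxE (ord1 i); case: (H j) => -[q r]/= [/andP[a1 a2] /andP[b1 b2]] /andP[c1 c2].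
  rewrite /ball/= ltr_distlC; apply/andP; split; first exact: lt_trans c1.
  exact: lt_trans b2.
by move=> i; rewrite !mxE; case: (H i) => -[q r]/= [/andP[_ ->] /andP[-> _]].
Qed.

Lemma measurable_rV_cons : measurable_fun setT rV_cons.
Proof.
apply: (@measurability _ _ _ _ _ _ (@open 'rV[R]_n.+1)) => //.
move=> _ [U oU <-]; rewrite setTI (open_bigcup_rV_box oU) preimage_bigcup.
rewrite bigcup_mkcond; apply: countable_bigcupT_measurable => [|[a b]].
  exact: countableP.
case: ifPn => // _ /=.
pose tl (c : 'rV[rat]_n.+1) := \row_j c 0 (lift ord0 j).
rewrite (_ : _ @^-1` _ =
  `]ratr (a 0 0), ratr (b 0 0)[%classic `*` rV_box (tl a) (tl b)).
  by apply: measurableX => //; apply: open_measurable_rV; exact: open_rV_box.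
apply/seteqP; split=> [p pab|p [p1 p2] i].
  split; first by have := pab 0; rewrite mxE unlift_none /= in_itv.
  by move=> i; have := pab (lift ord0 i); rewrite !mxE liftK.
rewrite mxE; case: unliftP => [j|] -> /=.
  by have := p2 j; rewrite !mxE.
by move: p1; rewrite /= in_itv.
Qed.

Context (m : {sigma_finite_measure set 'rV[R]_n -> \bar R}).

Definition rV_cons_measure : set 'rV[R]_n.+1 -> \bar R :=
  pushforward (@lebesgue_measure R \x m)%E rV_cons.

Let rV_cons_measure0 : rV_cons_measure set0 = 0%E.
Proof. by rewrite /rV_cons_measure /pushforward preimage_set0 measure0. Qed.

Let rV_cons_measure_ge0 A : (0 <= rV_cons_measure A)%E.
Proof. by rewrite /rV_cons_measure /pushforward measure_ge0. Qed.

Let rV_cons_measure_sigma_additive : semi_sigma_additive rV_cons_measure.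
Proof.
move=> F mF tF mUF; rewrite /rV_cons_measure /pushforward preimage_bigcup.
have mcF (A : set 'rV[R]_n.+1) : measurable A -> measurable (rV_cons @^-1` A).
  by move=> mA; rewrite -[X in measurable X]setTI; exact: measurable_rV_cons.
apply: measure_semi_sigma_additive => [k||].
- exact: mcF.
- apply/trivIsetP => i j _ _ ij; rewrite -preimage_setI.
  by move/trivIsetP : tF => /(_ _ _ _ _ ij) ->//; rewrite preimage_set0.
- by rewrite -preimage_bigcup; exact: mcF.
Qed.

HB.instance Definition _ := isMeasure.Build _ _ _ rV_cons_measure
  rV_cons_measure0 rV_cons_measure_ge0 rV_cons_measure_sigma_additive.

Let rV_cons_measure_sigma_finite : sigma_finite setT rV_cons_measure.
Proof.
pose tl (x : 'rV[R]_n.+1) : 'rV[R]_n := \row_j x 0 (lift ord0 j).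
pose uncons (x : 'rV[R]_n.+1) := (x 0 0, tl x).
have muncons : measurable_fun setT uncons.
  apply: measurable_fun_pair.
    apply: (measurability _ (measurable_realfun.RGenOpens.measurableE R)) => //.
    move=> _ [_ [a [b ->] <-]]; rewrite setTI; apply: open_measurable_rV.
    apply: open_comp => [x _|]; last exact: interval_open.
    exact: coord_continuous.
  apply: (@measurability _ _ _ _ _ _ (@open 'rV[R]_n)) => //.
  move=> _ [U oU <-]; rewrite setTI; apply: open_measurable_rV.
  apply: open_comp => // x _ V /= [W Wx WV].
  exists (fun i => fun j => if unlift ord0 j is Some k then W i k else setT).
    move=> i j; case: unliftP => [k ->|_]; last exact: filterT.
    by have := Wx i k; rewrite /tl mxE (ord1 i).
  move=> y yW; apply: WV => i j; have := yW i (lift ord0 j).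
  by rewrite liftK /tl mxE (ord1 i).
have unconsK : uncons \o rV_cons = id.
  apply/funext => -[x y]; rewrite /uncons /tl /=; congr pair.
    by rewrite mxE unlift_none.
  by apply/rowP => j; rewrite !mxE liftK.
have /sigma_finiteP[F [UF ndF Foo]] := sigma_finiteT (@lebesgue_measure R).
have /sigma_finiteP[G [UG ndG Goo]] := sigma_finiteT m.
exists (fun k => uncons @^-1` (F k `*` G k)).
  rewrite -preimage_bigcup; apply/esym/seteqP; split=> // x _.
  have [i _ Fi] : (\bigcup_k F k) (x 0 0) by rewrite -UF.
  have [j _ Gj] : (\bigcup_k G k) (tl x) by rewrite -UG.
  exists (maxn i j) => //; split.
    by have /subsetPset := ndF _ _ (leq_maxl i j); exact.
  by have /subsetPset := ndG _ _ (leq_maxr i j); exact.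
move=> k; have [mF Fk] := Foo k; have [mG Gk] := Goo k; split.
  rewrite -[X in measurable X]setTI; apply: muncons => //.
  exact: measurableX.
rewrite /rV_cons_measure /pushforward -comp_preimage unconsK preimage_id.
by rewrite product_measure1E// lte_mul_pinfty// ge0_fin_numE.
Qed.

HB.instance Definition _ := Measure_isSigmaFinite.Build _ _ _ rV_cons_measure
  rV_cons_measure_sigma_finite.
End cons.

(* Product of [n] copies of the Lebesgue measure of [R]. *)
Fixpoint lebesgue_rV (R : realType) (n : nat) :
    {sigma_finite_measure set 'rV[R]_n -> \bar R} :=
  if n is n'.+1 then rV_cons_measure (lebesgue_rV R n')
  else \d_(0 : 'rV[R]_0).

Section euclidean.
Context {R : realType} {n : nat}.
Implicit Types x y : 'rV[R]_n.

Definition dot x y : R := \sum_i x 0 i * y 0 i.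
Definition enorm x : R := Num.sqrt (dot x x).
(* [ediam set0 = -oo] *)
Definition ediam (C : set 'rV[R]_n) : \bar R :=
  ereal_sup [set (enorm (x - y))%:E | x in C & y in C].

Lemma ler_coord_enorm x i : `|x 0 i| <= enorm x.
Proof.
rewrite -sqrtr_sqr ler_wsqrtr// /dot (bigD1 i)//= -expr2 lerDl sumr_ge0// => j _.
by rewrite -expr2 sqr_ge0.
Qed.
End euclidean.

Definition unit_ball_volume (R : realType) (m : nat) : R :=
  fine (lebesgue_rV R m [set x | enorm x <= 1]).

Section hausdorff.
Context {R : realType} {n : nat}.
Context (m : nat).
Local Open Scope ereal_scope.
Implicit Types (A B C : set 'rV[R]_n) (d : R).

(* The normalization [unit_ball_volume R m / 2 ^+ m] is the usual one, for which
   the m-dimensional measure agrees with the Lebesgue measure when [n = m]. The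
   power [x ^+ 0] is [1], so that for [m = 0] one gets the counting measure. *)
Definition hausdorff_gauge C : \bar R :=
  if C == set0 then 0 else (unit_ball_volume R m / 2 ^+ m)%:E * ediam C ^+ m.

Definition diam_cover d A : set ((set 'rV[R]_n)^nat) :=
  [set C | (forall k, ediam (C k) <= d%:E) /\ A `<=` \bigcup_k C k].

Definition hausdorff_pre d A : \bar R :=
  ereal_inf [set \sum_(k <oo) hausdorff_gauge (C k) | C in diam_cover d A].

Definition hausdorff A : \bar R :=
  ereal_sup [set hausdorff_pre d A | d in [set d | (0 < d)%R]].

Let ub_ge0 : (0 <= unit_ball_volume R m)%R.
Proof. by rewrite fine_ge0// measure_ge0. Qed.

Lemma hausdorff_gauge_ge0 C : 0 <= hausdorff_gauge C.
Proof.
rewrite /hausdorff_gauge; case: ifPn => // /set0P[x Cx].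
rewrite mule_ge0 ?lee_fin ?divr_ge0 ?exprn_ge0//.
suff d0 : 0 <= ediam C by elim: m => // k ih; rewrite expeS mule_ge0.
apply: ereal_sup_ubound; exists x => //; exists x => //.
congr EFin; rewrite /enorm /dot big1 ?sqrtr0// => i _.
by rewrite !mxE subrr mul0r.
Qed.
Hint Resolve hausdorff_gauge_ge0 : core.

Let gauge0 : hausdorff_gauge set0 = 0.
Proof. by rewrite /hausdorff_gauge eqxx. Qed.

Let ediam0 d : ediam (set0 : set 'rV[R]_n) <= d%:E.
Proof. by apply: ge_ereal_sup => _ [x []]. Qed.

Lemma hausdorff_pre_ge0 d A : 0 <= hausdorff_pre d A.
Proof.
by apply: le_ereal_inf_tmp => _ [C _ <-]; apply: nneseries_ge0 => *.
Qed.

Lemma hausdorff_pre0 d : hausdorff_pre d set0 = 0.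
Proof.
apply/eqP; rewrite eq_le hausdorff_pre_ge0 andbT.
apply: ereal_inf_lbound; exists (fun=> set0); first by split.
by rewrite eseries0.
Qed.

Lemma le_hausdorff_pre d A B : A `<=` B -> hausdorff_pre d A <= hausdorff_pre d B.
Proof.
move=> AB; apply: ereal_inf_le_tmp => _ [C [Cd BC] <-]; exists C => //.
by split=> //; exact: subset_trans BC.
Qed.

Lemma hausdorff_pre_anti d d' A : (d <= d')%R ->
  hausdorff_pre d' A <= hausdorff_pre d A.
Proof.
move=> dd'; apply: ereal_inf_le_tmp => _ [C [Cd AC] <-]; exists C => //.
by split=> // k; rewrite (le_trans (Cd k))// lee_fin.
Qed.

Let T := g_sigma_algebraType [set: set 'rV[R]_n].

Let g d (C : set T) : \bar R :=
  if ediam (C : set 'rV[R]_n) <= d%:E then hausdorff_gauge C else +oo.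

Let g_ge0 d C : 0 <= g d C.
Proof. by rewrite /g; case: ifP. Qed.

Let g0 d : g d set0 = 0.
Proof. by rewrite /g ediam0. Qed.

Let hausdorff_preE d A : hausdorff_pre d A = mu_ext (g d) A.
Proof.
apply/eqP; rewrite eq_le; apply/andP; split; apply: le_ereal_inf_tmp.
  move=> _ [C [mC AC] <-].
  have [Cd|] := pselect (forall k, ediam (C k : set 'rV[R]_n) <= d%:E).
    apply: ereal_inf_lbound; exists C => //.
    by apply: eq_eseriesr => k _; rewrite /g Cd.
  move=> /existsNP[k /negP Ck]; rewrite (@eseries_pinfty _ _ _ k) ?leey//.
    by move=> i _; rewrite -ltNye; apply: lt_le_trans (g_ge0 _ _).
  by rewrite /g (negbTE Ck).
move=> _ [C [Cd AC] <-]; apply: ereal_inf_lbound; exists C.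
  by split => // i; exact: sub_sigma_algebra.
by apply: eq_eseriesr => k _; rewrite /g Cd.
Qed.

Let hausdorff_pre_sigma_subadditive d : sigma_subadditive (hausdorff_pre d).
Proof.
move=> F; rewrite hausdorff_preE.
rewrite (eq_eseriesr (g := fun i => mu_ext (g d) (F i : set T))); last first.
  by move=> i _; rewrite hausdorff_preE.
exact: (@mu_ext_sigma_subadditive _ (g_sigma_algebraType [set: set 'rV[R]_n]) R (g d) (g_ge0 d)).
Qed.

Let hausdorff_ge d A : (0 < d)%R -> hausdorff_pre d A <= hausdorff A.
Proof. by move=> d0; apply: ereal_sup_ubound; exists d. Qed.

Let hausdorff0 : hausdorff set0 = 0.
Proof.
apply/eqP; rewrite eq_le; apply/andP; split.
  by apply: ge_ereal_sup => _ [d _ <-]; rewrite hausdorff_pre0.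
by rewrite -(hausdorff_pre0 1) hausdorff_ge.
Qed.

Let hausdorff_ge0 A : 0 <= hausdorff A.
Proof. by apply: le_trans (hausdorff_ge A ltr01); exact: hausdorff_pre_ge0. Qed.

Let le_hausdorff : {homo hausdorff : A B / A `<=` B >-> A <= B}.
Proof.
move=> A B AB; apply: ge_ereal_sup => _ [d d0 <-].
by apply: le_trans (le_hausdorff_pre d AB) _; exact: hausdorff_ge.
Qed.

Let hausdorff_sigma_subadditive : sigma_subadditive hausdorff.
Proof.
move=> F; apply: ge_ereal_sup => _ [d d0 <-].
apply: le_trans (@hausdorff_pre_sigma_subadditive d F) _.
by apply: lee_nneseries => *; [exact: hausdorff_pre_ge0|exact: hausdorff_ge].
Qed.

HB.instance Definition _ := isOuterMeasure.Build R 'rV[R]_n hausdorff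
  hausdorff0 hausdorff_ge0 le_hausdorff hausdorff_sigma_subadditive.

Lemma hausdorff_metric A B (e : R) : (0 < e)%R ->
  (forall x y, A x -> B y -> (e <= enorm (x - y))%R) ->
  hausdorff A + hausdorff B <= hausdorff (A `|` B).
Proof.
move=> e0 AB.
have pre d : (d < e)%R ->
    hausdorff_pre d A + hausdorff_pre d B <= hausdorff_pre d (A `|` B).
  move=> de; apply: le_ereal_inf_tmp => _ [C [Cd ABC] <-].
  pose meets k := `[< C k `&` A !=set0 >].
  pose C1 k := if meets k then C k else set0.
  pose C2 k := if meets k then set0 else C k.
  apply: (@le_trans _ _ (\sum_(k <oo) hausdorff_gauge (C1 k) +
                         \sum_(k <oo) hausdorff_gauge (C2 k))).
    apply: leeD; apply: ereal_inf_lbound.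
      exists C1 => //; split=> [k|x Ax]; first by rewrite /C1; case: ifP.
      have [k _ Ckx] := ABC _ (or_introl Ax); exists k => //.
      by rewrite /C1 ifT//; apply/asboolP; exists x.
    exists C2 => //; split=> [k|y By]; first by rewrite /C2; case: ifP.
    have [k _ Cky] := ABC _ (or_intror By); exists k => //.
    rewrite /C2 ifF//; apply/negP => /asboolP[x [Ckx Ax]].
    have : (enorm (x - y))%:E <= d%:E.
      by apply: le_trans (Cd k); apply: ereal_sup_ubound; exists x => //; exists y.
    by rewrite lee_fin leNgt (lt_le_trans de)//; exact: AB.
  rewrite -nneseriesD//; apply: lee_nneseries => [k _|k _].
    by rewrite adde_ge0.
  by rewrite /C1 /C2; case: ifP; rewrite gauge0 ?adde0 ?add0e.
have [HB|HB] := eqVneq (hausdorff B) +oo.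
  have : hausdorff B <= hausdorff (A `|` B) by apply: le_hausdorff => x; right.
  by rewrite HB leye_eq => /eqP ->; rewrite leey.
have HBf : hausdorff B \is a fin_num by rewrite ge0_fin_numE// ltey.
rewrite -leeBrDr//; apply: ge_ereal_sup => _ [d1 /= d10 <-].
rewrite leeBrDr//.
have [H1|H1] := eqVneq (hausdorff_pre d1 A) +oo.
  have : hausdorff A <= hausdorff (A `|` B) by apply: le_hausdorff => x; left.
  apply: le_trans; apply: le_trans (hausdorff_ge A d10).
  by rewrite H1 leey.
have H1fin : hausdorff_pre d1 A \is a fin_num.
  by rewrite ge0_fin_numE ?ltey// hausdorff_pre_ge0.
rewrite addeC -leeBrDr//; apply: ge_ereal_sup => _ [d2 /= d20 <-].
rewrite leeBrDr//.
pose d := (Num.min (Num.min d1 d2) (e / 2))%R.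
have d0 : (0 < d)%R by rewrite !lt_min d10 d20 divr_gt0.
apply: le_trans (hausdorff_ge _ d0).
apply: le_trans (pre d _); last first.
  by rewrite /d gt_min ltr_pdivrMr// ltr_pMr// ltr1n orbT.
rewrite addeC; apply: leeD; apply: hausdorff_pre_anti.
  by rewrite /d !ge_min lexx.
by rewrite /d !ge_min lexx orbT.
Qed.

Lemma hausdorff_caratheodory_halfspace (i : 'I_n) (a : R) :
  hausdorff.-caratheodory [set x : 'rV[R]_n | (x 0 i <= a)%R].
Proof.
set C := (X in _.-caratheodory X).
apply: le_caratheodory_measurable => X.
rewrite /=; have [HX|HX] := eqVneq (hausdorff X) +oo; first by rewrite HX leey.
have HXf : hausdorff X < +oo by rewrite ltey.
pose t k : R := (a + k.+1%:R^-1)%R.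
pose X_ k := X `&` [set x | (t k <= x 0 i)%R].
pose D k := X_ k.+2 `\` X_ k.+1.
have sep (A B : set 'rV[R]_n) (s r : R) : (s < r)%R ->
    (forall x, A x -> (x 0 i <= s)%R) -> (forall x, B x -> (r <= x 0 i)%R) ->
    hausdorff A + hausdorff B <= hausdorff (A `|` B).
  move=> sr As Br; apply: (@hausdorff_metric _ _ (r - s)%R).
    by rewrite subr_gt0.
  move=> x y /As xs /Br ry; apply: le_trans (ler_coord_enorm _ i).
  by rewrite !mxE distrC (le_trans _ (ler_norm _))// lerB.
have ltt k : (t k.+1 < t k)%R by rewrite /t ltrD2l ltf_pV2 ?posrE// ltr_nat.
have let_ k l : (k <= l)%N -> (t l <= t k)%R.
  by move=> kl; rewrite /t lerD2l lef_pV2 ?posrE// ler_nat.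
have DX k : D k `<=` X by move=> x [[]].
have Dlt k x : D k x -> (x 0 i <= t k.+1)%R.
  move=> [[Xx _]]; rewrite /X_ /= => /not_andP[//|/negP].
  by rewrite -ltNge => /ltW.
have Dge k x : D k x -> (t k.+2 <= x 0 i)%R by move=> [[_]].
have alt b N : \sum_(k < N) hausdorff (D (b + k.*2)%N) <=
    hausdorff (\big[setU/set0]_(k < N) D (b + k.*2)%N).
  elim: N => [|N ih]; first by rewrite !big_ord0 outer_measure0.
  rewrite !big_ord_recr/= addeC setUC.
  apply: le_trans (leeD2l _ ih) _.
  apply: (@sep _ _ (t (b + N.*2).+1) (t (b + N.*2)%N)) => //; first exact: Dlt.
  move=> x; rewrite -(bigcup_mkord N (fun k => D (b + k.*2)%N)) => -[k /= kN].
  move=> /Dge; apply: le_trans; apply: let_.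
  by rewrite -!addnS leq_add2l -doubleS leq_double.
have altX b N : \sum_(k < N) hausdorff (D (b + k.*2)%N) <= hausdorff X.
  apply: le_trans (alt b N) _; apply: le_outer_measure.
  by rewrite -(bigcup_mkord N (fun k => D (b + k.*2)%N)) => x [k _ /DX].
have sumD2 N : \sum_(k < N.*2) hausdorff (D k) =
    \sum_(k < N) hausdorff (D (0 + k.*2)%N) +
    \sum_(k < N) hausdorff (D (1 + k.*2)%N).
  elim: N => [|N ih]; first by rewrite !big_ord0 adde0.
  by rewrite doubleS !big_ord_recr/= ih -!addeA; congr (_ + _); rewrite addeCA.
have sumD : \sum_(k <oo) hausdorff (D k) < +oo.
  apply: (@le_lt_trans _ _ (hausdorff X + hausdorff X)).
    apply: lime_le; first by apply: is_cvg_nneseries => *; exact: outer_measure_ge0.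
    apply: nearW => N; rewrite big_mkord.
    apply: le_trans (leeD (altX 0%N N) (altX 1%N N)); rewrite -sumD2.
    rewrite -(big_mkord xpredT (fun k => hausdorff (D k))).
    rewrite -(big_mkord xpredT (fun k => hausdorff (D k))).
    rewrite (@big_cat_nat _ _ _ N 0 N.*2)//= ?leeDl//; last by rewrite -addnn leq_addr.
    by apply: sume_ge0 => *; exact: outer_measure_ge0.
  by rewrite lte_add_pinfty.
have tail := nneseries_tail_cvg sumD (fun k _ => outer_measure_ge0 _ (D k)).
apply/lee_addgt0Pr => e e0.
have [N HN] : exists N, \sum_(N <= k <oo) hausdorff (D k) <= e%:E.
  have := tail [set y | y < e%:E].
  case; first by apply: open_ereal_lt_ereal => /=; rewrite lte_fin.
  by move=> N _ /(_ N (leqnn N))/= /ltW; exists N.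
apply: (@le_trans _ _ (hausdorff (X `&` C) + (hausdorff (X_ N.+1) + e%:E))).
  apply: leeD2l.
  apply: (@le_trans _ _ (hausdorff (X_ N.+1 `|` \bigcup_(k in ~` `I_N) D k))).
    apply: le_outer_measure => x [Xx]; rewrite /C /= => /negP; rewrite -ltNge => ax.
    have [tx|tx] := leP (t N.+1) (x 0 i)%R; [by left|right].
    have [m0 tm0] : exists m, (t m <= x 0 i)%R.
      exists (Num.truncn (x 0 i - a)^-1)%R; rewrite /t -lerBrDl.
      rewrite -[leRHS]invrK lef_pV2 ?posrE ?invr_gt0 ?subr_gt0//.
      by rewrite ltW// truncnS_gt.
    have [k tk kmin] := @ex_minnP (fun m => t m <= x 0 i)%R (ex_intro _ m0 tm0).
    have Nk : (N.+1 < k)%N.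
      by rewrite ltnNge; apply/negP => /let_ /le_trans/(_ tk); rewrite leNgt tx.
    case: k tk kmin Nk => [//|[//|k]] tk kmin Nk; exists k.
      by apply/negP; rewrite -leqNgt.
    by split=> //; move=> [_ /= /kmin]; rewrite ltnn.
  apply: le_trans (outer_measureU2 _ _ _) _; apply: leeD2l.
  exact: le_trans (outer_measure_sigma_subadditive_tail _ _ _) HN.
rewrite addeA leeD2r//.
apply: le_trans (@sep _ _ a (t N.+1) _ _ _) _ => //.
- by rewrite /t ltrDl.
- by move=> x [].
- by move=> x [].
- by apply: le_outer_measure => x [[]|[]].
Qed.

Let halfspace_lt (i : 'I_n) (a : R) :
  hausdorff.-cara.-measurable [set x : 'rV[R]_n | (x 0%R i < a)%R].
Proof.
rewrite (_ : mkset _ =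
    \bigcup_k [set x : 'rV[R]_n | (x 0%R i <= a - k.+1%:R^-1)%R]).
  by apply: bigcupT_measurable => k; exact: hausdorff_caratheodory_halfspace.
apply/seteqP; split=> [x /= xa|x [k _ /=]]; last first.
  by move=> /le_lt_trans; apply; rewrite ltrBlDr ltrDl.
exists (Num.truncn (a - x 0%R i)^-1)%R => //=.
rewrite lerBrDr addrC -lerBrDr -[leRHS]invrK lef_pV2 ?posrE ?invr_gt0 ?subr_gt0//.
by rewrite ltW// truncnS_gt.
Qed.

Let borel_caratheodory (A : set 'rV[R]_n) :
  measurable A -> hausdorff.-cara.-measurable A.
Proof.
apply: smallest_sub => [|U oU].
  split; first exact: measurable0.
    by move=> B mB; rewrite setTD; exact: measurableC.
  by move=> F mF; exact: bigcupT_measurable.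
rewrite (open_bigcup_rV_box oU) bigcup_mkcond.
apply: countable_bigcupT_measurable => [|[a b]]; first exact: countableP.
case: ifPn => // _ /=.
rewrite (_ : rV_box a b = \bigcap_(i in [set: 'I_n])
    (~` [set x : 'rV[R]_n | (x 0 i <= ratr (a 0 i))%R] `&`
     [set x : 'rV[R]_n | (x 0 i < ratr (b 0 i))%R])).
  apply: fin_bigcap_measurable => // i _; apply: measurableI => //.
  by apply: measurableC; exact: hausdorff_caratheodory_halfspace.
apply/seteqP; split=> [x xab i _|x xab i].
  by have /andP[a_ b_] := xab i; split=> //=; apply/negP; rewrite -ltNge.
by have [/= /negP] := xab i Logic.I; rewrite -ltNge => -> ->.
Qed.

Definition hausdorff_measure : set 'rV[R]_n -> \bar R := hausdorff.

Let hausdorff_measure0 : hausdorff_measure set0 = 0.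
Proof. exact: hausdorff0. Qed.

Let hausdorff_measure_ge0 A : 0 <= hausdorff_measure A.
Proof. exact: hausdorff_ge0. Qed.

Let hausdorff_measure_sigma_additive : semi_sigma_additive hausdorff_measure.
Proof.
move=> F mF tF mUF; apply: (caratheodory_measure_sigma_additive (mu := hausdorff)) => //.
  by move=> k; exact: borel_caratheodory.
exact: borel_caratheodory.
Qed.

HB.instance Definition _ := isMeasure.Build _ _ _ hausdorff_measure
  hausdorff_measure0 hausdorff_measure_ge0 hausdorff_measure_sigma_additive.

End hausdorff.

Section calculus.
Context {R : realType} {n : nat}.
Implicit Types (D : set 'rV[R]_n) (g : 'rV[R]_n -> R).

Definition partial (i : 'I_n) g : 'rV[R]_n -> R :=
  fun x => 'D_(delta_mx 0 i) g x.

Definition grad g (x : 'rV[R]_n) : 'rV[R]_n := \row_i partial i g x.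

Definition hessian g (x : 'rV[R]_n) : 'M[R]_n :=
  \matrix_(i, j) partial j (partial i g) x.

(* [g] is of class C^k on the open set [D]. *)
Fixpoint class_C (k : nat) D g : Prop :=
  (forall x, D x -> {for x, continuous g}) /\
  if k is k'.+1 then
    forall i : 'I_n, (forall x, D x -> derivable g x (delta_mx 0 i)) /\
                     class_C k' D (partial i g)
  else True.

Definition positive_definite (A : 'M[R]_n) : Prop :=
  forall v : 'rV[R]_n, v != 0 -> 0 < (v *m A *m v^T) 0 0.

(* Filter of the complements of bounded sets: [x --> at_infty] stands for
   ||x|| -> +oo. *)
Definition at_infty : set_system 'rV[R]_n :=
  [set A | exists r : R, forall x, r < enorm x -> A x].

Definition boundary (K : set 'rV[R]_n) : set 'rV[R]_n := closure K `\` K°.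

End calculus.

Section convex_bodies.
Context {R : realType} {n : nat}.
Implicit Types (K : set 'rV[R]_n) (g : 'rV[R]_n -> R).

Definition convex_body K : Prop := compact K /\ convex_set K.

Definition unit_normal g (x : 'rV[R]_n) : 'rV[R]_n :=
  (enorm (grad g x))^-1 *: grad g x.

(* Gauss curvature at [x] of the hypersurface [g = g x], i.e., the determinant
   of the shape operator (the differential of the unit normal field [nu],
   restricted to the tangent hyperplane, which is the orthogonal of [nu x]). The
   differential of [nu] takes its values in that hyperplane, so that adding the
   orthogonal projection [(nu x)^T *m nu x] onto the normal line gives an
   endomorphism of the whole space with the same determinant. *)
Definition gauss_curvature g (x : 'rV[R]_n) : R :=
  \det ('J (unit_normal g) x + (unit_normal g x)^T *m unit_normal g x).

(* [g] is a C^2 function on the open set [U], without critical points, whose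
   sublevel set [g <= 0] is [K] in [U]; the boundary of [K] in [U] is then the
   C^2 hypersurface [g = 0], with outer unit normal [unit_normal g]. *)
Definition C2_local_equation K (U : set 'rV[R]_n) g : Prop :=
  [/\ open U, class_C 2 U g, (forall x, U x -> grad g x != 0) &
      K `&` U = [set x | g x <= 0] `&` U].

Definition C2plus K : Prop :=
  forall p, boundary K p ->
    exists U, exists g,
      [/\ U p, C2_local_equation K U g & 0 < gauss_curvature g p].

Definition outer_unit_normal K (x v : 'rV[R]_n) : Prop :=
  enorm v = 1 /\ forall y, K y -> dot (y - x) v <= 0.

Definition gauss_map K (x : 'rV[R]_n) : 'rV[R]_n :=
  xget 0 [set v | outer_unit_normal K x v].

End convex_bodies.

Section function_classes.
Context {R : realType} {n : nat}.
Implicit Types (u : 'rV[R]_n -> \bar R) (f : 'rV[R]_n -> R).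

Definition dom u : set 'rV[R]_n := [set x | u x \is a fin_num].

Definition convex_efunction u : Prop :=
  forall x y (t : R), 0 <= t <= 1 ->
    (u (t *: x + (1 - t) *: y)%R <= t%:E * u x + (1 - t)%:E * u y)%E.

Definition class_L u : Prop :=
  [/\ forall x, u x != -oo%E, dom u !=set0, convex_efunction u &
      u x @[x --> at_infty] --> +oo%E].

Definition class_L' u : Prop :=
  [/\ class_L u, dom u = setT, class_C 2 setT (fine \o u),
      (forall x, positive_definite (hessian (fine \o u) x)) &
      fine (u x) / enorm x @[x --> at_infty] --> +oo].

Definition gradient_blowup u : Prop :=
  forall M : R, exists2 d : R, 0 < d &
    forall x, (dom u)° x ->
      (exists2 z, boundary (dom u) z & enorm (x - z) < d) ->
      M < enorm (grad (fine \o u) x).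

Definition class_L'' u : Prop :=
  [/\ class_L u,
      [/\ convex_body (dom u), (dom u)° !=set0 & C2plus (dom u)],
      class_C 2 (dom u)° (fine \o u) /\
        (forall x, (dom u)° x -> positive_definite (hessian (fine \o u) x)),
      {within dom u, continuous u} &
      gradient_blowup u].

Definition exp_neg u : 'rV[R]_n -> R := fun x => fine (expeR (- u x)).

Definition class_A' : set ('rV[R]_n -> R) := [set exp_neg u | u in class_L'].

Definition class_A'' : set ('rV[R]_n -> R) := [set exp_neg u | u in class_L''].

(* The function [u] such that [f] is [exp_neg u]; [lne 0 = -oo]. *)
Definition potential f : 'rV[R]_n -> \bar R := fun x => (- lne (f x)%:E)%E.

End function_classes.

Section moment_measures.
Context {R : realType} {n : nat}.
Implicit Types (f : 'rV[R]_n -> R) (m : set 'rV[R]_n -> \bar R)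
  (D : set 'rV[R]_n).

(* The measure with density [f] with respect to [m] restricted to [D]. *)
Definition density_measure m D f : set 'rV[R]_n -> \bar R :=
  fun A => (\int[m]_(x in A `&` D) (f x)%:E)%E.

Definition mu f : set 'rV[R]_n -> \bar R :=
  pushforward (density_measure (lebesgue_rV R n) (dom (potential f))° f)
    (grad (fine \o potential f)).

Definition sphere : set 'rV[R]_n := [set y | enorm y = 1].

(* A measure on the unit sphere is seen as a measure on the ambient space that
   is carried by [sphere]. *)
Definition sigma f : set 'rV[R]_n -> \bar R :=
  pushforward
    (density_measure (hausdorff_measure n.-1) (boundary (dom (potential f))) f)
    (gauss_map (dom (potential f))).

(* Componentwise integrability and integral of the identity of R^n. *)
Definition vintegrable m D : Prop :=
  forall i : 'I_n, m.-integrable D (fun y : 'rV[R]_n => (y 0 i)%:E).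

Definition vintegral m D : 'rV[R]_n :=
  \row_i fine (\int[m]_(y in D) (y 0 i)%:E)%E.

End moment_measures.

(* Main.v *)
From HB Require Import structures.
Require Import Defs.
From mathcomp Require Import all_boot all_order all_algebra.
From mathcomp Require Import all_classical all_reals all_analysis.
From mathcomp Require Import measurable_realfun.
From mathcomp Require Import lra ring.
Import Order.TTheory GRing.Theory Num.Theory.
Import numFieldNormedType.Exports.
Local Open Scope classical_set_scope.
Local Open Scope ring_scope.
Set Implicit Arguments.
Unset Strict Implicit.
Unset Printing Implicit Defensive.

(** Write D for the interior of dom u. As f = exp (- u), the i-th coordinate of
    the moment of mu f is the integral over D of f * partial i u, that is, minus
    the integral of partial i f. Integrate first along the lines parallel to the
    i-th axis. Such a line meets D in an open interval, on which f is unimodal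
    because u is convex. Hence the integral of |partial i f| over this interval
    is at most twice the supremum of f there (unimodal_ftc), so that Fubini's
    theorem applies and yields (moment_measure_coord)

        int y_i dmu(f)(y) = - int (f_+ - f_-),

    where the right-hand integral runs over the projection of D along the axis,
    and f_- and f_+ are the limits of f at the two ends of the interval.

    If dom u is the whole space, then superlinear growth gives a bound
    f <= C exp (- |x|). It dominates all the integrals, and f_+ = f_- = 0.

    If dom u is a body K, then f_+ and f_- are the values of f at the points
    where the line leaves and enters K. The projection along the axis maps
    injectively the part of the boundary where the i-th coordinate of the normal
    nu is positive, and the part where it is negative, onto the projection of D,
    with Jacobian |nu_i| (ge0_integral_boundary_side). So the integral of
    f_+ - f_- is the surface integral of f * nu_i, which is the i-th coordinate
    of the moment of sigma f, and the two moments cancel.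

    Most of the work is the Jacobian formula for the Hausdorff measure
    (ge0_integral_graph). On a piece of the boundary where nu stays close to a
    fixed vector v, convexity makes every chord almost orthogonal to v. Such a
    piece is therefore almost isometric to the part above it of the hyperplane
    orthogonal to v (local_area). Countably many pieces cover, and the
    distortion tends to 1 when they are refined. The measure of a part of a
    hyperplane comes from the equality of m-dimensional Hausdorff and Lebesgue
    measure in dimension m (hausdorff_lebesgue). There, one inequality is the
    isodiametric inequality, deduced from the Brunn-Minkowski inequality for a
    set and its opposite; the other one comes from filling open sets with
    balls. *)

(** * Lebesgue measure on row vectors *)

Section borel_rV.
Context {R : realType}.

Definition obox m (a b : 'rV[R]_m) : set 'rV[R]_m :=
  [set x | forall i, a 0 i < x 0 i < b 0 i].

Lemma rV_boxE m (a b : 'rV[rat]_m) :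
  rV_box a b = obox (map_mx ratr a) (map_mx ratr b) :> set 'rV[R]_m.
Proof.
by apply/seteqP; split=> x xab i; have := xab i; rewrite !mxE.
Qed.

Lemma open_obox m (a b : 'rV[R]_m) : open (obox a b).
Proof.
rewrite openE => x xab.
exists (fun _ i => `]a 0 i, b 0 i[%classic).
  move=> i j; rewrite (ord1 i); apply: open_nbhs_nbhs.
  by split; [exact: interval_open|rewrite /= in_itv/=; exact: xab].
by move=> y ys i; have := ys 0 i; rewrite /= in_itv.
Qed.

Lemma measurable_obox m (a b : 'rV[R]_m) : measurable (obox a b).
Proof. by apply: open_measurable_rV; exact: open_obox. Qed.

Lemma closed_measurable_rV m (F : set 'rV[R]_m) : closed F -> measurable F.
Proof.
by move=> cF; rewrite -[F]setCK; apply: measurableC; apply: open_measurable_rV; rewrite openC.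
Qed.

Lemma measurable_coord m (i : 'I_m) :
  measurable_fun setT (fun x : 'rV[R]_m => x 0 i).
Proof.
apply: (measurability _ (measurable_realfun.RGenOpens.measurableE R)) => //.
move=> _ [_ [a [b ->] <-]]; rewrite setTI; apply: open_measurable_rV.
apply: open_comp => [x _|]; last exact: interval_open.
exact: coord_continuous.
Qed.

Lemma measurable_fun_rV d (T : measurableType d) m (D : set T)
    (f : T -> 'rV[R]_m) :
  (forall i, measurable_fun D (fun x => f x 0 i)) -> measurable_fun D f.
Proof.
move=> mf mD.
apply: (@measurability _ _ _ _ _ _ (@open 'rV[R]_m)) => //.
move=> _ [U oU <-]; rewrite (open_bigcup_rV_box oU) preimage_bigcup setI_bigcupr.
rewrite bigcup_mkcond; apply: countable_bigcupT_measurable => [|[a b]].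
  exact: countableP.
case: ifPn => // _ /=.
rewrite (_ : _ `&` _ = \bigcap_(i in [set: 'I_m])
    (D `&` (fun x => f x 0 i) @^-1` `]ratr (a 0 i), ratr (b 0 i)[%classic) `&` D).
  apply: measurableI => //; apply: fin_bigcap_measurable => // i _.
  by apply: mf => //; exact: measurable_itv.
apply/seteqP; split=> [x [Dx xab]|x [H Dx]]; split => // i.
  by move=> _; split=> //=; rewrite in_itv; exact: xab.
by have [_] := H i Logic.I; rewrite /= in_itv.
Qed.

Lemma measurable_fun_coord d (T : measurableType d) m (D : set T)
    (f : T -> 'rV[R]_m) i : measurable_fun D f ->
  measurable_fun D (fun x => f x 0 i).
Proof. exact: measurableT_comp (measurable_coord i). Qed.

Lemma continuous_measurable_fun_rV m (f : 'rV[R]_m -> R) (D : set 'rV[R]_m) :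
  open D -> (forall x, D x -> {for x, continuous f}) -> measurable_fun D f.
Proof.
move=> oD cf mD.
apply: (measurability _ (measurable_realfun.RGenOpens.measurableE R)) => //.
move=> _ [_ [a [b ->] <-]].
have oE : open (D `&` f @^-1` `]a, b[).
  rewrite openE => x [Dx fx]; apply: filterI; first exact: open_nbhs_nbhs.
  apply: cf => //; apply: open_nbhs_nbhs; split => //; exact: interval_open.
exact: open_measurable_rV.
Qed.

Lemma measurability_obox m :
  measurable = <<s [set A : set 'rV[R]_m | exists ab, A = obox ab.1 ab.2] >>.
Proof.
apply/seteqP; split; last first.
  apply: smallest_sub.
    by split; [exact: measurable0|move=> A mA; rewrite setTD; exact: measurableC|
      move=> F mF; exact: bigcupT_measurable].
  by move=> _ [ab ->]; exact: measurable_obox.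
apply: smallest_sub; first exact: smallest_sigma_algebra.
move=> U oU; rewrite (open_bigcup_rV_box oU) bigcup_mkcond.
set G := (X in <<s X >>).
apply: (@countable_bigcupT_measurable _ (g_sigma_algebraType G)).
  exact: countableP.
move=> [a b]; case: ifPn => _; last exact: measurable0.
rewrite rV_boxE; apply: sub_sigma_algebra.
by exists (map_mx ratr a, map_mx ratr b).
Qed.

(** Open boxes form a pi-system that generates the Borel sets. *)
Lemma rV_measure_unique m (m1 m2 : {measure set 'rV[R]_m -> \bar R}) :
  (forall a b, m1 (obox a b) = m2 (obox a b)) ->
  (forall a b, (m1 (obox a b) < +oo)%E) ->
  forall A, measurable A -> m1 A = m2 A.
Proof.
move=> m12 m1oo.
apply: (measure_unique [set A | exists ab, A = obox ab.1 ab.2]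
  (fun k => obox (const_mx (- k%:R)) (const_mx k%:R))).
- exact: measurability_obox.
- move=> _ _ [[a b]/= ->] [[c d]/= ->].
  exists (\row_i Num.max (a 0 i) (c 0 i), \row_i Num.min (b 0 i) (d 0 i)) => /=.
  apply/seteqP; split=> [x [xab xcd] i|x x_].
    have := xab i; have := xcd i; rewrite !mxE gt_max lt_min.
    by move=> /andP[cx xd] /andP[ax xb]; rewrite ax xb cx xd.
  split=> i; have := x_ i; rewrite !mxE gt_max lt_min.
    by move=> /andP[/andP[-> _] /andP[-> _]].
  by move=> /andP[/andP[_ ->] /andP[_ ->]].
- by move=> k; exists (const_mx (- k%:R), const_mx k%:R).
- rewrite -subTset => x _; exists (Num.truncn (\sum_i `|x 0 i|)).+1 => // i.
  rewrite !mxE -ltr_norml; apply: le_lt_trans (truncnS_gt _).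
  by rewrite (bigD1 i)//= lerDl sumr_ge0.
- by move=> _ [[a b] ->]; exact: m12.
- by [].
Qed.

End borel_rV.

Section insert.
Context {R : realType} {m : nat}.
Implicit Types (i : 'I_m.+1) (y : 'rV[R]_m) (x : 'rV[R]_m.+1) (s : R).

(** Adding and deleting the i-th coordinate split R^(m+1) into the i-th axis and
    the hyperplane orthogonal to it. *)
Definition rV_ins i s y : 'rV[R]_m.+1 :=
  \row_j if unlift i j is Some k then y 0 k else s.
Definition rV_del i x : 'rV[R]_m := \row_k x 0 (lift i k).

Lemma rV_ins_eq i s y : rV_ins i s y 0 i = s.
Proof. by rewrite mxE unlift_none. Qed.

Lemma rV_ins_lift i s y k : rV_ins i s y 0 (lift i k) = y 0 k.
Proof. by rewrite mxE liftK. Qed.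

Lemma rV_delK i x : rV_ins i (x 0 i) (rV_del i x) = x.
Proof. by apply/rowP => j; rewrite mxE; case: unliftP => [k|] ->; rewrite ?mxE. Qed.

Lemma rV_insK i s y : rV_del i (rV_ins i s y) = y.
Proof. by apply/rowP => j; rewrite mxE rV_ins_lift. Qed.

Lemma rV_consE p : rV_cons p = rV_ins ord0 p.1 p.2.
Proof. by apply/rowP => j; rewrite !mxE. Qed.

Lemma measurable_rV_ins i :
  measurable_fun setT (fun p : R * 'rV[R]_m => rV_ins i p.1 p.2).
Proof.
apply: measurable_fun_rV => j.
have [k ->|->] := unliftP i j; last first.
  by apply: eq_measurable_fun (@measurable_fst _ _ _ _) => p _; rewrite rV_ins_eq.
apply: (eq_measurable_fun (fun p : R * 'rV[R]_m => p.2 0 k)).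
  by move=> p _; rewrite rV_ins_lift.
exact: measurable_fun_coord measurable_snd.
Qed.

Lemma preimage_rV_ins_obox i (a b : 'rV[R]_m.+1) :
  (fun p => rV_ins i p.1 p.2) @^-1` obox a b =
  `]a 0 i, b 0 i[%classic `*` obox (rV_del i a) (rV_del i b).
Proof.
apply/seteqP; split=> [p pab|p [p1 p2] j].
  split; first by have := pab i; rewrite rV_ins_eq /= in_itv.
  by move=> k; have := pab (lift i k); rewrite rV_ins_lift !mxE.
have [k ->|->] := unliftP i j; last by move: p1; rewrite rV_ins_eq /= in_itv.
by rewrite rV_ins_lift; have := p2 k; rewrite !mxE.
Qed.

End insert.

Section lebesgue_rV_theory.
Context {R : realType}.
Local Open Scope ereal_scope.

Lemma lebesgue_rV_succ m A :
  lebesgue_rV R m.+1 A = (@lebesgue_measure R \x lebesgue_rV R m) (rV_cons @^-1` A).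
Proof. by []. Qed.

Lemma lebesgue_rV_obox m (a b : 'rV[R]_m) :
  lebesgue_rV R m (obox a b) = (\prod_i Num.max 0 (b 0 i - a 0 i))%:E.
Proof.
elim: m a b => [|m ih] a b.
  rewrite big_ord0 /= diracE mem_set//=.
  by case.
rewrite lebesgue_rV_succ (_ : rV_cons = fun p => rV_ins ord0 p.1 p.2); last first.
  by apply/funext => p; rewrite rV_consE.
rewrite preimage_rV_ins_obox product_measure1E//=; last exact: measurable_obox.
rewrite ih big_ord_recl lebesgue_measure_itv/= lte_fin EFinM.
congr (_ * _%:E); last by apply: eq_bigr => k _; rewrite !mxE.
rewrite -EFinB; case: ltP => ab; first by rewrite max_r// subr_ge0 ltW.
by rewrite max_l// subr_le0.
Qed.

Lemma lebesgue_rV_obox_lty m (a b : 'rV[R]_m) : lebesgue_rV R m (obox a b) < +oo.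
Proof. by rewrite lebesgue_rV_obox ltry. Qed.

Section pushforward_measure_instance.
Context d d' (T : measurableType d) (T' : measurableType d')
  (m : {measure set T -> \bar R}) (f : T -> T') (mf : measurable_fun setT f).

(** Bundles the push-forward, so that the theory of measures applies to a term
    that is only known as a set function. *)
Lemma pushforward_measureE : exists m' : {measure set T' -> \bar R},
  m' = pushforward m f :> (set T' -> \bar R).
Proof.
by exists (measure_function_pushforward__canonical__measure_function_Measure m mf).
Qed.
End pushforward_measure_instance.

(** The recursive definition singles out the first coordinate; by uniqueness on
    boxes any other coordinate may be singled out instead. *)
Lemma lebesgue_rV_ins m (i : 'I_m.+1) A : measurable A ->
  lebesgue_rV R m.+1 A =
  (@lebesgue_measure R \x lebesgue_rV R m) ((fun p => rV_ins i p.1 p.2) @^-1` A).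
Proof.
have [m2 m2E] := pushforward_measureE (@lebesgue_measure R \x lebesgue_rV R m)
  (measurable_rV_ins i).
move=> mA; transitivity (m2 A); last by rewrite m2E.
apply: rV_measure_unique => // a b; last exact: lebesgue_rV_obox_lty.
rewrite m2E /pushforward preimage_rV_ins_obox /= product_measure1E//=; last exact: measurable_obox.
rewrite !lebesgue_rV_obox lebesgue_measure_itv/= lte_fin (bigD1_ord i)//= EFinM.
congr (_ * _%:E); last by apply: eq_bigr => k _; rewrite !mxE.
rewrite -EFinB; case: ltP => ab; first by rewrite max_r// subr_ge0 ltW.
by rewrite max_l// subr_le0.
Qed.

Lemma ge0_integral_rV_ins m (i : 'I_m.+1) (f : 'rV[R]_m.+1 -> \bar R) :
  measurable_fun setT f -> (forall x, 0 <= f x) ->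
  \int[lebesgue_rV R m.+1]_x f x =
  \int[lebesgue_rV R m]_y \int[@lebesgue_measure R]_s f (rV_ins i s y).
Proof.
move=> mf f0.
have [m2 m2E] := pushforward_measureE (@lebesgue_measure R \x lebesgue_rV R m)
  (measurable_rV_ins i).
rewrite (eq_measure_integral m2); last first.
  by move=> A mA _; rewrite m2E; exact: lebesgue_rV_ins.
rewrite m2E.
rewrite ge0_integral_pushforward//; last exact: measurable_rV_ins.
rewrite preimage_setT fubini_tonelli2//.
  exact: measurableT_comp (measurable_rV_ins i).
by move=> p; exact: f0.
Qed.

Lemma integral_rV_ins m (i : 'I_m.+1) (f : 'rV[R]_m.+1 -> \bar R) :
  (lebesgue_rV R m.+1).-integrable setT f ->
  \int[lebesgue_rV R m.+1]_x f x =
  \int[lebesgue_rV R m]_y \int[@lebesgue_measure R]_s f (rV_ins i s y).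
Proof.
move=> /integrableP[mf foo].
have mfi := measurableT_comp mf (measurable_rV_ins i).
have fi : (@lebesgue_measure R \x lebesgue_rV R m).-integrable setT
    (fun p => f (rV_ins i p.1 p.2)).
  apply/integrable21ltyP => //=.
  rewrite -(ge0_integral_rV_ins i (f := abse \o f))//.
    exact: measurableT_comp.
  by move=> x; exact: abse_ge0.
have [m2 m2E] := pushforward_measureE (@lebesgue_measure R \x lebesgue_rV R m)
  (measurable_rV_ins i).
rewrite (eq_measure_integral m2); last first.
  by move=> A mA _; rewrite m2E; exact: lebesgue_rV_ins.
rewrite m2E.
rewrite integral_pushforward//; last exact: measurable_rV_ins.
by rewrite preimage_setT -integral21_prod_meas1.
Qed.

Lemma lebesgue_rV_affine m (c b : 'rV[R]_m) A : (forall i, 0 < c 0 i)%R ->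
  measurable A ->
  lebesgue_rV R m A = (\prod_i c 0%R i)%:E *
    lebesgue_rV R m ((fun x => \row_i (c 0 i * x 0 i + b 0 i))%R @^-1` A).
Proof.
move=> c0.
have mphi : measurable_fun setT (fun x : 'rV[R]_m => \row_i (c 0 i * x 0 i + b 0 i))%R.
  apply: measurable_fun_rV => i.
  apply: (eq_measurable_fun (fun x : 'rV[R]_m => c 0 i * x 0 i + b 0 i)%R).
    by move=> x _; rewrite mxE.
  apply: measurable_funD => //; apply: measurable_funM => //.
  exact: measurable_coord.
have p0 : (0 <= \prod_i c 0 i)%R by apply: prodr_ge0 => i _; exact: ltW.
have [m1 m1E] := pushforward_measureE (lebesgue_rV R m) mphi.
pose m2 : {measure set 'rV[R]_m -> \bar R} := mscale (NngNum p0) m1.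
move=> mA.
have -> : (\prod_i c 0 i)%:E * lebesgue_rV R m
    ((fun x => \row_i (c 0 i * x 0 i + b 0 i))%R @^-1` A) = m2 A.
  by rewrite /m2 /= /mscale/= m1E.
apply: rV_measure_unique => // p q; last exact: lebesgue_rV_obox_lty.
rewrite /m2 /= /mscale/= m1E /pushforward.
have -> : (fun x : 'rV[R]_m => \row_i (c 0 i * x 0 i + b 0 i))%R @^-1` obox p q =
    obox (\row_i ((p 0 i - b 0 i) / c 0 i))%R (\row_i ((q 0 i - b 0 i) / c 0 i))%R.
  by apply/seteqP; split=> x H i; have := H i; rewrite !mxE
    ltr_pdivrMr// ltr_pdivlMr// ltrBlDr ltrBrDr ![(_ * c 0 i)%R]mulrC.
rewrite lebesgue_rV_obox [X in _ * X]lebesgue_rV_obox -EFinM -big_split/=; congr (_%:E); apply: eq_bigr => i _.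
rewrite !mxE maxr_pMr ?ltW// mulr0; congr Num.max.
by rewrite -mulrBl mulrCA mulfV ?gt_eqF// mulr1; ring.
Qed.

End lebesgue_rV_theory.

(** * Euclidean geometry of row vectors *)

Section euclidean_theory.
Context {R : realType} {m : nat}.
Implicit Types (x y z : 'rV[R]_m) (c : R).

Lemma dotC x y : dot x y = dot y x.
Proof. by apply: eq_bigr => i _; rewrite mulrC. Qed.

Lemma dotDl x y z : dot (x + y) z = dot x z + dot y z.
Proof. by rewrite -big_split; apply: eq_bigr => i _; rewrite mxE mulrDl. Qed.

Lemma dotZl c x z : dot (c *: x) z = c * dot x z.
Proof. by rewrite /dot mulr_sumr; apply: eq_bigr => i _; rewrite mxE mulrA. Qed.

Lemma dotNl x z : dot (- x) z = - dot x z.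
Proof. by rewrite -scaleN1r dotZl mulN1r. Qed.

Lemma dotBl x y z : dot (x - y) z = dot x z - dot y z.
Proof. by rewrite dotDl dotNl. Qed.

Lemma dotDr x y z : dot z (x + y) = dot z x + dot z y.
Proof. by rewrite dotC dotDl !(dotC z). Qed.

Lemma dotZr c x z : dot z (c *: x) = c * dot z x.
Proof. by rewrite dotC dotZl (dotC z). Qed.

Lemma dotNr x z : dot z (- x) = - dot z x.
Proof. by rewrite dotC dotNl (dotC z). Qed.

Lemma dotBr x y z : dot z (x - y) = dot z x - dot z y.
Proof. by rewrite dotDr dotNr. Qed.

Lemma dot0l z : dot 0 z = 0.
Proof. by rewrite -[X in dot X](scale0r 0) dotZl mul0r. Qed.

Lemma dot_ge0 x : 0 <= dot x x.
Proof. by apply: sumr_ge0 => i _; rewrite -expr2 sqr_ge0. Qed.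

Lemma enorm_ge0 x : 0 <= enorm x.
Proof. exact: sqrtr_ge0. Qed.

Lemma sqr_enorm x : enorm x ^+ 2 = dot x x.
Proof. by rewrite sqr_sqrtr// dot_ge0. Qed.

Lemma enorm0 : enorm (0 : 'rV[R]_m) = 0.
Proof. by rewrite /enorm dot0l sqrtr0. Qed.

Lemma enormZ c x : enorm (c *: x) = `|c| * enorm x.
Proof. by rewrite /enorm dotZl dotZr mulrA -expr2 sqrtrM ?sqr_ge0// sqrtr_sqr. Qed.

Lemma enormN x : enorm (- x) = enorm x.
Proof. by rewrite -scaleN1r enormZ normrN1 mul1r. Qed.

Lemma enormB x y : enorm (x - y) = enorm (y - x).
Proof. by rewrite -enormN opprB. Qed.

Lemma enorm_eq0 x : (enorm x == 0) = (x == 0).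
Proof.
apply/eqP/eqP => [x0|->]; last exact: enorm0.
apply/rowP => i; rewrite mxE; apply/eqP; rewrite -normr_le0.
by rewrite -x0; exact: ler_coord_enorm.
Qed.

Lemma enorm_gt0 x : (0 < enorm x) = (x != 0).
Proof. by rewrite lt_neqAle enorm_ge0 andbT eq_sym enorm_eq0. Qed.

Lemma cauchy_schwarz x y : `|dot x y| <= enorm x * enorm y.
Proof.
rewrite -ler_sqr ?nnegrE ?mulr_ge0 ?enorm_ge0// real_normK ?num_real//.
rewrite exprMn !sqr_enorm.
have [->|y0] := eqVneq y 0; first by rewrite dotC !dot0l expr0n mulr0.
have yy : 0 < dot y y by rewrite -sqr_enorm exprn_gt0// enorm_gt0.
have := dot_ge0 (dot y y *: x - dot x y *: y).
rewrite !(dotBl, dotBr, dotZl, dotZr) (dotC y x) => H.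
by rewrite -subr_ge0 -(pmulr_rge0 _ yy); apply: le_trans H _; rewrite le_eqVlt; apply/orP; left; apply/eqP; ring.
Qed.

Lemma ler_enormD x y : enorm (x + y) <= enorm x + enorm y.
Proof.
rewrite -ler_sqr ?nnegrE ?addr_ge0 ?enorm_ge0// sqrrD !sqr_enorm.
rewrite dotDl !dotDr (dotC y x).
have := cauchy_schwarz x y; have := ler_norm (dot x y); lra.
Qed.

Lemma ler_enormB x y : enorm x - enorm y <= enorm (x - y).
Proof. by rewrite lerBlDr; apply: le_trans (ler_enormD _ _); rewrite subrK. Qed.

Lemma ler_enormD_dist z x y : enorm (x - y) <= enorm (x - z) + enorm (z - y).
Proof. by apply: le_trans (ler_enormD _ _); rewrite addrA subrK. Qed.

Lemma ler_enorm_sum x : enorm x <= \sum_i `|x 0 i|.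
Proof.
rewrite -ler_sqr ?nnegrE ?enorm_ge0 ?sumr_ge0// sqr_enorm /dot expr2.
rewrite big_distrl/=; apply: ler_sum => i _.
rewrite -expr2 -real_normK ?num_real// expr2 ler_wpM2l//.
by rewrite (bigD1 i)//= lerDl sumr_ge0.
Qed.

Lemma nbhs_enormP x (A : set 'rV[R]_m) :
  nbhs x A <-> exists2 e, 0 < e & forall y, enorm (y - x) < e -> A y.
Proof.
split=> [/nbhs_ballP[e /= e0 eA]|[e e0 eA]].
  exists e => // y yx; apply: eA; split=> // i j; rewrite (ord1 i) /ball/= distrC.
  by have := ler_coord_enorm (y - x) j; rewrite !mxE => /le_lt_trans; exact.
apply/nbhs_ballP; exists (e / m.+1%:R) => /= [|y [_ yx]]; first exact: divr_gt0.
apply: eA; apply: le_lt_trans (ler_enorm_sum _) _.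
apply: (@le_lt_trans _ _ (\sum_(i < m) e / m.+1%:R)).
  apply: ler_sum => i _; rewrite !mxE distrC.
  by have := yx 0 i; rewrite /ball/= => /ltW.
rewrite sumr_const card_ord -[ltLHS]mulr_natr -mulrA gtr_pMr// mulrC ltr_pdivrMr//.
by rewrite mul1r ltr_nat.
Qed.

Lemma open_enormP (A : set 'rV[R]_m) :
  open A <-> forall x, A x -> exists2 e, 0 < e & forall y, enorm (y - x) < e -> A y.
Proof.
rewrite openE; split=> [oA x /oA /nbhs_enormP//|H x /H ?].
exact/nbhs_enormP.
Qed.

Lemma closure_enormP (A : set 'rV[R]_m) x :
  closure A x <-> forall e, 0 < e -> exists2 y, A y & enorm (y - x) < e.
Proof.
split=> [clA e e0|H B /nbhs_enormP[e e0 eB]].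
  have /clA[y [Ay yx]] : nbhs x [set y | enorm (y - x) < e].
    by apply/nbhs_enormP; exists e.
  by exists y.
by have [y Ay yx] := H e e0; exists y; split=> //; exact: eB.
Qed.

Lemma enorm_continuous : continuous (@enorm R m).
Proof.
move=> x A /nbhs_ballP[e /= e0 eA]; apply/nbhs_enormP; exists e => // y yx /=.
apply: eA; rewrite /ball/= ltr_norml.
have := ler_enormB x y; have := ler_enormB y x; rewrite (enormB x).
by move: yx; lra.
Qed.

End euclidean_theory.

(** * The Prekopa-Leindler inequality on the line *)

Section prekopa_leindler.
Context {R : realType}.
Local Notation mu := (@lebesgue_measure R).
Local Open Scope ereal_scope.

Lemma lebesgue_measure_affine (c b : R) (A : set R) : (0 < c)%R -> measurable A ->
  mu A = c%:E * mu [set x | A (c * x + b)%R].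
Proof.
move=> c0 mA.
have mphi : measurable_fun [set: measurableTypeR R]
    (fun x : R => (c * x + b)%R : measurableTypeR R).
  by apply: measurable_funD => //; apply: measurable_funM.
have [m1 m1E] := pushforward_measureE mu mphi.
pose m2 : {measure set (measurableTypeR R) -> \bar R} := mscale (NngNum (ltW c0)) m1.
transitivity (m2 A); last by rewrite /m2 /= /mscale/= m1E.
apply: lebesgue_measure_unique => // _ [[p q] _ <-].
rewrite /m2 /= /mscale/= m1E /pushforward.
have -> : (fun x => c * x + b)%R @^-1` `]p, q] = `]((p - b) / c)%R, ((q - b) / c)%R]%classic.
  apply/seteqP; split=> x /=; rewrite !in_itv/=;
  by rewrite ltr_pdivrMr// ler_pdivlMr// ltrBlDr lerBrDr (mulrC c).
rewrite lebesgue_measure_itv [X in _ * X]lebesgue_measure_itv/= !lte_fin ltr_pM2r ?invr_gt0// ltrD2r.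
case: ifP => _; last by rewrite mule0.
by rewrite -!EFinB -EFinM; congr _%:E; field; rewrite gt_eqF.
Qed.

(** Translate A by the minimum of B and B by the maximum of A: the two translates
    lie on either side of a common point and are both contained in 2 * C. *)
Lemma brunn_minkowski_compact (A B C : set R) :
  compact A -> compact B -> measurable C -> A !=set0 -> B !=set0 ->
  (forall a b, A a -> B b -> C ((a + b) / 2)%R) ->
  mu A + mu B <= 2%:E * mu C.
Proof.
move=> cA cB mC A0 B0 ABC.
have cid : {within A, continuous (id : R -> R)}.
  by apply: continuous_subspaceT => x; exact: cvg_id.
have [a /set_mem Aa amax] := compact_EVT_max A0 cA cid.
have cN : {within B, continuous (fun x : R => - x)%R}.
  by apply: continuous_subspaceT => x; exact: opp_continuous.
have [b /set_mem Bb bmin] := compact_EVT_max B0 cB cN.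
have mA := compact_measurable cA; have mB := compact_measurable cB.
pose D1 := [set x | A (2 * x + - b)%R]; pose D2 := [set x | B (2 * x + - a)%R].
have maff c (E : set R) : measurable E -> measurable [set x | E (2 * x + c)%R].
  move=> mE; rewrite -[X in measurable X]setTI.
  have mphi : measurable_fun [set: R] (fun x => 2 * x + c)%R.
    by apply: measurable_funD => //; apply: measurable_funM.
  exact: (mphi _ E mE).
have mD1 : measurable D1 by exact: maff.
have mD2 : measurable D2 by exact: maff.
(* a is the maximum of A and b the minimum of B: p is the only common point of
   the halved translates D1 and D2. *)
pose p := ((a + b) / 2)%R.
have D1le x : D1 x -> (x <= p)%R.
  by move=> D1x; have := amax _ (mem_set D1x); rewrite /p; lra.
have D2ge x : D2 x -> (p <= x)%R.
  by move=> D2x; have := bmin _ (mem_set D2x); rewrite /p; lra.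
rewrite (lebesgue_measure_affine (- b)%R (ltr0Sn R 1) mA).
rewrite (lebesgue_measure_affine (- a)%R (ltr0Sn R 1) mB).
rewrite -ge0_muleDr//; apply: lee_wpmul2l => //.
rewrite -/D1 -/D2.
have -> : mu D1 = mu (D1 `\ p).
  apply/eqP; rewrite eq_le; apply/andP; split; last first.
    by apply: le_measure; rewrite ?inE//; exact: measurableD.
  rewrite -[leRHS]adde0 -(lebesgue_measure_set1 p).
  apply: le_trans (measureU2 _ _ _) => //; last exact: measurableD.
  apply: le_measure; rewrite ?inE//; first by apply: measurableU => //; exact: measurableD.
  by move=> x D1x; have [->|xp] := eqVneq x p; [right|left; split=> //; exact/eqP].
rewrite -measureU//; last 2 first.
- exact: measurableD.
- apply/seteqP; split=> // x [[/D1le xp xneq] /D2ge px]; apply: xneq.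
  by apply/eqP; rewrite eq_le xp px.
apply: le_measure; rewrite ?inE//; first by apply: measurableU => //; exact: measurableD.
move=> x [[Ax _]|Bx].
  by have := ABC _ _ Ax Bb; rewrite (_ : _ / _ = x)%R//; lra.
by have := ABC _ _ Aa Bx; rewrite (_ : _ / _ = x)%R//; lra.
Qed.

(** By inner regularity; a point of A and a point of B are added to the compact
    sets, which must not be empty. *)
Lemma brunn_minkowski1 (A B C : set R) :
  measurable A -> measurable B -> measurable C -> A !=set0 -> B !=set0 ->
  (forall a b, A a -> B b -> C ((a + b) / 2)%R) ->
  mu A + mu B <= 2%:E * mu C.
Proof.
move=> mA mB mC [a0 Aa0] [b0 Bb0] ABC.
have [->|Coo] := eqVneq (mu C) +oo; first by rewrite gt0_muley ?lte_fin// leey.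
have Cfin : 2%:E * mu C \is a fin_num.
  by rewrite fin_numM// ge0_fin_numE// ltey.
have H K1 K2 : compact K1 -> K1 `<=` A -> compact K2 -> K2 `<=` B ->
    mu K1 + mu K2 <= 2%:E * mu C.
  move=> cK1 K1A cK2 K2B.
  have c1 : compact (K1 `|` [set a0]) by apply: compactU => //; exact: compact_set1.
  have c2 : compact (K2 `|` [set b0]) by apply: compactU => //; exact: compact_set1.
  apply: (@le_trans _ _ (mu (K1 `|` [set a0]) + mu (K2 `|` [set b0]))).
    by apply: leeD; apply: le_measure; rewrite ?inE; try exact: compact_measurable;
      exact: subsetUl.
  apply: brunn_minkowski_compact => //; [by exists a0; right|by exists b0; right|].
  by move=> a b [/K1A Aa|aa0] [/K2B Bb|bb0]; rewrite ?aa0 ?bb0; exact: ABC.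
rewrite (lebesgue_regularity_inner_sup mB).
have muAfin : mu A \is a fin_num.
  rewrite ge0_fin_numE//; apply: le_lt_trans (_ : 2%:E * mu C < _); last first.
    by rewrite ltey_eq Cfin.
  rewrite (lebesgue_regularity_inner_sup mA); apply: ge_ereal_sup => _ [K1 [cK1 K1A] <-].
  by have := H _ set0 cK1 K1A (@compact0 _) (@sub0set _ _); rewrite measure0 adde0.
rewrite addeC -leeBrDr//; apply: ge_ereal_sup => _ [K2 [cK2 K2B] <-].
rewrite leeBrDr//.
rewrite (lebesgue_regularity_inner_sup mA) addeC.
have K2fin : mu K2 \is a fin_num by rewrite ge0_fin_numE//; exact: compact_finite_measure.
rewrite -leeBrDr//; apply: ge_ereal_sup => _ [K1 [cK1 K1A] <-].
by rewrite leeBrDr//; exact: H.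
Qed.

Lemma layer_cake1 (f : R -> R) : measurable_fun [set: R] f -> (forall s, 0 <= f s)%R ->
  \int[mu]_s (Num.min 1 (f s))%:E =
  \int[mu]_(l in `]0%R, 1%R[) mu [set s | (l < f s)%R].
Proof.
move=> mf f0.
pose A : set (R * R) := [set p | (0 < p.2 < 1)%R && (p.2 < f p.1)%R].
have mA : measurable A.
  rewrite (_ : A = (setT `*` `]0%R, 1%R[%classic) `&`
     (fun p : R * R => p.2 < f p.1)%R @^-1` [set true]); last first.
    apply/seteqP; split=> [p /andP[p1 p2]|p [[_ /= p1] p2]].
      by split=> //; split=> //=; rewrite in_itv.
    by apply/andP; split=> //; move: p1; rewrite in_itv.
  apply: measurableI; first by apply: measurableX.
  rewrite -[X in measurable X]setTI.
  have mlt : measurable_fun [set: R * R] (fun p : R * R => p.2 < f p.1)%R.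
    by apply: measurable_fun_ltr => //; exact: measurableT_comp.
  exact: mlt.
have := indic_fubini_tonelli mu mu mA.
rewrite indic_fubini_tonelli_FE// indic_fubini_tonelli_GE//= => E.
transitivity (\int[mu]_x mu (xsection A x)).
  apply: eq_integral => s _.
  rewrite (_ : xsection A s = `]0%R, (Num.min 1 (f s))%R[%classic); last first.
    apply/seteqP; split=> l; rewrite /xsection /A/= in_itv/= inE/= lt_min andbA//.
  rewrite lebesgue_measure_itv/= lte_fin; case: ltP => [_|H]; first by rewrite oppr0 addr0.
  by congr _%:E; apply/eqP; rewrite eq_le H le_min f0 ler01.
rewrite E [RHS]integral_mkcond; apply: eq_integral => l _ /=.
rewrite patchE; case: ifPn => [|].
  rewrite inE/= in_itv/= => l01; congr (mu _); apply/seteqP; split=> s;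
  by rewrite /ysection /A/= inE/= l01.
rewrite notin_setE/= in_itv/= => /negP l01.
rewrite (_ : ysection A l = set0) ?measure0//; apply/seteqP; split=> s //.
by rewrite /ysection /A/= inE/= (negbTE l01).
Qed.

End prekopa_leindler.

Section prekopa_leindler.
Context {R : realType}.
Local Notation mu := (@lebesgue_measure R).
Local Open Scope ereal_scope.

Lemma measurable_superlevel (f : R -> R) : measurable_fun [set: R] f ->
  measurable_fun [set: R] (fun l => mu [set s | (l < f s)%R]).
Proof.
move=> mf.
pose A : set (R * R) := [set p | (p.2 < f p.1)%R].
have mA : measurable A.
  rewrite (_ : A = (fun p : R * R => p.2 < f p.1)%R @^-1` [set true]); last first.
    by apply/seteqP; split.
  rewrite -[X in measurable X]setTI.
  have mlt : measurable_fun [set: R * R] (fun p : R * R => p.2 < f p.1)%R.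
    by apply: measurable_fun_ltr => //; exact: measurableT_comp.
  exact: mlt.
apply: eq_measurable_fun (measurable_fun_ysection mu mA) => l _ /=.
by congr (mu _); apply/seteqP; split=> s; rewrite /ysection /A/= inE.
Qed.

(** When f and g have the same supremum 1, the superlevel sets at any height
    l < 1 are nonempty, so that the Brunn-Minkowski inequality applies to them; it
    is then integrated over l (layer cake). *)
Lemma prekopa_leindler_normalized (f g h : R -> R) :
  measurable_fun [set: R] f -> measurable_fun [set: R] g ->
  measurable_fun [set: R] h ->
  (forall s, 0 <= f s <= 1)%R -> (forall s, 0 <= g s <= 1)%R -> (forall s, 0 <= h s)%R ->
  (forall l, l < 1 -> exists s, l < f s)%R -> (forall l, l < 1 -> exists s, l < g s)%R ->
  (forall l s t, 0 < l -> l < f s -> l < g t -> l < h ((s + t) / 2))%R ->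
  \int[mu]_s (f s)%:E + \int[mu]_s (g s)%:E <= 2%:E * \int[mu]_s (h s)%:E.
Proof.
move=> mf mg mh f01 g01 h0 fsup gsup fgh.
have cake (k : R -> R) : measurable_fun [set: R] k -> (forall s, 0 <= k s <= 1)%R ->
    \int[mu]_s (k s)%:E = \int[mu]_(l in `]0%R, 1%R[) mu [set s | (l < k s)%R].
  move=> mk k01; rewrite -layer_cake1//; last by move=> s; have /andP[] := k01 s.
  by apply: eq_integral => s _; rewrite min_r//; have /andP[] := k01 s.
rewrite (cake f)// (cake g)//.
have mset (k : R -> R) l : measurable_fun [set: R] k -> measurable [set s : R | (l < k s)%R].
  move=> mk; rewrite -[X in measurable X]setTI.
  rewrite (_ : [set s | _] = k @^-1` `]l, +oo[); first exact: mk.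
  by apply/seteqP; split=> s; rewrite /= in_itv/= andbT.
rewrite -ge0_integralD//; last 2 first.
- by apply: measurable_funTS; exact: measurable_superlevel.
- by apply: measurable_funTS; exact: measurable_superlevel.
apply: (@le_trans _ _ (\int[mu]_(l in `]0%R, 1%R[) (2%:E * mu [set s | (l < h s)%R]))).
  apply: ge0_le_integral => //.
  - by move=> l _; rewrite adde_ge0.
  - by apply: emeasurable_funD; apply: measurable_funTS; exact: measurable_superlevel.
  - by apply: measurable_funeM; apply: measurable_funTS; exact: measurable_superlevel.
  - move=> l; rewrite /= in_itv/= => /andP[l0 l1].
    apply: brunn_minkowski1; try exact: mset.
    + exact: fsup.
    + exact: gsup.
    + by move=> a b /=; exact: fgh.
rewrite ge0_integralZl//; last by apply: measurable_funTS; exact: measurable_superlevel.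
apply: lee_wpmul2l => //; rewrite -layer_cake1//.
apply: ge0_le_integral => //.
- by move=> s _; rewrite lee_fin le_min ler01 h0.
- by apply/measurable_EFinP; apply: measurable_minr.
- exact/measurable_EFinP.
- by move=> s _; rewrite lee_fin ge_min lexx orbT.
Qed.

(** Normalize the suprema to 1. The additive inequality so obtained is stronger
    than the multiplicative one, by the inequality of the arithmetic and geometric
    means. *)
Lemma prekopa_leindler (f g h : R -> R) (M : R) :
  measurable_fun [set: R] f -> measurable_fun [set: R] g ->
  measurable_fun [set: R] h ->
  (forall s, 0 <= f s <= M)%R -> (forall s, 0 <= g s <= M)%R -> (forall s, 0 <= h s)%R ->
  (forall s t, f s * g t <= h ((s + t) / 2) ^+ 2)%R ->
  (\int[mu]_s (f s)%:E) * (\int[mu]_s (g s)%:E) <= (\int[mu]_s (h s)%:E) ^+ 2.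
Proof.
move=> mf mg mh f0M g0M h0 fgh.
have hh0 : 0 <= (\int[mu]_s (h s)%:E) ^+ 2.
  by rewrite expe_ge0// integral_ge0// => s _; rewrite lee_fin.
have norm (k : R -> R) : (forall s, 0 <= k s <= M)%R -> (forall s, k s = 0)%R \/
    exists2 K : R, (0 < K)%R & (forall s, k s <= K)%R /\ (forall l, l < K -> exists s, l < k s)%R.
  move=> k0M; have [k0|/existsNP[s0 /eqP ks0]] := pselect (forall s, k s = 0%R); [by left|right].
  have ksup : has_sup (range k).
    split; first by exists (k s0), s0.
    by exists M => _ [s _ <-]; have /andP[] := k0M s.
  have leK s : (k s <= sup (range k))%R by apply: sup_ubound; [case: ksup|exists s].
  exists (sup (range k)).
    by apply: lt_le_trans (leK s0); rewrite lt_neqAle eq_sym ks0; have /andP[] := k0M s0.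
  split => // l lK; have /(sup_adherent)/(_ ksup)[_ [s _ <-]] : (0 < sup (range k) - l)%R.
    by rewrite subr_gt0.
  by rewrite subKr => ?; exists s.
have [f0|[F F0 [fF Fsup]]] := norm f f0M.
  by rewrite integral0_eq ?mul0e// => s _; rewrite f0.
have [g0|[G G0 [gG Gsup]]] := norm g g0M.
  by rewrite [X in _ * X]integral0_eq ?mule0// => s _; rewrite g0.
pose H := Num.sqrt (F * G).
have H0 : (0 < H)%R by rewrite sqrtr_gt0 mulr_gt0.
have HE : (H ^+ 2 = F * G)%R by rewrite sqr_sqrtr// mulr_ge0// ltW.
have Zl (k : R -> R) K : measurable_fun [set: R] k -> (forall s, 0 <= k s)%R -> (0 < K)%R ->
    \int[mu]_s (k s)%:E = K%:E * \int[mu]_s (k s / K)%:E.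
  move=> mk k0 K0; rewrite -ge0_integralZl_EFin//.
  - by apply: eq_integral => s _; rewrite -EFinM mulrC divfK// gt_eqF.
  - by move=> s _; rewrite lee_fin divr_ge0// ltW.
  - by apply/measurable_EFinP; exact: measurable_funM.
  - exact: ltW.
have f0 s : (0 <= f s)%R by have /andP[] := f0M s.
have g0 s : (0 <= g s)%R by have /andP[] := g0M s.
rewrite (Zl f F)// (Zl g G)// (Zl h H)//.
set p := \int[mu]_s (f s / F)%:E; set q := \int[mu]_s (g s / G)%:E.
set k := \int[mu]_s (h s / H)%:E.
have PL : p + q <= 2%:E * k.
  apply: (@prekopa_leindler_normalized (fun s => f s / F) (fun s => g s / G) (fun s => h s / H))%R.
  - exact: measurable_funM.
  - exact: measurable_funM.
  - exact: measurable_funM.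
  - move=> s; apply/andP; split; first by apply: divr_ge0 => //; exact: ltW.
    by rewrite ler_pdivrMr// mul1r.
  - move=> s; apply/andP; split; first by apply: divr_ge0 => //; exact: ltW.
    by rewrite ler_pdivrMr// mul1r.
  - by move=> s; rewrite divr_ge0// ltW.
  - move=> l l1; have [|s ls] := Fsup (l * F)%R; first by rewrite gtr_pMl.
    by exists s; rewrite ltr_pdivlMr.
  - move=> l l1; have [|s ls] := Gsup (l * G)%R; first by rewrite gtr_pMl.
    by exists s; rewrite ltr_pdivlMr.
  - move=> l s t l0; rewrite !ltr_pdivlMr// => lf lg.
    rewrite -ltr_sqr ?nnegrE//; last by apply: mulr_ge0; exact: ltW.
    apply: lt_le_trans (fgh s t); rewrite exprMn HE expr2 mulrACA.
    by apply: ltr_pM => //; rewrite mulr_ge0// ltW.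
have p0 : 0 <= p by apply: integral_ge0 => ? _; rewrite lee_fin divr_ge0// ltW.
have q0 : 0 <= q by apply: integral_ge0 => ? _; rewrite lee_fin divr_ge0// ltW.
have k0 : 0 <= k by apply: integral_ge0 => ? _; rewrite lee_fin divr_ge0// ltW.
clearbody p q k.
have [koo|koo] := eqVneq k +oo.
  by rewrite koo gt0_muley ?lte_fin// expe2 mulyy leey.
have kfin : k \is a fin_num by rewrite ge0_fin_numE// ltey.
have pqoo : p + q < +oo by apply: le_lt_trans PL _; rewrite lte_mul_pinfty// ltey.
have pfin : p \is a fin_num.
  by rewrite ge0_fin_numE//; apply: le_lt_trans pqoo; rewrite leeDl.
have qfin : q \is a fin_num.
  by rewrite ge0_fin_numE//; apply: le_lt_trans pqoo; rewrite leeDr.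
move: PL p0 q0 k0; rewrite -(fineK pfin) -(fineK qfin) -(fineK kfin).
move: (fine p) (fine q) (fine k) => {pfin qfin kfin pqoo koo} {}p {}q {}k.
rewrite -EFinD -!EFinM -EFin_expe !lee_fin => PL p0 q0 k0.
rewrite exprMn HE mulrACA ler_pM2l ?mulr_gt0//.
have : ((p + q) ^+ 2 <= (2 * k) ^+ 2)%R.
  by rewrite ler_sqr ?nnegrE// ?addr_ge0 ?mulr_ge0.
by have := sqr_ge0 (p - q); nra.
Qed.

End prekopa_leindler.

(** * The isodiametric inequality *)

Section isodiametric.
Context {R : realType}.
Local Open Scope ereal_scope.
Local Notation mu := (@lebesgue_measure R).

Definition cube m (r : R) : set 'rV[R]_m := obox (const_mx (- r))%R (const_mx r).

Definition slice m (A : set 'rV[R]_m.+1) (s : R) : set 'rV[R]_m :=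
  [set y | A (rV_ins ord0 s y)].

Lemma slice_xsection m (A : set 'rV[R]_m.+1) s : slice A s = xsection (rV_cons @^-1` A) s.
Proof.
by apply/seteqP; split=> y; rewrite /slice /xsection/= inE/= rV_consE.
Qed.

Lemma measurable_preimage_rV_cons m (A : set 'rV[R]_m.+1) : measurable A ->
  measurable (rV_cons @^-1` A).
Proof. by move=> mA; rewrite -[X in measurable X]setTI; exact: measurable_rV_cons. Qed.

Lemma measurable_slice m (A : set 'rV[R]_m.+1) s : measurable A -> measurable (slice A s).
Proof.
move=> mA; rewrite slice_xsection.
apply: measurable_xsection; exact: measurable_preimage_rV_cons.
Qed.

Lemma measurable_fun_slice m (A : set 'rV[R]_m.+1) : measurable A ->
  measurable_fun [set: R] (fun s => lebesgue_rV R m (slice A s)).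
Proof.
move=> mA.
apply: eq_measurable_fun (measurable_fun_xsection (lebesgue_rV R m) (measurable_preimage_rV_cons mA)).
by move=> s _ /=; rewrite slice_xsection.
Qed.

Lemma lebesgue_rV_slice m (A : set 'rV[R]_m.+1) :
  lebesgue_rV R m.+1 A = \int[mu]_s lebesgue_rV R m (slice A s).
Proof.
rewrite lebesgue_rV_succ /product_measure1.
by apply: eq_integral => s _ /=; rewrite slice_xsection.
Qed.

Lemma lebesgue_rV_cube_fin_num m r (A : set 'rV[R]_m) : measurable A -> A `<=` cube r ->
  lebesgue_rV R m A \is a fin_num.
Proof.
move=> mA Ar; rewrite ge0_fin_numE//.
apply: le_lt_trans (lebesgue_rV_obox_lty (const_mx (- r))%R (const_mx r)).
by apply: le_measure; rewrite ?inE//; exact: measurable_obox.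
Qed.

(** Induction on the dimension: the measures of the slices of A, B and C satisfy
    the hypothesis of the Prekopa-Leindler inequality, by the induction hypothesis.
    The bounding cube keeps all measures finite. *)
Lemma brunn_minkowski_rV m r (A B C : set 'rV[R]_m) :
  measurable A -> measurable B -> measurable C ->
  A `<=` cube r -> B `<=` cube r -> C `<=` cube r ->
  (forall x y, A x -> B y -> C (2^-1 *: (x + y))%R) ->
  lebesgue_rV R m A * lebesgue_rV R m B <= lebesgue_rV R m C ^+ 2.
Proof.
elim: m A B C => [|m ih] A B C mA mB mC Ar Br Cr ABC.
  rewrite /= !diracE.
  have [/set_mem A0|] := boolP (0%R \in A); last by rewrite mul0e mule_ge0.
  have [/set_mem B0|] := boolP (0%R \in B); last by rewrite mule0 mule_ge0.
  have := ABC _ _ A0 B0; rewrite addr0 scaler0 => C0.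
  by rewrite mem_set// !mule1.
have sr E s : E `<=` cube r -> slice E s `<=` cube r.
  by move=> Er y /Er yr k; have := yr (lift ord0 k); rewrite rV_ins_lift !mxE.
have sfin E s : measurable E -> E `<=` cube r ->
    lebesgue_rV R m (slice E s) \is a fin_num.
  by move=> mE Er; apply: (@lebesgue_rV_cube_fin_num _ r); [exact: measurable_slice|exact: sr].
pose M := fine (lebesgue_rV R m (cube r)).
have sM E s : measurable E -> E `<=` cube r ->
    (0 <= fine (lebesgue_rV R m (slice E s)) <= M)%R.
  move=> mE Er; rewrite fine_ge0//= fine_le//; first exact: sfin.
    by apply: (@lebesgue_rV_cube_fin_num _ r) => //; exact: measurable_obox.
  apply: le_measure; rewrite ?inE//; [exact: measurable_slice|exact: measurable_obox|exact: sr].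
have LE E : measurable E -> E `<=` cube r ->
    lebesgue_rV R m.+1 E = \int[mu]_s (fine (lebesgue_rV R m (slice E s)))%:E.
  by move=> mE Er; rewrite lebesgue_rV_slice; apply: eq_integral => s _; rewrite fineK// sfin.
have mf E : measurable E -> measurable_fun [set: R] (fun s => fine (lebesgue_rV R m (slice E s))).
  by move=> mE; apply: measurableT_comp => //; exact: measurable_fun_slice.
rewrite !LE//; apply: (@prekopa_leindler _ _ _ _ M).
- exact: mf.
- exact: mf.
- exact: mf.
- by move=> s; exact: sM.
- by move=> s; exact: sM.
- by move=> s; rewrite fine_ge0.
- move=> s t; rewrite -lee_fin EFinM EFin_expe !fineK ?sfin//.
  apply: ih; try exact: measurable_slice; try exact: sr.
  move=> x y; rewrite /slice/= => Ax By; have := ABC _ _ Ax By; congr C.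
  apply/rowP => j; rewrite !mxE; case: unliftP => [k|] _; first by rewrite !mxE.
  by rewrite mulrC.
Qed.

Definition eball m (r : R) : set 'rV[R]_m := [set x | (enorm x <= r)%R].

Lemma measurable_enorm m : measurable_fun [set: 'rV[R]_m] (@enorm R m).
Proof.
apply: continuous_measurable_fun_rV; first exact: openT.
by move=> x _; exact: enorm_continuous.
Qed.

Lemma measurable_eball m r : measurable (@eball m r).
Proof.
rewrite (_ : eball r = [set: 'rV[R]_m] `&` @enorm R m @^-1` `]-oo, r]).
  by apply: measurable_enorm => //; exact: measurable_itv.
by apply/seteqP; split=> x; rewrite /eball/= in_itv/=; [move=> ?; split|case].
Qed.

Lemma eball_sub_cube m (r r' : R) : (r < r')%R -> @eball m r `<=` cube r'.
Proof.
move=> rr' x xr i; rewrite !mxE -ltr_norml.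
by apply: le_lt_trans rr'; apply: le_trans xr; exact: ler_coord_enorm.
Qed.

Lemma lebesgue_rV_eball_fin_num m r : lebesgue_rV R m (eball r) \is a fin_num.
Proof.
apply: (@lebesgue_rV_cube_fin_num _ (r + 1)); first exact: measurable_eball.
by apply: eball_sub_cube; rewrite ltrDl.
Qed.

Lemma lebesgue_rV_translate m (b : 'rV[R]_m) A : measurable A ->
  lebesgue_rV R m [set x | A (x + b)%R] = lebesgue_rV R m A.
Proof.
move=> mA; rewrite (@lebesgue_rV_affine _ _ (const_mx 1%R) b A)//; last by move=> i; rewrite mxE.
rewrite big1 ?mul1e; last by move=> i _; rewrite mxE.
congr (lebesgue_rV R m _); apply/seteqP; split=> x /=; congr A;
by apply/rowP => i; rewrite !mxE mul1r.
Qed.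

Lemma lebesgue_rV_scale m (c : R) A : (0 < c)%R -> measurable A ->
  lebesgue_rV R m A = (c ^+ m)%:E * lebesgue_rV R m [set x | A (c *: x)%R].
Proof.
move=> c0 mA; rewrite (@lebesgue_rV_affine _ _ (const_mx c) 0%R A)//; last by move=> i; rewrite mxE.
congr (_%:E * lebesgue_rV R m _).
  by under eq_bigr do rewrite mxE; rewrite prodr_const card_ord.
by apply/seteqP; split=> x /=; congr A; apply/rowP => i; rewrite !mxE addr0.
Qed.

Lemma measurable_rV_opp m : measurable_fun [set: 'rV[R]_m] (fun x : 'rV[R]_m => - x)%R.
Proof.
apply: measurable_fun_rV => i.
apply: (eq_measurable_fun (fun x : 'rV[R]_m => - x 0 i)%R); first by move=> x _; rewrite mxE.
by apply: measurableT_comp => //; exact: measurable_coord.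
Qed.

Lemma lebesgue_rV_opp m (A : set 'rV[R]_m) : measurable A ->
  lebesgue_rV R m [set x | A (- x)%R] = lebesgue_rV R m A.
Proof.
have [m2 m2E] := pushforward_measureE (lebesgue_rV R m) (@measurable_rV_opp m).
move=> mA; transitivity (m2 A); first by rewrite m2E.
apply/esym; apply: rV_measure_unique => // a b; last exact: lebesgue_rV_obox_lty.
rewrite m2E /pushforward (_ : _ @^-1` _ = obox (- b)%R (- a)%R).
  rewrite [LHS]lebesgue_rV_obox [RHS]lebesgue_rV_obox; congr _%:E; apply: eq_bigr => i _.
  by rewrite !mxE; congr Num.max; ring.
by apply/seteqP; split=> x H i; have := H i; rewrite !mxE; lra.
Qed.

Lemma lebesgue_rV_eball m r : (0 < r)%R ->
  lebesgue_rV R m (eball r) = (unit_ball_volume R m * r ^+ m)%:E.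
Proof.
move=> r0; rewrite (@lebesgue_rV_scale _ r)//; last exact: measurable_eball.
rewrite mulrC EFinM; congr (_ * _); rewrite /unit_ball_volume fineK.
  congr (lebesgue_rV R m _); apply/seteqP; split=> x;
  by rewrite /eball /= enormZ gtr0_norm// -ler_pdivlMl// mulVf// gt_eqF.
exact: lebesgue_rV_eball_fin_num.
Qed.

Lemma unit_ball_volume_gt0 m : (0 < unit_ball_volume R m)%R.
Proof.
have : 0 < lebesgue_rV R m (cube m.+1%:R^-1).
  rewrite lebesgue_rV_obox lte_fin prodr_gt0// => i _.
  by rewrite !mxE opprK lt_max addr_gt0 ?orbT.
move=> /lt_le_trans H; rewrite /unit_ball_volume fine_gt0//; apply/andP; split.
  apply: H; apply: le_measure; rewrite ?inE; [exact: measurable_obox|exact: measurable_eball|].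
  move=> x xm; apply: le_trans (ler_enorm_sum x) _.
  apply: (@le_trans _ _ (\sum_(i < m) m.+1%:R^-1)%R).
    by apply: ler_sum => i _; rewrite ler_norml; have := xm i; rewrite !mxE => /andP[/ltW -> /ltW ->].
  by rewrite sumr_const card_ord -[leLHS]mulr_natl ler_pdivrMr// mul1r ler_nat.
by have := lebesgue_rV_eball_fin_num m 1; rewrite fin_numElt => /andP[].
Qed.

(** The midpoints of A and - A lie in the ball of radius d / 2, and A and - A have
    the same measure, so that the Brunn-Minkowski inequality bounds the square of
    the measure of A by the square of that of the ball. *)
Lemma isodiametric m (A : set 'rV[R]_m) d : (0 < d)%R -> measurable A ->
  (forall x y, A x -> A y -> (enorm (x - y) <= d)%R) ->
  lebesgue_rV R m A <= (unit_ball_volume R m * (d / 2) ^+ m)%:E.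
Proof.
move=> d0 mA Ad.
have [->|/set0P[x0 Ax0]] := eqVneq A set0.
  by rewrite measure0 lee_fin mulr_ge0 ?exprn_ge0 ?divr_ge0 ?ltW// unit_ball_volume_gt0.
(* A cube around A, - A and the ball of radius d / 2. *)
pose r := (enorm x0 + d + 1)%R.
have Ar : A `<=` cube r.
  move=> x Ax; apply: (@eball_sub_cube _ (enorm x0 + d)%R); first by rewrite ltrDl.
  rewrite /eball/= -[x](subrK x0) addrC; apply: le_trans (ler_enormD _ _) _.
  by rewrite lerD2l Ad.
have mNA : measurable [set x | A (- x)%R].
  by rewrite -[X in measurable X]setTI; exact: (@measurable_rV_opp m _ A mA).
have := @brunn_minkowski_rV _ r A [set x | A (- x)%R] (eball (d / 2)) mA mNA
  (@measurable_eball _ _) Ar.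
rewrite lebesgue_rV_opp// lebesgue_rV_eball ?divr_gt0// => H.
have {}H : lebesgue_rV R m A * lebesgue_rV R m A <= (unit_ball_volume R m * (d / 2) ^+ m)%:E ^+ 2.
  apply: H.
  - by move=> x /= /Ar xr i; have := xr i; rewrite !mxE; lra.
  - by apply: eball_sub_cube; have := enorm_ge0 x0; rewrite /r; move: d0; lra.
  - move=> x y Ax /= Ay; rewrite /eball/= enormZ gtr0_norm ?invr_gt0// mulrC ler_pM2r ?invr_gt0//.
    by have := Ad _ _ Ax Ay; rewrite opprK.
have Afin : lebesgue_rV R m A \is a fin_num by apply: lebesgue_rV_cube_fin_num Ar.
move: H; rewrite -(fineK Afin) -EFinM -EFin_expe !lee_fin -expr2 ler_sqr ?nnegrE ?fine_ge0//.
by rewrite mulr_ge0 ?exprn_ge0 ?divr_ge0 ?ltW// unit_ball_volume_gt0.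
Qed.

End isodiametric.

(** * Hausdorff and Lebesgue measure in top dimension *)

Section hausdorff_lebesgue.
Context {R : realType}.
Local Open Scope ereal_scope.

Lemma ediam_leP n (C : set 'rV[R]_n) d :
  (forall x y, C x -> C y -> (enorm (x - y) <= d)%R) -> ediam C <= d%:E.
Proof. by move=> Cd; apply: ge_ereal_sup => _ [x Cx [y Cy <-]]; rewrite lee_fin Cd. Qed.

Lemma ediam_ub n (C : set 'rV[R]_n) x y : C x -> C y -> (enorm (x - y))%:E <= ediam C.
Proof. by move=> Cx Cy; apply: ereal_sup_ubound; exists x => //; exists y. Qed.

Lemma ediam_ge0 n (C : set 'rV[R]_n) : C !=set0 -> 0 <= ediam C.
Proof. by move=> [x Cx]; apply: le_trans (ediam_ub Cx Cx); rewrite lee_fin enorm_ge0. Qed.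

Lemma ediam_set0 n d : ediam (set0 : set 'rV[R]_n) <= d%:E.
Proof. exact: ediam_leP. Qed.

Lemma hausdorff_gauge_set0 n k : hausdorff_gauge k (set0 : set 'rV[R]_n) = 0.
Proof. by rewrite /hausdorff_gauge eqxx. Qed.

Lemma hausdorff_gauge_ub n k (C : set 'rV[R]_n) d : (0 <= d)%R -> ediam C <= d%:E ->
  hausdorff_gauge k C <= (unit_ball_volume R k / 2 ^+ k * d ^+ k)%:E.
Proof.
move=> d0 Cd; have w0 : (0 <= unit_ball_volume R k / 2 ^+ k)%R.
  by rewrite divr_ge0 ?exprn_ge0 ?ltW// unit_ball_volume_gt0.
rewrite /hausdorff_gauge; case: ifPn => [_|/set0P/ediam_ge0 C0].
  by rewrite lee_fin mulr_ge0// exprn_ge0.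
have Cfin : ediam C \is a fin_num.
  by rewrite ge0_fin_numE//; apply: le_lt_trans Cd _; exact: ltry.
move: C0 Cd; rewrite -(fineK Cfin) !lee_fin => C0 Cd.
by rewrite -EFin_expe -EFinM lee_fin ler_wpM2l// lerXn2r ?nnegrE.
Qed.

Lemma hausdorff_pre_le n k d (A : set 'rV[R]_n) : (0 < d)%R ->
  hausdorff_pre k d A <= hausdorff k A.
Proof. by move=> d0; apply: ereal_sup_ubound; exists d. Qed.

Lemma hausdorff_pre_cover n k d (A : set 'rV[R]_n) (C : nat -> set 'rV[R]_n) :
  (forall j, ediam (C j) <= d%:E) -> A `<=` \bigcup_j C j ->
  hausdorff_pre k d A <= \sum_(j <oo) hausdorff_gauge k (C j).
Proof. by move=> Cd AC; apply: ereal_inf_lbound; exists C. Qed.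

(** Finitely many sets together with a covering of the remainder E give a covering
    of A. *)
Lemma hausdorff_pre_finU n k d (A E : set 'rV[R]_n) (B : nat -> set 'rV[R]_n) N :
  (forall j, ediam (B j) <= d%:E) -> A `<=` (\bigcup_(j < N) B j) `|` E ->
  hausdorff_pre k d A <= \sum_(j < N) hausdorff_gauge k (B j) + hausdorff_pre k d E.
Proof.
move=> Bd ABE.
have Bfin : \sum_(j < N) hausdorff_gauge k (B j) \is a fin_num.
  rewrite sum_fin_num; apply/allP => _ /mapP[j _ ->].
  have d0 : (0 <= Num.max d 0)%R by rewrite le_max lexx orbT.
  rewrite /= ge0_fin_numE; last exact: hausdorff_gauge_ge0.
  apply: le_lt_trans (hausdorff_gauge_ub k d0 _) (ltry _).
  by apply: le_trans (Bd j) _; rewrite lee_fin le_max lexx.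
rewrite -leeBlDl//; apply: le_ereal_inf_tmp => _ [D [Dd ED] <-].
rewrite leeBlDl//.
pose C j := if (j < N)%N then B j else D (j - N)%N.
apply: le_trans (@hausdorff_pre_cover _ k d A C _ _) _.
- by move=> j; rewrite /C; case: ifP.
- move=> x /ABE[[j /= jN Bx]|/ED[j _ Dx]]; first by exists j; rewrite // /C jN.
  by exists (N + j)%N => //; rewrite /C ltnNge leq_addr/= addKn.
rewrite (nneseries_split _ N)//; last by move=> ? _; exact: hausdorff_gauge_ge0.
rewrite add0n big_mkord; apply: leeD.
  by apply: lee_sum => j _; rewrite /C ltn_ord.
rewrite -(nneseries_addn (f := fun j => hausdorff_gauge k (C j))); last first.
  by move=> j; exact: hausdorff_gauge_ge0.
apply: lee_nneseries => [j _ _|j _]; first exact: hausdorff_gauge_ge0.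
by rewrite /C ltnNge leq_addl/= addnK.
Qed.

(** The isodiametric inequality for the closure of C, which has the same diameter
    and, unlike C, is measurable. Diameter 0 is obtained as a limit, except in
    dimension 0, where the gauge of a point is 1. *)
Lemma lebesgue_rV_closure_le_gauge m (C : set 'rV[R]_m) d : ediam C <= d%:E ->
  lebesgue_rV R m (closure C) <= hausdorff_gauge m C.
Proof.
move=> Cd.
have [->|C0] := eqVneq C set0; first by rewrite closure0 measure0 hausdorff_gauge_set0.
rewrite /hausdorff_gauge (negbTE C0).
have D0 := ediam_ge0 ((set0P _).1 C0).
have Cfin : ediam C \is a fin_num.
  by rewrite ge0_fin_numE//; apply: le_lt_trans Cd _; exact: ltry.
pose e := fine (ediam C).
have e0 : (0 <= e)%R by rewrite fine_ge0.
have clC x y : closure C x -> closure C y -> (enorm (x - y) <= e)%R.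
  move=> /closure_enormP Cx /closure_enormP Cy; apply/ler_addgt0Pr => r r0.
  have [x' Cx' xx'] := Cx _ (divr_gt0 r0 (ltr0Sn R 1)).
  have [y' Cy' yy'] := Cy _ (divr_gt0 r0 (ltr0Sn R 1)).
  have := ediam_ub Cx' Cy'; rewrite -(fineK Cfin) lee_fin -/e.
  have := ler_enormD_dist x' x y; have := ler_enormD_dist y' x' y.
  by move: xx'; rewrite (enormB x' x); lra.
have mcl : measurable (closure C) by apply: closed_measurable_rV; exact: closed_closure.
have iso r : (0 < r)%R -> (e <= r)%R ->
    lebesgue_rV R m (closure C) <= (unit_ball_volume R m * (r / 2) ^+ m)%:E.
  by move=> r0 er; apply: isodiametric => // x y Cx Cy; exact: le_trans (clC _ _ Cx Cy) er.
rewrite -(fineK Cfin) -/e -EFin_expe -EFinM mulrAC -mulrA -expr_div_n.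
move: e0; rewrite le_eqVlt => /predU1P[e0|e0]; last exact: iso.
rewrite -e0 mul0r expr0n; have w0 := @unit_ball_volume_gt0 R m.
have [m0|m0] := boolP (m == 0%N).
  have e1 : (e <= 1)%R by rewrite -e0.
  apply: le_trans (iso 1%R ltr01 e1) _; rewrite lee_fin.
  have -> : ((1 / 2) ^+ m = 1 :> R)%R by rewrite (eqP m0) expr0.
  by [].
rewrite mulr0; apply/lee_addgt0Pr => r r0; rewrite add0e.
(* C is a point: the isodiametric inequality holds with every t > 0 in place of the
   diameter 0. *)
pose t := Num.min 1%R (r / unit_ball_volume R m)%R.
have t0 : (0 < t)%R by rewrite lt_min ltr01 divr_gt0.
apply: le_trans (iso t t0 _) _; first by rewrite -e0 ltW.
rewrite lee_fin mulrC -ler_pdivlMr//; apply: (@le_trans _ _ t); last by rewrite ge_min lexx orbT.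
have t1 : (t <= 1)%R by rewrite ge_min lexx.
apply: (@le_trans _ _ (t / 2)%R); last by move: t0; lra.
rewrite -[leRHS]expr1 ler_wiXn2l//; [lra|lra|by rewrite lt0n].
Qed.

Lemma lebesgue_le_hausdorff m (A : set 'rV[R]_m) : measurable A ->
  lebesgue_rV R m A <= hausdorff m A.
Proof.
move=> mA; apply: le_trans (hausdorff_pre_le m A ltr01).
apply: le_ereal_inf_tmp => _ [C [Cd AC] <-].
have mcl k : measurable (closure (C k)) by apply: closed_measurable_rV; exact: closed_closure.
apply: (@le_trans _ _ (\sum_(k <oo) lebesgue_rV R m (closure (C k)))).
  apply: measure_sigma_subadditive => //.
  by move=> x /AC[k _ Cx]; exists k => //; exact: subset_closure.
apply: lee_nneseries => k _ //.
exact: lebesgue_rV_closure_le_gauge (Cd k).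
Qed.

End hausdorff_lebesgue.

Section grid.
Context {R : realType} {m : nat}.
Local Open Scope ereal_scope.
Local Notation L := (lebesgue_rV R m).

(** Half-open cubes of side s, which partition the space when z ranges over the
    integer vectors. *)
Definition cell (s : R) (z : 'rV[int]_m) : set 'rV[R]_m :=
  [set x | forall i, ((z 0 i)%:~R * s <= x 0 i < (z 0 i + 1)%:~R * s)%R].

(** A ball that is concentric with the cell and of radius s / 4, half the largest
    possible one, so that the closed ball is inside the half-open cell. *)
Definition cell_ball (s : R) (z : 'rV[int]_m) : set 'rV[R]_m :=
  [set x | eball (s / 4) (x - \row_i (((z 0 i)%:~R + 2^-1) * s))%R].

Lemma measurable_cell s z : measurable (cell s z).
Proof.
rewrite (_ : cell s z = \bigcap_(i in [set: 'I_m])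
    ([set: 'rV[R]_m] `&` (fun x : 'rV[R]_m => x 0%R i) @^-1`
      `[((z 0 i)%:~R * s)%R, ((z 0 i + 1)%:~R * s)%R[%classic)).
  by apply: fin_bigcap_measurable => // i _; apply: measurable_coord => //; exact: measurable_itv.
apply/seteqP; split=> [x xs i _|x xs i]; first by split=> //=; rewrite in_itv; exact: xs.
by have [_] := xs i Logic.I; rewrite /= in_itv.
Qed.

Lemma cell_inj s z z' x : (0 < s)%R -> cell s z x -> cell s z' x -> z = z'.
Proof.
move=> s0 xz xz'; apply/rowP => i.
have fl (w : 'rV[int]_m) : cell s w x -> Num.floor (x 0%R i / s)%R = w 0%R i.
  move=> /(_ i) /andP[x1 x2]; apply: floor_def.
  by rewrite ler_pdivlMr// ltr_pdivrMr// x1.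
by rewrite -(fl z)// -(fl z').
Qed.

Lemma cell_floor (s : R) (x : 'rV[R]_m) : (0 < s)%R -> cell s (\row_i Num.floor (x 0 i / s))%R x.
Proof.
move=> s0 i; rewrite !mxE; have := floor_itv (x 0 i / s)%R.
by rewrite ler_pdivlMr// ltr_pdivrMr.
Qed.

Lemma cell_dist (s : R) z (x y : 'rV[R]_m) i : cell s z x -> cell s z y -> (`|x 0 i - y 0 i| < s)%R.
Proof.
move=> /(_ i) /andP[x1 x2] /(_ i) /andP[y1 y2].
rewrite ltr_norml; move: x1 x2 y1 y2; rewrite intrD mulrDl mul1r; lra.
Qed.

Lemma ediam_cell s z : (0 <= s)%R -> ediam (cell s z) <= (m%:R * s)%:E.
Proof.
move=> s0; apply: ediam_leP => x y xz yz; apply: le_trans (ler_enorm_sum _) _.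
apply: (@le_trans _ _ (\sum_(i < m) s)%R).
  by apply: ler_sum => i _; rewrite !mxE ltW// (cell_dist i xz yz).
by rewrite sumr_const card_ord -[leLHS]mulr_natl.
Qed.

Lemma lebesgue_cell_ge s z : (0 < s)%R -> (s ^+ m)%:E <= L (cell s z).
Proof.
move=> s0.
apply: (@le_trans _ _ (L (obox (\row_i ((z 0 i)%:~R * s)) (\row_i ((z 0 i + 1)%:~R * s)))%R)).
  rewrite lebesgue_rV_obox lee_fin (eq_bigr (fun=> s)); last first.
    by move=> i _; rewrite !mxE -mulrBl intrD addrAC subrr add0r mul1r max_r// ltW.
  by rewrite prodr_const card_ord.
apply: le_measure; rewrite ?inE; [exact: measurable_obox|exact: measurable_cell|].
by move=> x xz i; have := xz i; rewrite !mxE => /andP[/ltW -> ->].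
Qed.

Lemma lebesgue_cell_le s z : (0 < s)%R -> L (cell s z) <= ((2 * s) ^+ m)%:E.
Proof.
move=> s0.
apply: (@le_trans _ _ (L (obox (\row_i ((z 0 i - 1)%:~R * s)) (\row_i ((z 0 i + 1)%:~R * s)))%R)).
  apply: le_measure; rewrite ?inE; [exact: measurable_cell|exact: measurable_obox|].
  move=> x xz i; have := xz i; rewrite !mxE => /andP[H ->]; rewrite andbT.
  by apply: lt_le_trans H; rewrite ltr_pM2r// ltr_int ltrBlDr ltrDl.
rewrite lebesgue_rV_obox lee_fin (eq_bigr (fun=> 2 * s)%R); last first.
  move=> i _; rewrite !mxE -mulrBl intrD intrB max_r; first by congr (_ * _)%R; ring.
  by rewrite mulr_ge0 ?ltW//; lra.
by rewrite prodr_const card_ord.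
Qed.

Lemma cell_ball_sub s z : (0 < s)%R -> cell_ball s z `<=` cell s z.
Proof.
move=> s0 x xb i; have /(fun H => le_trans H xb) := ler_coord_enorm (x - \row_i (((z 0 i)%:~R + 2^-1) * s))%R i.
rewrite !mxE ler_norml intrD !mulrDl; move: s0; lra.
Qed.

Lemma measurable_cell_ball s z : measurable (cell_ball s z).
Proof.
have mf : measurable_fun [set: 'rV[R]_m]
    (fun x : 'rV[R]_m => x - \row_i (((z 0 i)%:~R + 2^-1) * s))%R.
  apply: measurable_fun_rV => i.
  apply: (eq_measurable_fun (fun x : 'rV[R]_m => x 0 i - ((z 0 i)%:~R + 2^-1) * s)%R).
    by move=> x _; rewrite !mxE.
  by apply: measurable_funB => //; exact: measurable_coord.
rewrite -[X in measurable X]setTI; apply: mf => //; exact: measurable_eball.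
Qed.

Lemma closed_cell_ball s z : closed (cell_ball s z).
Proof.
rewrite -openC; apply/open_enormP => x /negP; rewrite -ltNge => xs.
set c := (\row_i _)%R in xs.
exists (enorm (x - c) - s / 4)%R; first by rewrite subr_gt0.
move=> y yx /=; apply/negP; rewrite -ltNge -/c.
by have := ler_enormD_dist y x c; rewrite (enormB x y); move: yx; lra.
Qed.

Lemma lebesgue_cell_ball s z : (0 < s)%R ->
  L (cell_ball s z) = (unit_ball_volume R m * (s / 4) ^+ m)%:E.
Proof.
move=> s0; rewrite -lebesgue_rV_eball ?divr_gt0//.
exact: (lebesgue_rV_translate (- \row_i (((z 0 i)%:~R + 2^-1) * s))%R (@measurable_eball R m _)).
Qed.

Lemma ediam_cell_ball s z : ediam (cell_ball s z) <= (s / 2)%:E.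
Proof.
apply: ediam_leP => x y; rewrite /cell_ball /eball/=; set c := (\row_i _)%R => xc yc.
by have := ler_enormD_dist c x y; rewrite (enormB c y); lra.
Qed.

(** For balls the isodiametric inequality is an equality: this is how the gauge is
    normalized. *)
Lemma gauge_cell_ball s z : (0 < s)%R -> hausdorff_gauge m (cell_ball s z) <= L (cell_ball s z).
Proof.
move=> s0; rewrite lebesgue_cell_ball//.
apply: le_trans (hausdorff_gauge_ub m _ (ediam_cell_ball s z)) _; first by rewrite divr_ge0// ltW.
rewrite lee_fin -mulrA ler_pM2l ?unit_ball_volume_gt0//.
rewrite -exprVn -exprMn; rewrite le_eqVlt; apply/orP; left; by apply/eqP; congr (_ ^+ _)%R; field.
Qed.

End grid.

Section hausdorff_le_lebesgue.
Context {R : realType} {m : nat}.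
Local Open Scope ereal_scope.
Local Notation L := (lebesgue_rV R m).
Local Notation H := (@hausdorff_measure R m m).
Implicit Types (U E : set 'rV[R]_m) (B : R -> 'rV[int]_m -> set 'rV[R]_m).

(** The sets B s z of those cells of side s that are contained in U, indexed by the
    code k of the vector z, and empty for the other values of k. *)
Definition cells U (s : R) B (k : nat) : set 'rV[R]_m :=
  if pickle_inv k is Some z then (if `[< cell s z `<=` U >] then B s z else set0) else set0.

Lemma cellsP U s B k : cells U s B k = set0 \/
  exists2 z, cells U s B k = B s z & cells U s (@cell R m) k = cell s z /\ cell s z `<=` U.
Proof.
rewrite /cells; case: (pickle_inv k) => [z|]; last by left.
by case: ifPn => [/asboolP zU|_]; [right; exists z|left].
Qed.

Lemma cells_le (f g : set 'rV[R]_m -> \bar R) U s B B' k :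
  f set0 <= g set0 -> (forall z, f (B s z) <= g (B' s z)) ->
  f (cells U s B k) <= g (cells U s B' k).
Proof. by move=> fg0 fg; rewrite /cells; case: (pickle_inv k) => // z; case: ifP. Qed.

Lemma measurable_cells U s B k : (forall z, measurable (B s z)) -> measurable (cells U s B k).
Proof. by move=> mB; have [->//|[z -> _]] := cellsP U s B k. Qed.

Lemma cells_sub U s B k : (forall z, B s z `<=` cell s z) -> cells U s B k `<=` U.
Proof. by move=> BQ; have [->//|[z -> [_ zU]]] := cellsP U s B k; apply: subset_trans zU. Qed.

Lemma trivIset_cells U s B : (0 < s)%R -> (forall z, B s z `<=` cell s z) ->
  trivIset [set: nat] (cells U s B).
Proof.
move=> s0 BQ i j _ _ [x [xi xj]]; move: xi xj; rewrite /cells.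
have := @pickle_invK 'rV[int]_m i; have := @pickle_invK 'rV[int]_m j.
case: (pickle_inv i) => [z|] /=; case: (pickle_inv j) => [z'|] //=.
move=> <- <-; case: ifPn => // _ /BQ xz; case: ifPn => // _ /BQ xz'.
by rewrite (cell_inj s0 xz xz').
Qed.

Definition grid_part U s := \bigcup_k cells U s (@cell R m) k.

Lemma measurable_grid_part U s : measurable (grid_part U s).
Proof. by apply: bigcupT_measurable => k; apply: measurable_cells => z; exact: measurable_cell. Qed.

Lemma grid_part_sub U s : grid_part U s `<=` U.
Proof. by move=> x [k _]; apply: (@cells_sub U s (@cell R m)) => z y. Qed.

Lemma grid_part_near U x : open U -> U x ->
  exists n, forall j, (n <= j)%N -> grid_part U j.+1%:R^-1 x.
Proof.
move=> /open_enormP oU /oU[e e0 eU].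
exists (Num.truncn (m%:R / e)) => j nj.
have s0 : (0 < j.+1%:R^-1 :> R)%R by rewrite invr_gt0.
have xz := cell_floor x s0; set z := (\row_i _)%R in xz.
have zU : cell j.+1%:R^-1 z `<=` U.
  move=> y yz; apply: eU; apply: le_lt_trans (ler_enorm_sum _) _.
  apply: (@le_lt_trans _ _ (\sum_(i < m) j.+1%:R^-1)%R).
    by apply: ler_sum => i _; rewrite !mxE ltW// (cell_dist i yz xz).
  rewrite sumr_const card_ord -[ltLHS]mulr_natl ltr_pdivrMr// mulrC -ltr_pdivrMr//.
  by apply: lt_le_trans (truncnS_gt _) _; rewrite ler_nat.
exists (pickle z) => //; rewrite /cells pickleK_inv ifT//; exact/asboolP.
Qed.

(** Every point of the open set U is in the grid part of U for all fine enough
    meshes. So U is the increasing union of the sets of points that are in all the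
    grid parts from the n-th on, and it suffices to bound the measure of subsets of
    all these grid parts. *)
Lemma measure_open_le (mu : {measure set 'rV[R]_m -> \bar R}) U c : open U ->
  (forall E n, measurable E -> (forall j, (n <= j)%N -> E `<=` grid_part U j.+1%:R^-1) ->
    mu E <= c) ->
  mu U <= c.
Proof.
move=> oU Ec.
pose E n := \bigcap_(j in [set j | (n <= j)%N]) grid_part U j.+1%:R^-1.
have mE n : measurable (E n).
  by apply: bigcap_measurable => [|j _]; [exists n => /=|exact: measurable_grid_part].
have UE : U = \bigcup_n E n.
  apply/seteqP; split=> [x Ux|x [n _ /(_ n (leqnn n))]]; last exact: grid_part_sub.
  by have [n nx] := grid_part_near oU Ux; exists n.
have cvE : mu \o E @ \oo --> mu U.
  rewrite UE; apply: nondecreasing_cvg_mu => //; first exact: bigcupT_measurable.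
  by move=> i j ij; apply/subsetPset => x Ex k /= jk; apply: Ex => /=; exact: leq_trans jk.
rewrite -(cvg_lim _ cvE)//; apply: lime_le; first by apply/cvg_ex; exists (mu U).
by apply: nearW => n /=; apply: (Ec _ n) => // j nj x; apply.
Qed.

Definition hausdorff_bound (C : R) := forall U, open U -> L U < +oo -> H U <= C%:E * L U.

Let w := unit_ball_volume R m.
Let K : R := (w / 2 ^+ m * m%:R ^+ m)%R.

(** Covering by the cells themselves gives some finite constant, the ratio of the
    gauge of a bound for the cell to its volume. *)
Lemma hausdorff_bound0 : hausdorff_bound K.
Proof.
have w0 : (0 < w)%R by exact: unit_ball_volume_gt0.
have K0 : (0 <= K)%R by rewrite mulr_ge0 ?exprn_ge0// divr_ge0 ?exprn_ge0// ltW.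
move=> U oU Uoo; apply: measure_open_le => // E n mE En.
apply: ge_ereal_sup => _ [d /= d0 <-].
pose j := maxn n (Num.truncn (m%:R / d)%R).
have s0 : (0 < j.+1%:R^-1 :> R)%R by rewrite invr_gt0.
have sd : (m%:R * j.+1%:R^-1 <= d)%R.
  rewrite ler_pdivrMr// mulrC -ler_pdivrMr//; apply/ltW.
  by apply: lt_le_trans (truncnS_gt _) _; rewrite ler_nat ltnS leq_maxr.
apply: le_trans (@hausdorff_pre_cover _ _ m d E (cells U j.+1%:R^-1 (@cell R m)) _ _) _.
- move=> k; have [->|[z -> _]] := cellsP U j.+1%:R^-1 (@cell R m) k.
    exact: ediam_set0.
  by apply: le_trans (ediam_cell _ (ltW s0)) _; rewrite lee_fin.
- by apply: En; rewrite leq_maxl.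
apply: (@le_trans _ _ (\sum_(k <oo) K%:E * L (cells U j.+1%:R^-1 (@cell R m) k))).
  apply: lee_nneseries => [k _ _|k _]; first exact: hausdorff_gauge_ge0.
  apply: (@cells_le (hausdorff_gauge m) (fun A => K%:E * L A)).
    by rewrite hausdorff_gauge_set0 mule_ge0.
  move=> z; apply: le_trans (hausdorff_gauge_ub _ _ (ediam_cell z (ltW s0))) _.
    by rewrite mulr_ge0// ltW.
  rewrite exprMn mulrA EFinM; apply: lee_wpmul2l; first by rewrite lee_fin.
  exact: lebesgue_cell_ge.
rewrite nneseriesZl; last by move=> k _; exact: measure_ge0.
rewrite -measure_semi_bigcup//.
- apply: lee_wpmul2l => //; apply: le_measure; rewrite ?inE; last exact: grid_part_sub.
    exact: measurable_grid_part.
  exact: open_measurable_rV.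
- by move=> k; apply: measurable_cells => z; exact: measurable_cell.
- by apply: trivIset_cells => // z y.
- exact: measurable_grid_part.
Qed.

Let theta : R := (Num.min (w / 8 ^+ m) 2^-1)%R.

(** Cover the balls that are concentric with the cells of U by themselves, at the
    cost of exactly their volume, and use the constant C only on what is left of U.
    The balls take a fixed proportion theta of the volume, whatever the mesh, which
    moves the constant C by that proportion towards 1. *)
Lemma hausdorff_bound_improve C : (1 < C)%R -> hausdorff_bound C ->
  hausdorff_bound (C - (C - 1) * theta)%R.
Proof.
move=> C1 HC U oU Uoo.
have w0 : (0 < w)%R by exact: unit_ball_volume_gt0.
have th0 : (0 < theta)%R by rewrite lt_min divr_gt0 ?exprn_gt0//= invr_gt0.
have mU : measurable U by exact: open_measurable_rV.
have Ufin : L U \is a fin_num by rewrite ge0_fin_numE.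
apply: ge_ereal_sup => _ [d /= d0 <-].
have hfin : hausdorff_pre m d U \is a fin_num.
  rewrite ge0_fin_numE; last exact: hausdorff_pre_ge0.
  apply: le_lt_trans (hausdorff_pre_le m U d0) _; apply: le_lt_trans (HC _ oU Uoo) _.
  by rewrite lte_mul_pinfty// lee_fin; move: C1; lra.
set u := fine (L U); set h := fine (hausdorff_pre m d U).
(* The bound is turned into one on L U, which can be tested on the grid parts. *)
suff Lb : L U <= ((C * u - h) / ((C - 1) * theta))%:E.
  move: Lb; rewrite -(fineK Ufin) -(fineK hfin) -/u -/h -EFinM !lee_fin.
  by rewrite ler_pdivlMr ?mulr_gt0 ?subr_gt0//; lra.
apply: measure_open_le => // E n mE En.
pose j := maxn n (Num.truncn d^-1%R).
set s : R := (j.+1%:R^-1)%R.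
have s0 : (0 < s)%R by rewrite invr_gt0.
have sd : (s / 2 <= d)%R.
  apply: (@le_trans _ _ s); first by rewrite ler_pdivrMr// ler_pMr// ler1n.
  rewrite -[leRHS]invrK lef_pV2 ?posrE ?invr_gt0//; apply/ltW.
  by apply: lt_le_trans (truncnS_gt _) _; rewrite ler_nat ltnS leq_maxr.
pose F := cells U s (@cell R m); pose B := cells U s (@cell_ball R m).
have mF k : measurable (F k) by apply: measurable_cells => z; exact: measurable_cell.
have mB k : measurable (B k) by apply: measurable_cells => z; exact: measurable_cell_ball.
apply: (@le_trans _ _ (L (\bigcup_k F k))).
  by apply: le_measure; rewrite ?inE//; [exact: measurable_grid_part|apply: En; rewrite leq_maxl].
rewrite measure_semi_bigcup//; last 2 first.
- by apply: trivIset_cells => // z y.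
- exact: measurable_grid_part.
apply: lime_le; first by apply: is_cvg_nneseries.
apply: nearW => N; rewrite big_mkord.
pose BN := \big[setU/set0]_(k < N) B k.
have mBN : measurable BN by apply: bigsetU_measurable.
have BU : BN `<=` U.
  by rewrite /BN -(bigcup_mkord N B) => x [k _]; apply: cells_sub => z; exact: cell_ball_sub.
have LBN : L BN = \sum_(k < N) L (B k).
  rewrite /BN measure_bigsetU//; apply: (@sub_trivIset _ _ _ setT) => //.
  by apply: trivIset_cells => // z; exact: cell_ball_sub.
have BNfin : L BN \is a fin_num.
  by rewrite ge0_fin_numE//; apply: le_lt_trans Uoo; apply: le_measure; rewrite ?inE.
have oD : open (U `\` BN).
  rewrite setDE; apply: openI => //; rewrite openC /BN.
  elim/big_ind : _ => [||k _]; [exact: closed0|by move=> ? ? ? ?; exact: closedU|].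
  rewrite /B; have [->|[z -> _]] := cellsP U s (@cell_ball R m) k; first exact: closed0.
  exact: closed_cell_ball.
have LD : L (U `\` BN) = L U - L BN by rewrite measureD// setIidr.
(* The balls of BN are finitely many, so that U `\` BN is open and the bound C
   applies to it. *)
have hle : (h%:E <= L BN + C%:E * (L U - L BN)).
  rewrite fineK//; apply: le_trans (@hausdorff_pre_finU _ _ m d U (U `\` BN) B N _ _) _.
  - move=> k; rewrite /B; have [->|[z -> _]] := cellsP U s (@cell_ball R m) k.
      exact: ediam_set0.
    by apply: le_trans (ediam_cell_ball _ _) _; rewrite lee_fin.
  - move=> x Ux; have [xB|xB] := pselect (BN x); last by right.
    by left; move: xB; rewrite /BN -(bigcup_mkord N B).
  - apply: leeD.
      rewrite LBN; apply: lee_sum => k _.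
      apply: (@cells_le (hausdorff_gauge m) L); first by rewrite hausdorff_gauge_set0 measure0.
      by move=> z; exact: gauge_cell_ball.
    apply: le_trans (hausdorff_pre_le m _ d0) _; rewrite -LD; apply: HC => //.
    by apply: le_lt_trans Uoo; apply: le_measure; rewrite ?inE//; exact: measurableD.
(* A cell is contained in an open box of volume (2 s)^m, and its ball has volume
   w (s / 4)^m: the quotient is w / 8^m. *)
have thF : theta%:E * \sum_(k < N) L (F k) <= L BN.
  rewrite LBN ge0_sume_distrr//; apply: lee_sum => k _.
  apply: (@cells_le (fun A => theta%:E * L A) L); first by rewrite measure0 mule0.
  move=> z; rewrite lebesgue_cell_ball//.
  apply: (@le_trans _ _ (theta%:E * ((2 * s) ^+ m)%:E)).
    by apply: lee_wpmul2l; [rewrite lee_fin ltW|exact: lebesgue_cell_le].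
  rewrite -EFinM lee_fin; apply: (@le_trans _ _ (w / 8 ^+ m * (2 * s) ^+ m)%R).
    apply: ler_wpM2r; last by rewrite /theta ge_min lexx.
    by apply: exprn_ge0; apply: mulr_ge0 => //; exact: ltW.
  rewrite -mulrA ler_pM2l// -exprVn -exprMn.
  by rewrite le_eqVlt; apply/orP; left; apply/eqP; congr (_ ^+ _)%R; field.
have Ffin : \sum_(k < N) L (F k) \is a fin_num.
  rewrite ge0_fin_numE ?sume_ge0//.
  have -> : \sum_(k < N) L (F k) = L (\big[setU/set0]_(k < N) F k).
    rewrite measure_bigsetU//; apply: (@sub_trivIset _ _ _ setT) => //.
    by apply: trivIset_cells => // z y.
  apply: le_lt_trans Uoo; apply: le_measure; rewrite ?inE//.
    by apply: bigsetU_measurable => k _; exact: mF.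
  by rewrite -(bigcup_mkord N F) => x [k _]; apply: (@cells_sub U s (@cell R m)) => z y.
move: hle thF; rewrite -(fineK Ffin) -(fineK Ufin) -(fineK BNfin) -/u.
move: (fine _) (fine (L BN)) => f b; rewrite -EFinB -!EFinM -EFinD !lee_fin => hle thF.
rewrite ler_pdivlMr ?mulr_gt0 ?subr_gt0//.
have : (0 <= (C - 1) * (b - theta * f))%R by rewrite mulr_ge0// subr_ge0// ltW.
by move: hle; lra.
Qed.

(** Iterated improvement makes the constant converge to 1 geometrically. *)
Lemma hausdorff_le_lebesgue_open U : open U -> L U < +oo -> H U <= L U.
Proof.
move=> oU Uoo.
have w0 : (0 < w)%R by exact: unit_ball_volume_gt0.
have K0 : (0 <= K)%R by rewrite mulr_ge0 ?exprn_ge0// divr_ge0 ?exprn_ge0// ltW.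
have th0 : (0 < theta)%R by rewrite lt_min divr_gt0 ?exprn_gt0//= invr_gt0.
have th1 : (theta < 1)%R.
  by apply: (@le_lt_trans _ _ 2^-1%R); [rewrite /theta ge_min lexx orbT|rewrite invf_lt1// ltr1n].
have bound n : hausdorff_bound (1 + (1 - theta) ^+ n * (K + 1))%R.
  elim: n => [|n ih].
    rewrite expr0 mul1r => V oV Voo; apply: le_trans (hausdorff_bound0 oV Voo) _.
    by apply: lee_wpmul2r => //; rewrite lee_fin; lra.
  have q0 : (0 < (1 - theta) ^+ n * (K + 1))%R.
    by rewrite mulr_gt0// ?exprn_gt0 ?subr_gt0// ltr_wpDl.
  have := hausdorff_bound_improve _ ih; rewrite ltrDl => /(_ q0).
  by congr hausdorff_bound; rewrite exprS; ring.
have Ufin : L U \is a fin_num by rewrite ge0_fin_numE.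
apply/lee_addgt0Pr => e e0.
have [n ne] : exists n, ((1 - theta) ^+ n * ((K + 1) * fine (L U)) <= e)%R.
  have q1 : (`|1 - theta| < 1)%R by rewrite ltr_norml; apply/andP; split; move: th0 th1; lra.
  have : ((1 - theta) ^+ n * ((K + 1) * fine (L U)))%R @[n --> \oo] -->
      (0 * ((K + 1) * fine (L U)))%R.
    by apply: cvgM; [exact: cvg_expr|exact: cvg_cst].
  rewrite mul0r => /cvgrPdist_le/(_ e e0)[n _ /(_ n (leqnn n))] /=.
  rewrite sub0r normrN => H1; exists n; apply: le_trans H1.
  exact: ler_norm.
apply: le_trans (bound n U oU Uoo) _; rewrite -(fineK Ufin) -EFinM -EFinD lee_fin.
by move: ne; lra.
Qed.

Theorem hausdorff_lebesgue A : measurable A -> H A = L A.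
Proof.
move=> mA; apply/esym; apply: rV_measure_unique => // a b.
  apply/eqP; rewrite eq_le; apply/andP; split.
    by apply: lebesgue_le_hausdorff; exact: measurable_obox.
  apply: hausdorff_le_lebesgue_open; [exact: open_obox|exact: lebesgue_rV_obox_lty].
exact: lebesgue_rV_obox_lty.
Qed.

End hausdorff_le_lebesgue.

(** * Hausdorff measure of nearly flat graphs *)

Section area.
Context {R : realType}.
Local Open Scope ereal_scope.

Lemma hausdorff_gauge_le p q k (C : set 'rV[R]_p) (D : set 'rV[R]_q) (c d : R) :
  (0 < c)%R -> (D !=set0 -> C !=set0) -> ediam C <= d%:E -> ediam D <= c%:E * ediam C ->
  hausdorff_gauge k D <= (c ^+ k)%:E * hausdorff_gauge k C.
Proof.
move=> c0 DC Cd DcC.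
have [->|D0] := eqVneq D set0.
  by rewrite hausdorff_gauge_set0 mule_ge0// ?hausdorff_gauge_ge0// lee_fin exprn_ge0// ltW.
have C0 := DC ((set0P _).1 D0).
have Cfin : ediam C \is a fin_num.
  by rewrite ge0_fin_numE ?ediam_ge0//; apply: le_lt_trans Cd (ltry _).
have dC : (0 <= fine (ediam C))%R by rewrite fine_ge0// ediam_ge0.
move: DcC; rewrite -(fineK Cfin) -EFinM => DcC.
apply: le_trans (hausdorff_gauge_ub k _ DcC) _; first by rewrite mulr_ge0// ltW.
rewrite /hausdorff_gauge ifN; last exact/set0P.
by rewrite -(fineK Cfin) -EFin_expe -!EFinM lee_fin exprMn mulrCA.
Qed.

(** Both sets are parametrized by E, so that a covering of f @` E is transported to
    one of g @` E without inverting f. *)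
Lemma hausdorff_lipschitz p q k (T : Type) (E : set T) (f : T -> 'rV[R]_p)
    (g : T -> 'rV[R]_q) c : (0 < c)%R ->
  (forall x y, E x -> E y -> (enorm (g x - g y) <= c * enorm (f x - f y))%R) ->
  hausdorff k (g @` E) <= (c ^+ k)%:E * hausdorff k (f @` E).
Proof.
move=> c0 gf.
have ck : (0 < c ^+ k)%R by rewrite exprn_gt0.
apply: ge_ereal_sup => _ [d /= d0 <-].
have dc0 : (0 < d / c)%R by rewrite divr_gt0.
apply: (@le_trans _ _ ((c ^+ k)%:E * hausdorff_pre k (d / c) (f @` E))); last first.
  by apply: lee_wpmul2l; [rewrite lee_fin ltW|exact: hausdorff_pre_le].
rewrite -lee_pdivrMl//; apply: le_ereal_inf_tmp => _ [C [Cd EC] <-].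
rewrite lee_pdivrMl//.
have diam j : ediam (g @` (E `&` f @^-1` C j)) <= c%:E * ediam (C j).
  apply: ge_ereal_sup => _ [_ [x [Ex Cx] <-] [_ [y [Ey Cy] <-] <-]].
  apply: (@le_trans _ _ (c%:E * (enorm (f x - f y))%:E)); first by rewrite -EFinM lee_fin gf.
  by apply: lee_wpmul2l; [rewrite lee_fin ltW|exact: ediam_ub].
apply: le_trans (@hausdorff_pre_cover _ _ k d _ (fun j => g @` (E `&` f @^-1` C j)) _ _) _.
- move=> j; apply: le_trans (diam j) _.
  apply: (@le_trans _ _ (c%:E * (d / c)%:E)).
    by apply: lee_wpmul2l; [rewrite lee_fin ltW|exact: Cd].
  by rewrite -EFinM mulrC divfK// gt_eqF.
- move=> _ [x Ex <-]; have [j _ Cx] := EC _ (imageP f Ex).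
  by exists j => //; exists x.
rewrite -nneseriesZl; last by move=> j _; exact: hausdorff_gauge_ge0.
apply: lee_nneseries => [j _ _|j _]; first exact: hausdorff_gauge_ge0.
apply: (@hausdorff_gauge_le p q k _ _ c (d / c)%R) => //.
by move=> [_ [x [_ Cx] _]]; exists (f x).
Qed.

Close Scope ereal_scope.

Definition householder m (w y : 'rV[R]_m) : 'rV[R]_m :=
  (y - (2 * dot w y / dot w w) *: w)%R.

Lemma dot_householder m (w y z : 'rV[R]_m) :
  dot (householder w y) (householder w z) = dot y z.
Proof.
rewrite /householder dotBl !dotBr !dotZl !dotZr (dotC y w).
have [->|w0] := eqVneq (dot w w) 0%R; first by rewrite invr0; ring.
by field.
Qed.

Lemma householderK m (w : 'rV[R]_m) : involutive (householder w).
Proof.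
move=> y; rewrite /householder dotBr dotZr.
have [->|w0] := eqVneq (dot w w) 0%R; first by rewrite invr0 !(mulr0, scale0r, subr0).
rewrite -addrA -opprD -scalerDl.
suff -> : (2 * dot w y / dot w w +
    2 * (dot w y - 2 * dot w y / dot w w * dot w w) / dot w w = 0)%R.
  by rewrite scale0r subr0.
by field.
Qed.

Lemma householderB m (w y z : 'rV[R]_m) :
  householder w (y - z) = (householder w y - householder w z)%R.
Proof.
rewrite /householder dotBr mulrBr mulrBl scalerBl !opprB.
by apply/rowP => i; rewrite !mxE; ring.
Qed.

Lemma enorm_householder m (w y : 'rV[R]_m) : enorm (householder w y) = enorm y.
Proof. by rewrite /enorm dot_householder. Qed.

Lemma dot_rV_del m (i : 'I_m.+1) (x y : 'rV[R]_m.+1) :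
  dot x y = (x 0 i * y 0 i + dot (rV_del i x) (rV_del i y))%R.
Proof. by rewrite /dot (bigD1_ord i)//=; congr +%R; apply: eq_bigr => k _; rewrite !mxE. Qed.

Lemma dot_delta m (i : 'I_m) (x : 'rV[R]_m) : dot (delta_mx 0 i) x = x 0 i.
Proof.
rewrite /dot (bigD1 i)//= big1 ?mxE ?eqxx ?mul1r ?addr0// => j ji.
by rewrite mxE (negbTE ji) andbF mul0r.
Qed.

Lemma householder_to_axis m (a : 'rV[R]_m.+1) :
  householder (a - enorm a *: delta_mx 0 ord0)%R a = (enorm a *: delta_mx 0 ord0)%R.
Proof.
set e := delta_mx 0 ord0; set w := (a - _)%R.
have dee : dot e e = 1%R by rewrite dot_delta mxE !eqxx.
have aa : dot a a = (enorm a ^+ 2)%R by rewrite sqr_enorm.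
have ww : dot w w = (2 * dot w a)%R.
  rewrite /w !dotBl !dotBr !dotZl !dotZr dee aa (dotC e a).
  by ring.
rewrite /householder -ww.
have [w0|w0] := eqVneq (dot w w) 0%R.
  have w00 : w = 0%R by apply/eqP; rewrite -enorm_eq0 /enorm w0 sqrtr0.
  by rewrite w0 mul0r scale0r subr0; apply/eqP; rewrite -subr_eq0 -/w w00.
by rewrite divff// scale1r /w opprB addrC subrK.
Qed.

(** Hausdorff measure only depends on distances. *)
Lemma lebesgue_rV_isometry m (g : 'rV[R]_m -> 'rV[R]_m) (A : set 'rV[R]_m) :
  involutive g -> (forall x y, enorm (g x - g y) = enorm (x - y)) ->
  measurable A -> measurable (g @` A) /\ lebesgue_rV R m (g @` A) = lebesgue_rV R m A.
Proof.
move=> gK gi mA.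
have gE : g @` A = g @^-1` A.
  by apply/seteqP; split=> [_ [x Ax <-]|x Ax]; rewrite /= ?gK//; exists (g x).
have mg : measurable_fun [set: 'rV[R]_m] g.
  apply: (@measurability _ _ _ _ _ _ (@open 'rV[R]_m)) => //.
  move=> _ [U /open_enormP oU <-]; rewrite setTI; apply: open_measurable_rV.
  apply/open_enormP => x /oU[e e0 eU]; exists e => // y yx.
  by apply: eU; rewrite gi.
have mgA : measurable (g @` A) by rewrite gE -[X in measurable X]setTI; exact: mg.
split => //; rewrite -hausdorff_lebesgue// -[RHS]hausdorff_lebesgue//.
have id1 : id @` A = A by rewrite image_id.
apply/eqP; rewrite eq_le; apply/andP; split.
  have := @hausdorff_lipschitz m m m _ A id g 1%R ltr01.
  rewrite id1 expr1n mul1e; apply => x y _ _; by rewrite mul1r gi.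
have := @hausdorff_lipschitz m m m _ A g id 1%R ltr01.
by rewrite id1 expr1n mul1e; apply => x y _ _; rewrite mul1r gi.
Qed.

(** The map y |-> (y, - dot a y) onto a hyperplane of R^(m+1), up to isometry: S is
    a reflection that sends a to the first axis, followed by a dilation along this
    axis by the factor sqrt (1 + |a|^2). *)
Lemma stretch_area m (a : 'rV[R]_m) : exists S : 'rV[R]_m -> 'rV[R]_m,
  (forall y z, enorm (S y - S z) ^+ 2 = enorm (y - z) ^+ 2 + dot a (y - z) ^+ 2)%R /\
  (forall E, measurable E -> measurable (S @` E) /\
    (lebesgue_rV R m (S @` E) = (Num.sqrt (1 + dot a a))%:E * lebesgue_rV R m E)%E).
Proof.
case: m a => [|m] a.
  have d0 (x y : 'rV[R]_0) : dot x y = 0%R by rewrite /dot big_ord0.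
  exists id; split=> [y z|E mE]; first by rewrite !sqr_enorm !d0 expr0n addr0.
  by rewrite image_id d0 addr0 sqrtr1 mul1e.
pose t := Num.sqrt (1 + dot a a).
have t0 : (0 < t)%R by rewrite sqrtr_gt0 ltr_pwDl// dot_ge0.
have t2 : (t ^+ 2 = 1 + enorm a ^+ 2)%R by rewrite sqr_sqrtr ?sqr_enorm// addr_ge0// dot_ge0.
pose w := (a - enorm a *: delta_mx 0 ord0)%R.
pose c : 'rV[R]_m.+1 := \row_i (if i == ord0 then t else 1)%R.
pose D (y : 'rV[R]_m.+1) : 'rV[R]_m.+1 := \row_i (c 0 i * y 0 i + (0 : 'rV[R]_m.+1) 0 i)%R.
have cE i : c 0 (lift ord0 i) = 1%R by rewrite mxE.
have c0E : c 0 ord0 = t by rewrite mxE eqxx.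
have c0 i : (0 < c 0 i)%R by rewrite mxE; case: ifP.
exists (D \o householder w); split=> [y z|E mE].
  rewrite /= !sqr_enorm -(dot_householder w (y - z)) (_ : dot a (y - z) =
     dot (householder w a) (householder w (y - z))); last by rewrite dot_householder.
  rewrite householder_to_axis householderB.
  move: (householder w y) (householder w z) => y' z'.
  rewrite dotZl dot_delta !(dot_rV_del ord0).
  have -> : rV_del ord0 (D y' - D z') = rV_del ord0 (y' - z').
    by apply/rowP => k; rewrite !mxE /= !mul1r !addr0.
  rewrite [RHS]addrAC; congr (_ + _)%R.
  have -> : (D y' - D z') 0 ord0 = t * (y' - z') 0 ord0 by rewrite !mxE eqxx; ring.
  by rewrite mulrACA -!expr2 t2; ring.
have [mR LR] := @lebesgue_rV_isometry m.+1 (householder w) E (householderK w)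
  (fun x y => etrans (congr1 _ (esym (householderB w x y))) (enorm_householder w _)) mE.
pose D' (y : 'rV[R]_m.+1) : 'rV[R]_m.+1 := \row_i ((c 0 i)^-1 * y 0 i)%R.
have DK : cancel D D'.
  by move=> y; apply/rowP => i; have := c0 i; rewrite !mxE addr0 => ci; rewrite mulKf// gt_eqF.
have D'K : cancel D' D.
  by move=> y; apply/rowP => i; have := c0 i; rewrite !mxE addr0 => ci; rewrite mulVKf// gt_eqF.
have SE : (D \o householder w) @` E = D' @^-1` (householder w @` E).
  apply/seteqP; split=> [_ [x Ex <-]|x [y Ey yx]] /=; first by rewrite DK; exists x.
  by exists y => //=; rewrite yx D'K.
have mD' : measurable_fun [set: 'rV[R]_m.+1] D'.
  apply: measurable_fun_rV => i.
  apply: (eq_measurable_fun (fun x : 'rV[R]_m.+1 => (c 0 i)^-1 * x 0 i)%R).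
    by move=> x _; rewrite [RHS]mxE.
  by apply: measurable_funM => //; exact: measurable_coord.
have mS : measurable ((D \o householder w) @` E).
  by rewrite SE -[X in measurable X]setTI; exact: mD'.
split => //.
rewrite (@lebesgue_rV_affine _ _ c 0%R _ c0 mS) -/t; congr (_%:E * _)%E.
  by rewrite big_ord_recl c0E big1 ?mulr1// => i _; rewrite cE.
rewrite -LR; congr (lebesgue_rV R m.+1 _).
rewrite SE; apply/seteqP; split=> x /=; rewrite -/(D x) DK//.
Qed.

(** Moving g y along the i-th axis onto the hyperplane through the origin that is
    orthogonal to v changes a difference g y - g z only by e * |g y - g z| at most,
    since this difference is nearly orthogonal to v. The composite of y |-> g y with
    this motion is linear and has the distances of stretch_area for
    a = - (rV_del i v) / v_i, with sqrt (1 + |a|^2) = |v| / |v_i|. *)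
Lemma local_area m (i : 'I_m.+1) (v : 'rV[R]_m.+1) (e : R) (E : set 'rV[R]_m)
    (g : 'rV[R]_m -> 'rV[R]_m.+1) :
  measurable E -> v 0%R i != 0%R -> (0 <= e < 1)%R ->
  (forall y, E y -> rV_del i (g y) = y) ->
  (forall y z, E y -> E z -> `|dot (g y - g z) v| <= e * `|v 0 i| * enorm (g y - g z))%R ->
  (((1 - e) ^+ m)%:E * hausdorff m (g @` E) <= (enorm v / `|v 0 i|)%:E * lebesgue_rV R m E)%E /\
  ((enorm v / `|v 0 i|)%:E * lebesgue_rV R m E <= ((1 + e) ^+ m)%:E * hausdorff m (g @` E))%E.
Proof.
move=> mE vi0 /andP[e0 e1] gdel gv.
pose a := (- (v 0 i)^-1 *: rV_del i v)%R.
have [S [S1 S2]] := stretch_area a.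
have [mSE LSE] := S2 E mE.
have vi : (0 < `|v 0 i|)%R by rewrite normr_gt0.
have rho : Num.sqrt (1 + dot a a) = (enorm v / `|v 0 i|)%R.
  have -> : (1 + dot a a = dot v v / (v 0 i) ^+ 2)%R.
    by rewrite (dot_rV_del i v v) /a dotZl dotZr; field.
  by rewrite sqrtrM ?dot_ge0// sqrtrV ?sqr_ge0// sqrtr_sqr.
have subd (x : 'rV[R]_m.+1) r : (x - r *: delta_mx 0 i) 0 i = x 0 i - r.
  by rewrite !mxE !eqxx mulr1.
(* With x = g y - g z and r = (x . v) / v_i, the vector q = x - r e_i is orthogonal
   to v and |r| <= e |x|; q is the difference of the images of y and z in the
   hyperplane orthogonal to v. *)
have key y z : E y -> E z ->
   ((1 - e) * enorm (g y - g z) <= enorm (S y - S z))%R /\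
   (enorm (S y - S z) <= (1 + e) * enorm (g y - g z))%R.
  move=> Ey Ez; set x := (g y - g z)%R.
  have xdel : rV_del i x = (y - z)%R.
    by rewrite -[in RHS](gdel y Ey) -[in RHS](gdel z Ez); apply/rowP => k; rewrite !mxE.
  pose r := (dot x v / v 0 i)%R.
  pose q := (x - r *: delta_mx 0 i)%R.
  have qdel : rV_del i q = (y - z)%R.
    rewrite -xdel; apply/rowP => k.
    have ik : (lift i k == i) = false by rewrite eq_sym; exact/negbTE/neq_lift.
    by rewrite !mxE ik andbF mulr0 subr0.
  have qi : q 0 i = dot a (y - z).
    rewrite /a dotZl -xdel /q subd /r (dot_rV_del i x v) (dotC (rV_del i v)).
    by field.
  have Sq : enorm (S y - S z) = enorm q.
    apply/eqP; rewrite -(@eqrXn2 _ 2) ?enorm_ge0// S1 !sqr_enorm (dot_rV_del i q) qdel qi.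
    by rewrite addrC expr2.
  have rx : (enorm (r *: delta_mx 0 i : 'rV[R]_m.+1) <= e * enorm x)%R.
    rewrite enormZ (_ : enorm (delta_mx 0 i) = 1%R) ?mulr1; last first.
      by rewrite /enorm dot_delta mxE !eqxx sqrtr1.
    rewrite /r normrM normfV ler_pdivrMr// mulrAC; exact: gv.
  rewrite Sq; have xq : x = (q + r *: delta_mx 0 i)%R by rewrite subrK.
  have := ler_enormB x (r *: delta_mx 0 i); rewrite -/q.
  have := ler_enormD x (- (r *: delta_mx 0 i)); rewrite -/q enormN.
  by move: rx; move: (enorm (r *: _)) => u; lra.
have HL := @hausdorff_lebesgue R m _ mSE; rewrite LSE rho in HL; rewrite -HL; split.
  rewrite -lee_pdivlMl ?exprn_gt0 ?subr_gt0// -exprVn.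
  apply: hausdorff_lipschitz; first by rewrite invr_gt0 subr_gt0.
  by move=> y z Ey Ez; rewrite ler_pdivlMl ?subr_gt0//; case: (key y z Ey Ez).
apply: hausdorff_lipschitz; first by rewrite ltr_pwDl.
by move=> y z Ey Ez; case: (key y z Ey Ez).
Qed.

End area.

(** * Integration against the push-forward of a density *)

Section pushforward_density.
Local Open Scope ereal_scope.
Context d d' (T : measurableType d) (T' : measurableType d') (R : realType).
Variables (m : {measure set T -> \bar R}) (D : set T) (f : T -> R) (phi : T -> T').
Hypotheses (mD : measurable D) (mf : measurable_fun D f) (f0 : forall x, (0 <= f x)%R)
  (mphi : measurable_fun D phi).

(** The form taken by both the moment measure and the surface area measure. *)
Definition pushforward_density (A : set T') : \bar R :=
  \int[m]_(x in phi @^-1` A `&` D) (f x)%:E.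

Let mpre A : measurable A -> measurable (phi @^-1` A `&` D).
Proof. by move=> mA; rewrite setIC; exact: mphi. Qed.

Let pushforward_density0 : pushforward_density set0 = 0.
Proof. by rewrite /pushforward_density preimage_set0 set0I integral_set0. Qed.

Let pushforward_density_ge0 A : 0 <= pushforward_density A.
Proof. by apply: integral_ge0 => x _; rewrite lee_fin. Qed.

Let pushforward_density_sigma_additive : semi_sigma_additive pushforward_density.
Proof.
move=> F mF tF mUF; rewrite /pushforward_density preimage_bigcup setI_bigcupl.
rewrite ge0_integral_bigcup//.
- by apply: is_cvg_nneseries => k _ _; apply: integral_ge0 => x _; rewrite lee_fin.
- by move=> k; exact: mpre.
- apply/measurable_EFinP; apply: measurable_funS mf => //.
  by move=> x [k _ []].
- by move=> x _; rewrite lee_fin.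
- apply/trivIsetP => i j _ _ ij; rewrite setIACA setIid -preimage_setI.
  by move/trivIsetP : tF => /(_ _ _ _ _ ij) ->//; rewrite preimage_set0 set0I.
Qed.

HB.instance Definition _ := isMeasure.Build _ _ _ pushforward_density
  pushforward_density0 pushforward_density_ge0 pushforward_density_sigma_additive.

Lemma pushforward_density_measureE : exists M : {measure set T' -> \bar R},
  M = pushforward_density :> (set T' -> \bar R).
Proof. by exists pushforward_density. Qed.

Import HBNNSimple.

(** Approximation from below by simple functions, and monotone convergence. *)
Lemma ge0_integral_pushforward_density (F : T' -> \bar R) :
  measurable_fun setT F -> (forall y, 0 <= F y) ->
  \int[pushforward_density]_y F y = \int[m]_(x in D) (F (phi x) * (f x)%:E).
Proof.
move=> mF F0.
pose f_ := nnsfun_approx measurableT mF.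
have mfE : measurable_fun D (EFin \o f) by exact/measurable_EFinP.
have mf_phi n : measurable_fun D (fun x => (f_ n (phi x))%:E).
  by apply/measurable_EFinP; apply: measurableT_comp mphi.
transitivity (limn (fun n => \int[pushforward_density]_x (f_ n x)%:E)).
  rewrite -monotone_convergence//.
  - apply: eq_integral => y _; apply/esym/cvg_lim => //.
    exact: cvg_nnsfun_approx.
  - by move=> n; exact/measurable_EFinP/measurable_funP.
  - by move=> n y _; rewrite lee_fin.
  - by move=> y _ a b ab; rewrite lee_fin; exact/lefP/nd_nnsfun_approx.
transitivity (limn (fun n => \int[m]_(x in D) ((f_ n (phi x))%:E * (f x)%:E))); last first.
  rewrite -monotone_convergence//.
  - apply: eq_integral => x _; apply/cvg_lim => //; apply: cvgeZr => //.
    exact: cvg_nnsfun_approx.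
  - by move=> n; apply: emeasurable_funM.
  - by move=> n x _; rewrite mule_ge0 ?lee_fin.
  - move=> x _ a b ab; apply: lee_wpmul2r; first by rewrite lee_fin.
    by rewrite lee_fin; exact/lefP/nd_nnsfun_approx.
apply/congr_lim/funext => n.
rewrite integralT_nnsfun sintegralE.
transitivity (\sum_(k \in range (f_ n))
    \int[m]_(x in D) (k%:E * ((\1_(phi @^-1` (f_ n @^-1` [set k])) x)%:E * (f x)%:E))).
  apply: eq_fsbigr => k /set_mem[y _ fk].
  have k0 : 0 <= k%:E by rewrite lee_fin -fk.
  rewrite ge0_integralZl//.
  - congr (_ * _); transitivity (\int[m]_(x in phi @^-1` (f_ n @^-1` [set k]) `&` D) (f x)%:E) => //.
    rewrite integral_mkcondl.
    by apply: eq_integral => x _; rewrite epatch_indic muleC.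
  - apply: emeasurable_funM => //; apply/measurable_EFinP.
    have : measurable_fun D (\1_(f_ n @^-1` [set k]) \o phi : T -> R).
      by apply: measurableT_comp mphi; exact: measurable_indic.
    exact: eq_measurable_fun.
  - by move=> x _; rewrite mule_ge0 ?lee_fin.
rewrite -ge0_integral_fsum//.
- apply: eq_integral => x _.
  rewrite [in RHS]fimfunE -fsumEFin// ge0_mule_fsuml; last first.
    by move=> k; rewrite lee_fin; exact: nnfun_muleindic_ge0.
  by apply: eq_fsbigr => k _; rewrite muleA -EFinM.
- move=> k; apply: emeasurable_funM => //; apply: emeasurable_funM => //.
  apply/measurable_EFinP.
  have : measurable_fun D (\1_(f_ n @^-1` [set k]) \o phi : T -> R).
    by apply: measurableT_comp mphi; exact: measurable_indic.
  exact: eq_measurable_fun.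
- move=> k x _; rewrite muleA; apply: mule_ge0; last by rewrite lee_fin.
  by rewrite -EFinM lee_fin; exact: nnfun_muleindic_ge0.
Qed.

Lemma integrable_pushforward_density (F : T' -> \bar R) :
  measurable_fun setT F ->
  m.-integrable D (fun x => F (phi x) * (f x)%:E) ->
  integrable pushforward_density setT F /\
  \int[pushforward_density]_y F y = \int[m]_(x in D) (F (phi x) * (f x)%:E).
Proof.
move=> mF iF.
have mFa : measurable_fun setT (abse \o F) by exact: measurableT_comp.
split.
  apply/integrableP; split => //.
  rewrite (ge0_integral_pushforward_density mFa)//=.
  move/integrableP : iF => [_]; apply: le_lt_trans.
  rewrite le_eqVlt; apply/orP; left; apply/eqP; apply: eq_integral => x _.
  by rewrite abseM (gee0_abs (_ : 0 <= (f x)%:E))// lee_fin.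
have mFp : measurable_fun setT F^\+ by exact: measurable_funepos.
have mFn : measurable_fun setT F^\- by exact: measurable_funeneg.
transitivity (\int[pushforward_density]_y F^\+ y - \int[pushforward_density]_y F^\- y).
  exact: integralE.
rewrite (ge0_integral_pushforward_density mFp)// (ge0_integral_pushforward_density mFn)//.
rewrite [RHS]integralE; congr (_ - _); apply: eq_integral => x _.
  by rewrite !funeposE maxe_pMl ?lee_fin// mul0e.
by rewrite !funenegE maxe_pMl ?lee_fin// mul0e mulNe.
Qed.

End pushforward_density.

(** * Projection of a surface with a normal field *)

(** Let e tend to 0. Bernoulli's inequality (1 - e)^k >= 1 - k e makes the bounds
    affine in e. *)
Lemma ereal_eq_of_distortion (R : realType) (k : nat) (I L : \bar R) :
  (0 <= I)%E -> (0 <= L)%E ->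
  (forall e : R, 0 < e < 1 -> (((1 - e) ^+ k)%:E * I <= (1 + e)%:E * L)%E /\
     ((1 - e)%:E * L <= ((1 + e) ^+ k)%:E * I)%E) ->
  I = L.
Proof.
move=> I0 L0 H.
have h0 : 0 < (2^-1 : R) < 1 by apply/andP; split; lra.
have [H1 H2] := H _ h0.
have p1 : 0 < 1 - 2^-1 :> R by lra.
have p2 : 0 < 1 + 2^-1 :> R by lra.
have [Loo|Loo] := eqVneq L +oo%E.
  move: H2; rewrite Loo gt0_muley ?lte_fin// leye_eq => /eqP H2.
  apply/eqP; rewrite -leye_eq leNgt; apply/negP => Ioo.
  have : (((1 + 2^-1) ^+ k)%:E * I < +oo)%E by rewrite lte_mul_pinfty// lee_fin exprn_ge0// ltW.
  by rewrite H2 ltxx.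
have Lfin : L \is a fin_num by rewrite ge0_fin_numE// ltey.
have Ifin : I \is a fin_num.
  rewrite ge0_fin_numE// ltNge leye_eq; apply/negP => /eqP Ioo.
  move: H1; rewrite Ioo gt0_muley ?lte_fin ?exprn_gt0// leye_eq.
  by rewrite -(fineK Lfin) -EFinM.
move: I0 L0 H; rewrite -(fineK Lfin) -(fineK Ifin).
move: (fine I) (fine L) => a b; rewrite !lee_fin => a0 b0 H.
have bern (e : R) j : 0 < e < 1 -> 1 - j%:R * e <= (1 - e) ^+ j.
  move=> /andP[e0 e1]; elim: j => [|j ih]; first by rewrite mul0r subr0 expr0.
  rewrite exprS; apply: le_trans (_ : (1 - e) * (1 - j%:R * e) <= _); last first.
    by rewrite ler_wpM2l// subr_ge0 ltW.
  rewrite -subr_ge0 (_ : _ - _ = j%:R * e ^+ 2); first by rewrite mulr_ge0// sqr_ge0.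
  by rewrite -natr1; ring.
have small (c x y : R) : 0 <= c -> (forall e, 0 < e < 1 -> x <= y + e * c) -> x <= y.
  move=> c0 xy; apply/ler_addgt0Pr => r r0.
  pose e := Num.min 2^-1 (r / (c + 1)).
  have e0 : 0 < e by rewrite lt_min invr_gt0 ltr0n divr_gt0// ltr_wpDl.
  have e1 : e < 1 by apply: (@le_lt_trans _ _ 2^-1); [rewrite ge_min lexx|lra].
  apply: le_trans (xy e _) _; first by rewrite e0.
  rewrite lerD2l; apply: (@le_trans _ _ (r / (c + 1) * c)).
    by rewrite ler_wpM2r// ge_min lexx orbT.
  by rewrite mulrAC ler_pdivrMr ?ltr_wpDl// ler_wpM2l ?lerDl// ltW.
congr EFin; apply/eqP; rewrite eq_le; apply/andP; split.
  apply: (small (k%:R * a + b)); first by rewrite addr_ge0// mulr_ge0.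
  move=> e e01; have [+ _] := H e e01; rewrite -!EFinM lee_fin.
  have := ler_wpM2r a0 (bern e k e01); lra.
apply: (small (k.+1%:R * b)); first by rewrite mulr_ge0.
move=> e e01; have [_] := H e e01; rewrite -!EFinM lee_fin => He.
have := ler_wpM2r b0 (bern e k.+1 e01).
have /andP[e0 e1] := e01.
have q0 : 0 <= (1 - e) ^+ k by rewrite exprn_ge0// subr_ge0 ltW.
have : (1 - e) ^+ k * ((1 - e) * b) <= a.
  apply: le_trans (ler_wpM2l q0 He) _; rewrite mulrA -exprMn.
  rewrite -[leRHS]mul1r ler_wpM2r// exprn_ile1//; first by rewrite mulr_ge0//; lra.
  by rewrite -subr_ge0 (_ : _ - _ = e ^+ 2) ?sqr_ge0//; ring.
by rewrite mulrA -exprSr; lra.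
Qed.

Section graph_area.
Context {R : realType} {m : nat} (i : 'I_m.+1).
Variables (Om : set 'rV[R]_m) (g : 'rV[R]_m -> 'rV[R]_m.+1) (nu : 'rV[R]_m.+1 -> 'rV[R]_m.+1).
Let S := g @` Om.
Hypotheses (mOm : measurable Om) (mg : measurable_fun Om g) (mS : measurable S)
  (gdel : forall y, Om y -> rV_del i (g y) = y)
  (mnu : measurable_fun S nu)
  (nu1 : forall x, S x -> enorm (nu x) = 1)
  (nui : forall x, S x -> nu x 0 i != 0)
  (nuS : forall x x', S x -> S x' -> dot (x' - x) (nu x) <= 0).
Local Open Scope ereal_scope.
Local Notation H := (@hausdorff_measure R m.+1 m).
Local Notation L := (lebesgue_rV R m).

Let M1 (A : set 'rV[R]_m.+1) : \bar R := \int[H]_(x in A `&` S) (`|nu x 0%R i|)%:E.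
Let M2 (A : set 'rV[R]_m.+1) : \bar R := L (g @^-1` A `&` Om).

Let mnui : measurable_fun S (fun x => `|nu x 0%R i|%R).
Proof.
apply: measurableT_comp => //; exact: measurable_fun_coord.
Qed.

Let mE A : measurable A -> measurable (g @^-1` A `&` Om).
Proof. by move=> mA; rewrite setIC; exact: mg. Qed.

(** Where nu is close to v, the inequality dot (x' - x) (nu x) <= 0, used at both x
    and x', bounds |dot (x' - x) v| by a small multiple of |x' - x|: this is the
    hypothesis of local_area. There |v| is close to 1 and |nu_i| to |v_i|, so that
    the factor |v| / |v_i| compensates the weight |nu_i|. *)
Let graph_piece (e : R) (v : 'rV[R]_m.+1) (A : set 'rV[R]_m.+1) : (0 < e < 1)%R ->
  v 0%R i != 0%R -> measurable A -> A `<=` S ->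
  (forall x, A x -> enorm (nu x - v) < e * `|v 0 i|)%R ->
  ((1 - e) ^+ m.+1)%:E * M1 A <= (1 + e)%:E * M2 A /\
  (1 - e)%:E * M2 A <= ((1 + e) ^+ m.+1)%:E * M1 A.
Proof.
move=> /andP[e0 e1] vi mA AS nuv.
have [->|/set0P[x0 Ax0]] := eqVneq A set0.
  by rewrite /M1 /M2 preimage_set0 !set0I integral_set0 measure0 !mule0.
set E := g @^-1` A `&` Om.
have gEA : g @` E = A.
  apply/seteqP; split=> [_ [y [Ay _] <-]//|x Ax].
  by have [y Oy yx] := AS x Ax; exists y => //; split; rewrite //= yx.
have v0 : (0 < `|v 0 i|)%R by rewrite normr_gt0.
have viv : (`|v 0 i| <= enorm v)%R by exact: ler_coord_enorm.
have [LA1 LA2] : ((1 - e) ^+ m)%:E * H A <= (enorm v / `|v 0%R i|)%:E * L E /\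
  (enorm v / `|v 0%R i|)%:E * L E <= ((1 + e) ^+ m)%:E * H A.
  rewrite -gEA; apply: local_area => //.
  - exact: mE.
  - by rewrite (ltW e0) e1.
  - by move=> y [_ Oy]; exact: gdel.
  - have half x x' : A x -> A x' -> (dot (x' - x) v <= e * `|v 0 i| * enorm (x' - x))%R.
      move=> Ax Ax'; have H1 := nuS (AS _ Ax) (AS _ Ax').
      have -> : dot (x' - x) v = (dot (x' - x) (nu x) - dot (x' - x) (nu x - v))%R.
        by rewrite dotBr; ring.
      have := cauchy_schwarz (x' - x) (nu x - v); rewrite ler_norml => /andP[H2 _].
      have : (enorm (x' - x) * enorm (nu x - v) <= enorm (x' - x) * (e * `|v 0 i|))%R.
        by rewrite ler_wpM2l ?enorm_ge0// ltW// nuv.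
      by lra.
    move=> y z [Ay _] [Az _]; rewrite ler_norml; apply/andP; split; last exact: half.
    rewrite lerNl -dotNl opprB enormB; exact: half.
have absd (a b c : R) : (`|a - b| <= c -> `|a| <= c + `|b|)%R.
  by have := ler_normD (a - b)%R b; rewrite subrK; lra.
have M1ub : M1 A <= ((1 + e) * `|v 0%R i|)%:E * H A.
  rewrite -integral_cst// /M1 (setIidl AS); apply: ge0_le_integral => //.
  - by apply/measurable_EFinP; exact: measurable_funS mnui.
  - move=> x Ax; rewrite lee_fin.
    have := le_trans (ler_coord_enorm (nu x - v) i) (ltW (nuv x Ax)).
    by rewrite !mxE => /absd; lra.
have M1lb : ((1 - e) * `|v 0%R i|)%:E * H A <= M1 A.
  rewrite -integral_cst// /M1 (setIidl AS); apply: ge0_le_integral => //.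
  - by move=> x _; rewrite lee_fin mulr_ge0// subr_ge0 ltW.
  - by apply/measurable_EFinP; exact: measurable_funS mnui.
  - move=> x Ax; rewrite lee_fin.
    have := le_trans (ler_coord_enorm (nu x - v) i) (ltW (nuv x Ax)).
    by rewrite !mxE distrC => /absd; lra.
have nx1 := nu1 (AS _ Ax0); have nxv := nuv _ Ax0.
have w1 : ((1 - e) * enorm v <= 1)%R.
  have := ler_enormB v (nu x0); rewrite enormB nx1.
  have : (e * `|v 0 i| <= e * enorm v)%R by rewrite ler_wpM2l// ltW.
  by move: nxv; lra.
have w2 : (1 <= (1 + e) * enorm v)%R.
  have := ler_enormB (nu x0) v; rewrite nx1.
  have : (e * `|v 0 i| <= e * enorm v)%R by rewrite ler_wpM2l// ltW.
  by move: nxv; lra.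
have e1' : (0 <= 1 - e)%R by rewrite subr_ge0 ltW.
have e2' : (0 <= 1 + e)%R by rewrite addr_ge0// ltW.
split.
  apply: (@le_trans _ _ (((1 - e) ^+ m.+1)%:E * (((1 + e) * `|v 0%R i|)%:E * H A))).
    by apply: lee_wpmul2l => //; rewrite lee_fin exprn_ge0.
  rewrite muleA -EFinM (_ : (1 - e) ^+ m.+1 * ((1 + e) * `|v 0 i|) = ((1 + e) * (1 - e) * `|v 0 i|) * (1 - e) ^+ m)%R; last by rewrite exprS; ring.
  rewrite EFinM -muleA.
  apply: (@le_trans _ _ (((1 + e) * (1 - e) * `|v 0%R i|)%:E * ((enorm v / `|v 0%R i|)%:E * L E))).
    by apply: lee_wpmul2l => //; rewrite lee_fin !mulr_ge0.
  rewrite muleA -EFinM; apply: lee_wpmul2r; first exact: measure_ge0.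
  rewrite lee_fin (_ : (1 + e) * (1 - e) * `|v 0 i| * (enorm v / `|v 0 i|) = (1 + e) * ((1 - e) * enorm v))%R; last by field; rewrite gt_eqF.
  by rewrite -[leRHS]mulr1 ler_wpM2l.
apply: (@le_trans _ _ (((1 + e) ^+ m.+1)%:E * (((1 - e) * `|v 0%R i|)%:E * H A))); last first.
  by apply: lee_wpmul2l => //; rewrite lee_fin exprn_ge0.
rewrite muleA -EFinM (_ : (1 + e) ^+ m.+1 * ((1 - e) * `|v 0 i|) = ((1 + e) * (1 - e) * `|v 0 i|) * (1 + e) ^+ m)%R; last by rewrite exprS; ring.
rewrite EFinM -muleA.
apply: (@le_trans _ _ (((1 + e) * (1 - e) * `|v 0%R i|)%:E * ((enorm v / `|v 0%R i|)%:E * L E))); last first.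
  by apply: lee_wpmul2l => //; rewrite lee_fin !mulr_ge0.
rewrite muleA -EFinM; apply: lee_wpmul2r; first exact: measure_ge0.
rewrite lee_fin (_ : (1 + e) * (1 - e) * `|v 0 i| * (enorm v / `|v 0 i|) = (1 - e) * ((1 + e) * enorm v))%R; last by field; rewrite gt_eqF.
by rewrite -[leLHS]mulr1 ler_wpM2l.
Qed.

(** Rational vectors v, enumerated by their codes, so that countably many pieces
    are enough. *)
Let piece (e : R) (k : nat) : set 'rV[R]_m.+1 :=
  if pickle_inv k is Some v then
    let v' : 'rV[R]_m.+1 := map_mx ratr (v : 'rV[rat]_m.+1) in
    if v' 0%R i != 0%R then S `&` [set x | (enorm (nu x - v') < e * `|v' 0 i|)%R] else set0
  else set0.

Let measurable_piece e k : measurable (piece e k).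
Proof.
rewrite /piece; case: (pickle_inv k) => [v|//] /=; case: ifPn => // _.
set v' := map_mx _ _; set c := (e * _)%R.
rewrite (_ : [set _ | _] = (fun x => enorm (nu x - v')) @^-1` `]-oo, c[%classic); last first.
  by apply/seteqP; split=> x /=; rewrite in_itv.
have mf : measurable_fun S (fun x => enorm (nu x - v')).
  apply: measurableT_comp; first exact: measurable_enorm.
  apply: measurable_fun_rV => j.
  apply: (eq_measurable_fun (fun x => nu x 0 j - v' 0 j)%R); first by move=> x _; rewrite !mxE.
  by apply: measurable_funB => //; exact: measurable_fun_coord.
exact: mf.
Qed.

Let piece_cover e : (0 < e < 1)%R -> S = \bigcup_k piece e k.
Proof.
move=> /andP[e0 e1]; apply/seteqP; split=> [x Sx|x [k _]]; last first.
  by rewrite /piece; case: (pickle_inv k) => [v|//] /=; case: ifPn => // _ [].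
have n0 : (0 < `|nu x 0 i|)%R by rewrite normr_gt0 nui.
(* Approximating each of the m + 1 coordinates up to eta gives a distance at most
   (m + 1) eta <= e (|nu_i| - eta) <= e |v_i|. *)
pose eta := (e * `|nu x 0 i| / m.+2%:R)%R.
have eta0 : (0 < eta)%R by rewrite divr_gt0// mulr_gt0.
have V j : {q : rat | (`|nu x 0 j - ratr q| < eta)%R}.
  have /rat_in_itvoo /cid[q] : (nu x 0 j - eta < nu x 0 j + eta)%R by move: eta0; lra.
  by rewrite in_itv/= => /andP[q1 q2]; exists q; rewrite ltr_norml; apply/andP; split; lra.
pose v : 'rV[rat]_m.+1 := \row_j projT1 (V j).
have vE j : (`|nu x 0 j - (map_mx ratr v : 'rV[R]_m.+1) 0 j| < eta)%R.
  by rewrite !mxE; exact: projT2 (V j).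
have vi : (`|nu x 0 i| - eta < `|(map_mx ratr v : 'rV[R]_m.+1) 0 i|)%R.
  have := vE i; move: ((map_mx ratr v : 'rV[R]_m.+1) 0%R i) (nu x 0%R i) => a b.
  by have := ler_normD (b - a)%R a; rewrite subrK; lra.
have etaE : (m.+1%:R * eta <= e * (`|nu x 0 i| - eta))%R.
  have : (m.+2%:R * eta = e * `|nu x 0 i|)%R by rewrite /eta mulrC divfK.
  have : (e * eta <= eta)%R by rewrite ger_pMl// ltW.
  by rewrite -[m.+2%:R]natr1; lra.
have eta_lt : (eta < `|nu x 0 i|)%R.
  rewrite /eta ltr_pdivrMr// mulrC ltr_pM2l//; apply: lt_le_trans e1 _.
  by rewrite ler1n.
exists (pickle v) => //; rewrite /piece pickleK_inv /= ifT; last first.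
  by rewrite -normr_gt0; apply: lt_trans vi; rewrite subr_gt0.
split => //=; apply: le_lt_trans (ler_enorm_sum _) _.
apply: (@lt_le_trans _ _ (m.+1%:R * eta)%R); last first.
  by apply: le_trans etaE _; rewrite ler_pM2l// ltW.
rewrite mulr_natl -[X in (_ *+ X)%R]card_ord -sumr_const; apply: ltr_sum.
  by apply/hasP; exists i; rewrite ?mem_index_enum.
by move=> j _; have := vE j; rewrite !mxE.
Qed.

(** Cut S into disjoint parts of pieces, and let the distortion tend to 1. *)
Lemma graph_measure A : measurable A ->
  \int[H]_(x in A `&` S) (`|nu x 0%R i|)%:E = L (g @^-1` A `&` Om).
Proof.
move=> mA; rewrite -/(M1 A) -/(M2 A).
apply: (@ereal_eq_of_distortion _ m.+1).
- by apply: integral_ge0 => x _; rewrite lee_fin.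
- exact: measure_ge0.
move=> e e01; have /andP[e0 e1] := e01.
pose D := seqDU (piece e).
have mD k : measurable (D k).
  by apply: measurableD => //; apply: bigsetU_measurable.
have DS : \bigcup_k D k = S by rewrite -seqDU_bigcup_eq -piece_cover.
have tD : trivIset setT D by exact: trivIset_seqDU.
have DkS k : D k `<=` S by rewrite -DS; exact: bigcup_sup.
have M1_ge0 B : 0 <= M1 B by apply: integral_ge0 => x _; rewrite lee_fin.
have M1E : M1 A = \sum_(k <oo) M1 (A `&` D k).
  rewrite /M1 -{1}DS setI_bigcupr ge0_integral_bigcup//.
  - by apply: eq_eseriesr => k _; congr integral; apply/esym/setIidl => x [_ /DkS].
  - by move=> k; exact: measurableI.
  - apply/measurable_EFinP; apply: measurable_funS mnui => //.
    by move=> x [k _ [_ /DkS]].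
  - exact: trivIset_setIl.
have M2E : M2 A = \sum_(k <oo) M2 (A `&` D k).
  rewrite /M2 -measure_semi_bigcup.
  - congr (L _); rewrite -setI_bigcupl -preimage_bigcup -setI_bigcupr DS.
    by apply/seteqP; split=> [y [Ay Oy]|y [[Ay _] Oy]]; split=> //; split=> //; exists y.
  - by move=> k; apply: mE; exact: measurableI.
  - apply/trivIsetP => a b _ _ ab; rewrite setIACA setIid -preimage_setI setIACA setIid.
    by move/trivIsetP : tD => /(_ _ _ Logic.I Logic.I ab) ->; rewrite setI0 preimage_set0 set0I.
  - by apply: bigcupT_measurable => k; apply: mE; exact: measurableI.
have piecek k : ((1 - e) ^+ m.+1)%:E * M1 (A `&` D k) <= (1 + e)%:E * M2 (A `&` D k) /\
    (1 - e)%:E * M2 (A `&` D k) <= ((1 + e) ^+ m.+1)%:E * M1 (A `&` D k).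
  have : D k `<=` piece e k by apply: subDsetl.
  have := mD k; move: (D k) => B mB; rewrite /piece; case: (pickle_inv k) => [v|]; last first.
    rewrite subset0 => ->; rewrite setI0 /M1 /M2 preimage_set0 !set0I integral_set0 measure0 !mule0.
    by split.
  move=> /=; case: ifPn => [vi Bv|_]; last first.
    rewrite subset0 => ->; rewrite setI0 /M1 /M2 preimage_set0 !set0I integral_set0 measure0 !mule0.
    by split.
  apply: (graph_piece (v := map_mx ratr v)) => //; first exact: measurableI.
    by move=> x [_ /Bv[]].
  by move=> x [_ /Bv[]].
rewrite M1E M2E; split; rewrite -!nneseriesZl//; apply: lee_nneseries => [k _ _|k _].
- by rewrite mule_ge0// lee_fin exprn_ge0// subr_ge0 ltW.
- by case: (piecek k).
- by rewrite mule_ge0// lee_fin subr_ge0 ltW.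
- by case: (piecek k).
Qed.

(** The Jacobian of the projection along the i-th axis is |nu_i|. The hypothesis
    nuS says that the hyperplane orthogonal to nu x supports S at x; it takes the
    place of differentiability of g. *)
Lemma ge0_integral_graph (F : 'rV[R]_m.+1 -> \bar R) : measurable_fun setT F ->
  (forall x, 0 <= F x) ->
  \int[H]_(x in S) (F x * (`|nu x 0%R i|)%:E) = \int[L]_(y in Om) F (g y).
Proof.
move=> mF F0.
have f0 x : (0 <= `|nu x 0%R i|)%R by [].
have c0 (y : 'rV[R]_m) : (0 <= cst 1 y :> R)%R by [].
have mid : measurable_fun S (id : 'rV[R]_m.+1 -> 'rV[R]_m.+1) by [].
have mc : measurable_fun Om (cst 1%R : 'rV[R]_m -> R) by [].
have E1 := ge0_integral_pushforward_density H mS mnui f0 mid mF F0.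
have E2 := ge0_integral_pushforward_density L mOm mc c0 mg mF F0.
transitivity (\int[L]_(x in Om) (F (g x) * (cst 1%R x)%:E)); last first.
  by apply: eq_integral => y _; rewrite mule1.
rewrite -E1 -E2.
have [N1 N1E] := pushforward_density_measureE H mS mnui f0 mid.
have [N2 N2E] := pushforward_density_measureE L mOm mc c0 mg.
rewrite -N1E -N2E; apply: eq_measure_integral => A mA _; rewrite N1E N2E.
transitivity (L (g @^-1` A `&` Om)); first exact: graph_measure.
transitivity (\int[L]_(y in g @^-1` A `&` Om) (cst 1 y)) => //.
by rewrite integral_cst ?mul1e//; exact: mE.
Qed.

End graph_area.

(** * First order expansion of C^1 functions *)

Section derivative_along_lines.
Context {R : realType} {n : nat}.
Implicit Types (g : 'rV[R]_n -> R) (x v p h : 'rV[R]_n).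

Lemma is_derive_line g x v (s : R) : derivable g (x + s *: v) v ->
  is_derive s 1 (fun t => g (x + t *: v)) ('D_v g (x + s *: v)).
Proof.
move=> dg.
have E : (fun h : R => h^-1 *: (((fun t => g (x + t *: v)) \o shift s) (h *: 1) - g (x + s *: v))) =
         (fun h : R => h^-1 *: ((g \o shift (x + s *: v)) (h *: v) - g (x + s *: v))).
  apply/funext => h /=; congr (_ *: (g _ - _)).
  have -> : h *: (1 : R^o) = h by rewrite /GRing.scale/= mulr1.
  by rewrite scalerDl addrCA.
by split; rewrite /derivable /derive E.
Qed.

Lemma mvt_line g x (i : 'I_n) (a : R) :
  (forall c, `|c| <= `|a| -> derivable g (x + c *: delta_mx 0 i) (delta_mx 0 i)) ->
  exists2 c, `|c| <= `|a| &
    g (x + a *: delta_mx 0 i) - g x = partial i g (x + c *: delta_mx 0 i) * a.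
Proof.
move=> dg.
pose psi t := g (x + t *: delta_mx 0 i).
pose dpsi t := partial i g (x + t *: delta_mx 0 i).
have dp (t : R) : `|t| <= `|a| -> is_derive t 1 psi (dpsi t) by move=> ta; apply: is_derive_line; exact: dg.
have cp (t : R) : `|t| <= `|a| -> {for t, continuous psi}.
  by move=> /dp[dt _]; apply: differentiable_continuous; exact/derivable1_diffP.
have psi0 : psi 0 = g x by rewrite /psi scale0r addr0.
have [a0|a0] := leP 0 a.
  have le t : t \in `[0, a] -> `|t| <= `|a|.
    by rewrite in_itv/= => /andP[t0 ta]; rewrite !ger0_norm.
  have [t||c cI E] := @MVT_segment R psi dpsi 0 a a0.
  - by move=> tI; apply: dp; apply: le; exact: subset_itv_oo_cc tI.
  - by apply: continuous_in_subspaceT => t /set_mem tI; exact/cp/le.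
  - by exists c; [exact: le|rewrite -psi0 -/(psi a) E subr0].
have le t : t \in `[a, 0] -> `|t| <= `|a|.
  by rewrite in_itv/= => /andP[t0 ta]; rewrite !ler0_norm ?lerN2// ltW.
have [t||c cI E] := @MVT_segment R psi dpsi a 0 (ltW a0).
- by move=> tI; apply: dp; apply: le; exact: subset_itv_oo_cc tI.
- by apply: continuous_in_subspaceT => t /set_mem tI; exact/cp/le.
- by exists c; [exact: le|rewrite -psi0 -/(psi a) -opprB E sub0r mulrN opprK].
Qed.

(** Move from p to p + h by changing one coordinate at a time, and apply the mean
    value theorem to each step: continuity of the partial derivatives is enough. *)
Lemma C1_expansion (U : set 'rV[R]_n) g p e : open U -> class_C 1 U g -> U p -> 0 < e ->
  exists2 d, 0 < d & forall h, enorm h < d ->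
    U (p + h) /\ `|g (p + h) - g p - dot (grad g p) h| <= e * \sum_i `|h 0 i|.
Proof.
move=> oU [cg dg] Up e0.
have HU : nbhs p U by apply: open_nbhs_nbhs.
have HD : nbhs p (fun y => forall i, `|partial i g y - partial i g p| < e).
  apply: (@filter_forall _ _ (fun i y => `|partial i g y - partial i g p| < e) _
    (nbhs_filter p)) => i; have [_ [+ _]] := dg i => /(_ p Up) cpi.
  have /cpi : nbhs (partial i g p) (ball (partial i g p) e) by exact: nbhsx_ballx.
  by apply: (@filterS _ _ (nbhs_filter p)) => y; rewrite /ball/= distrC.
have [d d0 dU] := (nbhs_enormP _ _).1 (@filterI _ _ (nbhs_filter p) _ _ HU HD).
exists d => // h hd.
have U' y : enorm (y - p) < d -> U y by move=> /dU[].
split; first by apply: U'; rewrite addrC addKr.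
(* The first k coordinates of h, followed by zeros. *)
pose hk (k : nat) : 'rV[R]_n := \row_j (if (j < k)%N then h 0 j else 0).
have hk0 : hk 0%N = 0 by apply/rowP => j; rewrite !mxE.
have hkn : hk n = h by apply/rowP => j; rewrite !mxE ltn_ord.
have hkS (i : 'I_n) : hk i.+1 = hk i + h 0 i *: delta_mx 0 i.
  apply/rowP => j; rewrite !mxE eqxx/= ltnS; have [ji|ij|ji] := ltngtP j i.
  - by rewrite (_ : (j == i) = false) ?mulr0 ?addr0//; apply/negbTE; rewrite neq_ltn ji.
  - by rewrite (_ : (j == i) = false) ?mulr0 ?addr0//; apply/negbTE; rewrite neq_ltn ij orbT.
  - by rewrite (_ : j = i) ?eqxx ?mulr1 ?add0r//; exact: val_inj.
have small (i : 'I_n) c : `|c| <= `|h 0 i| -> enorm (hk i + c *: delta_mx 0 i) < d.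
  move=> ch; apply: le_lt_trans hd; rewrite ler_wsqrtr//; apply: ler_sum => j _.
  rewrite -!expr2 -[leLHS]real_normK ?num_real// -[leRHS]real_normK ?num_real//.
  rewrite lerXn2r ?nnegrE//.
  rewrite !mxE eqxx/=; have [ji|ij|ji] := ltngtP j i.
  - by rewrite (_ : (j == i) = false) ?mulr0 ?addr0//; apply/negbTE; rewrite neq_ltn ji.
  - by rewrite (_ : (j == i) = false) ?mulr0 ?addr0 ?normr0//; apply/negbTE; rewrite neq_ltn ij orbT.
  - by rewrite (_ : j = i) ?eqxx ?mulr1 ?add0r//; exact: val_inj.
have telescope : g (p + h) - g p = \sum_(i < n) (g (p + hk i.+1) - g (p + hk i)).
  rewrite -{1}hkn -[X in _ - g X]addr0 -hk0.
  rewrite -(telescope_sumr (fun k => g (p + hk k)) (leq0n n)).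
  by rewrite big_mkord.
rewrite telescope /dot -sumrB mulr_sumr; apply: le_trans (ler_norm_sum _ _ _) _.
apply: ler_sum => i _; rewrite hkS addrA.
have [|c ch ->] := @mvt_line g (p + hk i) i (h 0 i).
  move=> c ch; have [+ _] := dg i; apply; apply: U'.
  by rewrite -(addrA p) (addrC p) addrK; exact: small.
rewrite mxE -mulrBl normrM ler_wpM2r//; apply/ltW.
have [_] : U (p + hk i + c *: delta_mx 0 i) /\ forall j,
  `|partial j g (p + hk i + c *: delta_mx 0 i) - partial j g p| < e.
  by apply: dU; rewrite -(addrA p) (addrC p) addrK; exact: small.
exact.
Qed.

(** In a direction v where the derivative of g does not vanish, the sign of
    g (p + t v) - g p is that of the derivative for small t > 0. *)
Lemma C1_ray (U : set 'rV[R]_n) g p v : open U -> class_C 1 U g -> U p ->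
  dot (grad g p) v != 0 ->
  exists2 d, 0 < d & forall t, 0 < t < d -> U (p + t *: v) /\
    `|g (p + t *: v) - g p - t * dot (grad g p) v| < t * `|dot (grad g p) v|.
Proof.
move=> oU Cg Up v0.
pose e := `|dot (grad g p) v| / (\sum_i `|v 0 i| + 1).
have s0 : 0 <= \sum_i `|v 0 i| by apply: sumr_ge0.
have e0 : 0 < e by rewrite divr_gt0 ?normr_gt0// ltr_wpDl.
have [d d0 H] := C1_expansion oU Cg Up e0.
exists (d / (enorm v + 1)); first by rewrite divr_gt0// ltr_wpDl// enorm_ge0.
move=> t /andP[t0]; rewrite ltr_pdivlMr ?ltr_wpDl ?enorm_ge0// => td.
have [|Utv Hv] := H (t *: v).
  by rewrite enormZ gtr0_norm//; apply: le_lt_trans td; rewrite ler_pM2l// lerDl.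
split => //; move: Hv; rewrite dotZr => /le_lt_trans; apply.
rewrite (eq_bigr (fun i => t * `|v 0 i|)); last first.
  by move=> i _; rewrite mxE normrM gtr0_norm.
rewrite -mulr_sumr mulrCA ltr_pM2l// /e mulrAC ltr_pdivrMr ?ltr_wpDl//.
by rewrite ltr_pM2l ?normr_gt0// ltrDl.
Qed.

End derivative_along_lines.

(** * The Gauss map of a convex body *)

Section gauss_map.
Context {R : realType} {n : nat}.
Implicit Types (K U : set 'rV[R]_n) (g : 'rV[R]_n -> R) (x v : 'rV[R]_n).

Lemma convex_setP K x y (t : R) : convex_set K -> 0 <= t <= 1 -> K x -> K y ->
  K (t *: x + (1 - t) *: y).
Proof.
move=> cK /andP[t0 t1] Kx Ky.
have := cK x y (Itv01 t0 t1); rewrite !inE => /(_ Kx Ky).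
by rewrite /conv/=.
Qed.

Lemma compact_closed_rV K : compact K -> closed K.
Proof. by move=> cK; apply: compact_closed => //; exact: norm_hausdorff. Qed.

Lemma compact_bounded_rV K : compact K -> exists r, forall x, K x -> enorm x <= r.
Proof.
move=> cK; have [->|/set0P K0] := eqVneq K set0; first by exists 0.
have ce : {within K, continuous (@enorm R n)}.
  by apply: continuous_subspaceT; exact: enorm_continuous.
have [c _ H] := compact_EVT_max K0 cK ce.
by exists (enorm c) => x Kx; apply: H; rewrite inE.
Qed.

Lemma boundaryE K : closed K -> boundary K = K `\` K°.
Proof. by move=> cK; rewrite /boundary -((closure_id K).1 cK). Qed.

Lemma class_C2W U g : class_C 2 U g -> class_C 1 U g.
Proof. by move=> [cg dg]; split=> // i; have [? [? _]] := dg i. Qed.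

Lemma unit_normal_cvg U g x e : open U -> class_C 1 U g -> U x -> grad g x != 0 -> 0 < e ->
  exists2 d, 0 < d & forall y, enorm (y - x) < d -> U y /\ enorm (unit_normal g y - unit_normal g x) < e.
Proof.
move=> oU [cg dg] Ux gx e0.
have gx0 : 0 < enorm (grad g x) by rewrite enorm_gt0.
pose r := e * enorm (grad g x) / 2.
have r0 : 0 < r by rewrite divr_gt0// mulr_gt0.
have rn0 : 0 < r / n.+1%:R by rewrite divr_gt0.
have HU : nbhs x U by apply: open_nbhs_nbhs.
have HD : nbhs x (fun y => forall i, `|partial i g y - partial i g x| < r / n.+1%:R).
  apply: (@filter_forall _ _ (fun i y => `|partial i g y - partial i g x| < r / n.+1%:R) _
    (nbhs_filter x)) => i; have [_ [+ _]] := dg i => /(_ x Ux) cxi.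
  have /cxi : nbhs (partial i g x) (ball (partial i g x) (r / n.+1%:R)) by exact: nbhsx_ballx.
  by apply: (@filterS _ _ (nbhs_filter x)) => y; rewrite /ball/= distrC.
have [d d0 dU] := (nbhs_enormP _ _).1 (@filterI _ _ (nbhs_filter x) _ _ HU HD).
exists d => // y /dU[Uy Hy]; split => //.
have gr : enorm (grad g y - grad g x) < r.
  apply: le_lt_trans (ler_enorm_sum _) _.
  apply: (@le_lt_trans _ _ (\sum_(i < n) r / n.+1%:R)).
    by apply: ler_sum => i _; rewrite !mxE ltW.
  rewrite sumr_const card_ord -[ltLHS]mulr_natl mulrCA gtr_pMr// ltr_pdivrMr//.
  by rewrite mul1r ltr_nat.
rewrite /unit_normal; move: gx0 gr; rewrite /r.
move: (grad g y) (grad g x) => w v v0 wv.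
(* Both terms of this decomposition have norm at most |w - v| / |v| < e / 2. *)
have -> : (enorm w)^-1 *: w - (enorm v)^-1 *: v =
   (enorm v)^-1 *: (w - v) + ((enorm w)^-1 - (enorm v)^-1) *: w.
  by rewrite scalerBr scalerBl [RHS]addrC addrA subrK.
apply: le_lt_trans (ler_enormD _ _) _; rewrite !enormZ ger0_norm ?invr_ge0 ?enorm_ge0//.
have H2 : `|(enorm w)^-1 - (enorm v)^-1| * enorm w <= (enorm v)^-1 * enorm (w - v).
  have [->|w0] := eqVneq w 0; first by rewrite enorm0 mulr0 mulr_ge0// ?invr_ge0 enorm_ge0.
  have w0' : 0 < enorm w by rewrite enorm_gt0.
  rewrite -{2}(gtr0_norm w0') -normrM.
  have -> : ((enorm w)^-1 - (enorm v)^-1) * enorm w = (enorm v)^-1 * (enorm v - enorm w).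
    by field; rewrite !gt_eqF.
  rewrite normrM gtr0_norm ?invr_gt0// ler_pM2l ?invr_gt0// ler_norml.
  by have := ler_enormB v w; have := ler_enormB w v; rewrite (enormB v); lra.
apply: le_lt_trans (lerD (lexx _) H2) _.
have : (enorm v)^-1 * enorm (w - v) < e / 2 by rewrite ltr_pdivrMl// mulrCA mulrA.
by lra.
Qed.

(** By continuity g stays negative near y. *)
Lemma interior_local_eq K U g y : C2_local_equation K U g -> U y -> g y < 0 -> K° y.
Proof.
move=> [oU [cg _] gn0 KU] Uy gy.
have HU : nbhs y U by apply: open_nbhs_nbhs.
have Hg : nbhs y (fun z => g z < 0).
  have /(cg y Uy) : nbhs (g y) [set r | r < 0] by apply: open_nbhs_nbhs; split => //; exact: open_lt.
  by [].
rewrite /interior /=.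
apply: (@filterS _ _ (nbhs_filter y) _ _ _ (@filterI _ _ (nbhs_filter y) _ _ HU Hg)).
move=> z [Uz gz]; have : ([set x | g x <= 0] `&` U) z by split=> //; exact: ltW.
by rewrite -KU => -[].
Qed.

Lemma local_eq_le0 K U g y : C2_local_equation K U g -> U y -> K y <-> g y <= 0.
Proof.
move=> [_ _ _ KU] Uy; split=> [Ky|gy].
  by have : (K `&` U) y by []; rewrite KU => -[].
by have : ([set x | g x <= 0] `&` U) y by []; rewrite -KU => -[].
Qed.

Lemma boundary_local_eq K U g x : closed K -> boundary K x -> C2_local_equation K U g -> U x ->
  g x = 0.
Proof.
move=> cK; rewrite boundaryE// => -[Kx nKx] eqU Ux.
apply/eqP; rewrite eq_le; apply/andP; split; first exact/(local_eq_le0 eqU Ux).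
by rewrite leNgt; apply/negP => gx; apply: nKx; exact: interior_local_eq eqU _ gx.
Qed.

(** Rays on which g decreases enter K, and rays on which g increases leave K. By
    the first fact an outer normal v has dot w v <= 0 whenever w makes an obtuse angle
    with the gradient, so that v is the normalized gradient. By the second fact and
    convexity the gradient is indeed normal. *)
Lemma outer_unit_normal_local_eq K U g x v : convex_set K -> closed K -> boundary K x ->
  C2_local_equation K U g -> U x -> outer_unit_normal K x v <-> v = unit_normal g x.
Proof.
move=> vK cK bx eqU Ux.
have gx0 := boundary_local_eq cK bx eqU Ux.
have Kx : K x by move: bx; rewrite boundaryE// => -[].
have [oU /class_C2W Cg gn0 _] := eqU.
set G := grad g x; have G0 : G != 0 by exact: gn0.
have nG : 0 < enorm G by rewrite enorm_gt0.
have ray w : dot G w != 0 -> exists2 d, 0 < d & forall t, 0 < t < d ->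
    U (x + t *: w) /\ (K (x + t *: w) <-> dot G w < 0).
  move=> Gw0; have [d d0 H] := C1_ray oU Cg Ux Gw0.
  exists d => // t td; have [Uz] := H t td; rewrite gx0 subr0 -/G => Hz.
  split => //; have /andP[t0 _] := td.
  split=> [/(local_eq_le0 eqU Uz) z0|q0].
    rewrite ltNge; apply/negP => q0; move: Hz; rewrite (ger0_norm q0) ltr_norml => /andP[+ _].
    by move: z0; lra.
  apply/(local_eq_le0 eqU Uz); move: Hz; rewrite (ltr0_norm q0) ltr_norml => /andP[_].
  by lra.
set N := unit_normal g x.
have NE w : dot N w = (enorm G)^-1 * dot G w by rewrite /N /unit_normal dotZl.
have N1 : enorm N = 1.
  by rewrite /N /unit_normal enormZ ger0_norm ?invr_ge0 ?enorm_ge0// mulVf// gt_eqF.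
clearbody N.
split=> [[v1 vN]|->].
  have half w : dot N w < 0 -> dot w v <= 0.
    rewrite NE pmulr_rlt0 ?invr_gt0// => Gw.
    have [d d0 H] := ray w (ltr0_neq0 Gw).
    have [|_ [_ /(_ Gw)]] := H (d / 2); first by rewrite divr_gt0//= ltr_pdivrMr// ltr_pMr// ltr1n.
    by move=> /vN; rewrite addrAC subrr add0r dotZl pmulr_rle0// divr_gt0.
  pose p := dot N v.
  have NN : dot N N = 1 by rewrite -sqr_enorm N1 expr1n.
  have vv : dot v v = 1 by rewrite -sqr_enorm v1 expr1n.
  have p0 : 0 <= p.
    have := half (- N); rewrite dotNr NN oppr_lt0 ltr01 => /(_ isT).
    by rewrite dotNl oppr_le0.
  have p1 : 1 <= p.
    rewrite leNgt; apply/negP => p1.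
    pose e := (1 - p ^+ 2) / 2.
    have pp : p ^+ 2 < 1 by rewrite expr_lt1.
    have e0 : 0 < e by rewrite divr_gt0// subr_gt0.
    (* v - p N is orthogonal to N and v . (v - p N) = 1 - p^2, so subtracting e N
       makes the angle obtuse and keeps the product with v positive. *)
    have := half (v - p *: N - e *: N).
    rewrite !(dotBr, dotBl, dotZr, dotZl) NN vv -/p => /(_ _).
    have -> : (p - p * 1 - e * 1 < 0) by lra.
    move=> /(_ isT); have : e * p <= e by rewrite ger_pMr// ltW.
    by rewrite /e; move: pp; rewrite expr2; lra.
  apply/eqP; rewrite -subr_eq0 -enorm_eq0 -sqrf_eq0 sqr_enorm eq_le dot_ge0 andbT.
  by rewrite !(dotBr, dotBl) NN vv (dotC v N) -/p; lra.
split => // y Ky; rewrite leNgt; apply/negP; rewrite dotC NE pmulr_rgt0 ?invr_gt0// => Gw.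
have [d d0 H] := ray _ (lt0r_neq0 Gw).
pose t := Num.min (d / 2) 1.
have t0 : 0 < t by rewrite lt_min ltr01 divr_gt0.
have td : t < d.
  apply: (@le_lt_trans _ _ (d / 2)); first by rewrite ge_min lexx.
  by rewrite ltr_pdivrMr// ltr_pMr// ltr1n.
have t1 : t <= 1 by rewrite ge_min lexx orbT.
have [|_ [+ _]] := H t; first by rewrite t0.
have -> : x + t *: (y - x) = t *: y + (1 - t) *: x.
  by rewrite scalerBr scalerBl scale1r addrCA.
move=> /(_ (convex_setP vK _ Ky Kx)); rewrite (ltW t0) t1 => /(_ isT).
by rewrite ltNge (ltW Gw).
Qed.

Lemma gauss_map_local_eq K U g x : convex_set K -> closed K -> boundary K x ->
  C2_local_equation K U g -> U x -> gauss_map K x = unit_normal g x.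
Proof.
move=> vK cK bx eqU Ux.
apply/(outer_unit_normal_local_eq _ vK cK bx eqU Ux); rewrite /gauss_map.
apply: (@xgetPex _ 0 [set v | outer_unit_normal K x v]).
by exists (unit_normal g x); apply/(outer_unit_normal_local_eq _ vK cK bx eqU Ux).
Qed.

Lemma outer_unit_normal_gauss_map K x : convex_set K -> closed K -> C2plus K -> boundary K x ->
  outer_unit_normal K x (gauss_map K x).
Proof.
move=> vK cK pK bx; have [U [g [Ux eqU _]]] := pK x bx.
apply/(outer_unit_normal_local_eq _ vK cK bx eqU Ux).
exact: gauss_map_local_eq eqU _.
Qed.

(** Near x the Gauss map is the normalized gradient of the same local equation. *)
Lemma gauss_map_cvg K x e : convex_set K -> closed K -> C2plus K -> boundary K x -> 0 < e ->
  exists2 d, 0 < d & forall y, boundary K y -> enorm (y - x) < d ->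
    enorm (gauss_map K y - gauss_map K x) < e.
Proof.
move=> vK cK pK bx e0; have [U [g [Ux eqU _]]] := pK x bx.
have [oU /class_C2W Cg gn0 _] := eqU.
have [d d0 H] := unit_normal_cvg oU Cg Ux (gn0 x Ux) e0.
exists d => // y bY yx; have [Uy nyx] := H y yx.
by rewrite (gauss_map_local_eq vK cK bY eqU Uy) (gauss_map_local_eq vK cK bx eqU Ux).
Qed.

End gauss_map.

(** The hypothesis is continuity relative to D. *)
Lemma cvg_measurable_fun_rV (R : realType) m n (D : set 'rV[R]_m) (f : 'rV[R]_m -> 'rV[R]_n) :
  measurable D ->
  (forall x e, D x -> 0 < e -> exists2 d, 0 < d & forall y, D y -> enorm (y - x) < d ->
    enorm (f y - f x) < e) ->
  measurable_fun D f.
Proof.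
move=> mD cf _.
apply: (@measurability _ _ _ _ _ _ (@open 'rV[R]_n)) => //.
move=> _ [V /open_enormP oV <-].
pose W := [set z : 'rV[R]_m | exists x d, [/\ D x /\ V (f x), (forall y, D y -> enorm (y - x) < d -> V (f y)) & enorm (z - x) < d]].
have oW : open W.
  apply/open_enormP => z [x [d [DV H zx]]]; exists (d - enorm (z - x)); first by rewrite subr_gt0.
  move=> y yz; exists x, d; split => //.
  by apply: le_lt_trans (ler_enormD_dist z _ _) _; move: yz; lra.
have -> : D `&` f @^-1` V = D `&` W.
  apply/seteqP; split=> [x [Dx Vx]|z [Dz [x [d [_ H zx]]]]]; last by split=> //; exact: H.
  split => //; have [e e0 eV] := oV _ Vx; have [d d0 H] := cf x e Dx e0.
  by exists x, d; split=> // [y Dy yx|]; [exact/eV/H|rewrite subrr enorm0].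
by apply: measurableI => //; exact: open_measurable_rV.
Qed.

(** * Shadow of a convex body along a coordinate axis *)

Section shadow.
Context {R : realType} {m : nat} (i : 'I_m.+1).
Implicit Types (D : set 'rV[R]_m.+1) (y : 'rV[R]_m) (t : R).

Lemma rV_ins_shift (x : 'rV[R]_m.+1) (a : R) :
  rV_ins i (x 0 i + a) (rV_del i x) = x + a *: delta_mx 0 i.
Proof.
apply/rowP => j; rewrite !mxE eqxx/=; case: unliftP => [k|] ->; last by rewrite eqxx mulr1.
by rewrite mxE (_ : (lift i k == i) = false) ?mulr0 ?addr0// eq_sym; exact/negbTE/neq_lift.
Qed.

Lemma rV_insB s s' y y' : rV_ins i s y - rV_ins i s' y' = rV_ins i (s - s') (y - y').
Proof. by apply/rowP => j; rewrite !mxE; case: unliftP => [k|] _; rewrite ?mxE. Qed.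

Lemma dot_delta_r (x : 'rV[R]_m.+1) : dot x (delta_mx 0 i) = x 0 i.
Proof. by rewrite dotC dot_delta. Qed.

Lemma dot_rV_ins s s' y y' :
  dot (rV_ins i s y) (rV_ins i s' y') = s * s' + dot y y'.
Proof. by rewrite (dot_rV_del i) !rV_ins_eq !rV_insK. Qed.

Lemma enorm_rV_ins_line (s : R) : enorm (rV_ins i s (0 : 'rV[R]_m)) = `|s|.
Proof. by rewrite /enorm dot_rV_ins dot0l addr0 -expr2 sqrtr_sqr. Qed.

Lemma enorm_rV_ins_shadow y : enorm (rV_ins i 0 y) = enorm y.
Proof. by rewrite /enorm dot_rV_ins mulr0 add0r. Qed.

(** The orthogonal projection of D along the i-th axis. *)
Definition shadow D : set 'rV[R]_m := [set y | exists s, D (rV_ins i s y)].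

Definition chord D y : set R := [set s | D (rV_ins i s y)].

(** The upper end of the chord above y for tau = 1, and its lower end for tau = -1. *)
Definition chord_end (tau : R) D y : R := tau * sup [set tau * s | s in chord D y].

(** The point where the line above y leaves D, in the direction tau. *)
Definition shadow_lift (tau : R) D y : 'rV[R]_m.+1 := rV_ins i (chord_end tau D y) y.

Lemma open_shadow_gt D (tau c : R) : open D ->
  open [set y | exists2 s, D (rV_ins i s y) & c < tau * s].
Proof.
move=> /open_enormP oD; apply/open_enormP => y [s Ds cs].
have [e e0 eD] := oD _ Ds; exists e => // z zy; exists s => //.
by apply: eD; rewrite rV_insB subrr enorm_rV_ins_shadow.
Qed.

Lemma open_shadow D : open D -> open (shadow D).
Proof.
move=> /open_enormP oD; apply/open_enormP => y [s Ds].
have [e e0 eD] := oD _ Ds; exists e => // z zy; exists s.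
by apply: eD; rewrite rV_insB subrr enorm_rV_ins_shadow.
Qed.

Variables (D : set 'rV[R]_m.+1) (r : R) (tau : R).
Hypotheses (oD : open D) (Dr : forall x, D x -> enorm x <= r) (tau2 : tau * tau = 1).
Local Notation Om := (shadow D).

Lemma normr_sign : `|tau| = 1.
Proof. by apply/eqP; rewrite -(@eqrXn2 _ 2)// expr1n expr2 -normrM tau2 normr1. Qed.

Lemma chord_has_sup y : Om y -> has_sup [set tau * s | s in chord D y].
Proof.
move=> [s Ds]; split; first by exists (tau * s), s.
exists r => _ [s' Ds' <-]; apply: le_trans (ler_norm _) _.
rewrite normrM normr_sign mul1r; apply: le_trans (Dr Ds').
by rewrite -[X in `|X|](rV_ins_eq i s' y); exact: ler_coord_enorm.
Qed.

Lemma tau_chord_end y : tau * chord_end tau D y = sup [set tau * s | s in chord D y].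
Proof. by rewrite /chord_end mulrA tau2 mul1r. Qed.

Lemma chord_lt_end y s : D (rV_ins i s y) -> tau * s < tau * chord_end tau D y.
Proof.
move=> Ds; have Oy : Om y by exists s.
have [e e0 eD] := (open_enormP _).1 oD _ Ds.
rewrite tau_chord_end; apply: (@lt_le_trans _ _ (tau * (s + tau * (e / 2)))).
  by rewrite mulrDr mulrA tau2 mul1r ltrDl divr_gt0.
apply: sup_ubound; first by case: (chord_has_sup Oy).
exists (s + tau * (e / 2)) => //; apply: eD.
rewrite rV_insB subrr addrAC subrr add0r enorm_rV_ins_line normrM normr_sign mul1r.
by rewrite gtr0_norm ?divr_gt0// ltr_pdivrMr// ltr_pMr// ltr1n.
Qed.

Lemma chord_end_adherent y e : Om y -> 0 < e ->
  exists2 s, D (rV_ins i s y) & tau * chord_end tau D y - e < tau * s.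
Proof.
move=> Oy e0; have [_ [s Ds <-] H] := sup_adherent e0 (chord_has_sup Oy).
by exists s; rewrite // tau_chord_end.
Qed.

Lemma shadow_lift_notin y : ~ D (shadow_lift tau D y).
Proof. by move=> /chord_lt_end; rewrite ltxx. Qed.

Lemma shadow_lift_closure y : Om y -> closure D (shadow_lift tau D y).
Proof.
move=> Oy; apply/closure_enormP => e e0; have [s Ds H] := chord_end_adherent Oy e0.
exists (rV_ins i s y) => //; rewrite rV_insB subrr enorm_rV_ins_line.
rewrite -[`|_|]mul1r -normr_sign -normrM mulrBr ltr_norml.
by have := chord_lt_end Ds; move: e0 H; lra.
Qed.

(** tau * chord_end tau D is lower semicontinuous when D is open. *)
Lemma measurable_chord_end : measurable_fun Om (chord_end tau D).
Proof.
have mt : measurable_fun Om (fun y => tau * chord_end tau D y).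
  move=> mOm; apply: (measurability _ (measurable_realfun.RGenOInfty.measurableE R)) => //.
  move=> _ [_ [c ->] <-].
  have -> : Om `&` (fun y => tau * chord_end tau D y) @^-1` `]c, +oo[ =
      [set y | exists2 s, D (rV_ins i s y) & c < tau * s].
    apply/seteqP; split=> [y [Oy]|y [s Ds cs]] /=; rewrite in_itv/= andbT.
      move=> cy; have e0 : 0 < tau * chord_end tau D y - c by rewrite subr_gt0.
      by have [s Ds] := chord_end_adherent Oy e0; rewrite subKr; exists s.
    by split; [exists s|exact: lt_trans cs (chord_lt_end Ds)].
  by apply: open_measurable_rV; exact: open_shadow_gt.
apply: (eq_measurable_fun (fun y => tau * (tau * chord_end tau D y))).
  by move=> y _; rewrite mulrA tau2 mul1r.
exact: measurable_funM.
Qed.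

Lemma measurable_shadow_lift : measurable_fun Om (shadow_lift tau D).
Proof.
apply: measurable_fun_rV => j; have [k ->|->] := unliftP i j.
  apply: (eq_measurable_fun (fun y : 'rV[R]_m => y 0 k)).
    by move=> y _; rewrite rV_ins_lift.
  by apply: measurable_funTS; exact: measurable_coord.
apply: (eq_measurable_fun (chord_end tau D)); last exact: measurable_chord_end.
by move=> y _; rewrite rV_ins_eq.
Qed.

End shadow.

Section convex_body_boundary.
Context {R : realType} {m : nat} (i : 'I_m.+1) (K : set 'rV[R]_m.+1).
Hypotheses (cK : compact K) (vK : convex_set K) (pK : C2plus K).
Local Notation D := (K°).
Local Notation nu := (gauss_map K).
Variables (tau : R) (tau2 : tau * tau = 1).
Let clK : closed K := compact_closed_rV cK.

Let DK : D `<=` K. Proof. exact: interior_subset. Qed.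

Let oD : open D. Proof. exact: open_interior. Qed.

Let Dr : exists r, forall x, D x -> enorm x <= r.
Proof. by have [r rK] := compact_bounded_rV cK; exists r => x /DK; exact: rK. Qed.

Lemma boundary_shadow_lift y : shadow i D y -> boundary K (shadow_lift i tau D y).
Proof.
move=> Oy; have [r rD] := Dr; rewrite boundaryE//; split; last exact: shadow_lift_notin rD tau2 _.
have /(closure_subset DK) := shadow_lift_closure oD rD tau2 Oy.
by rewrite -((closure_id K).1 clK).
Qed.

(** A ball around an interior point of K on the same line is on the inner side of
    the supporting hyperplane, so the axis crosses the latter transversally. *)
Lemma gauss_map_shadow_lift y : shadow i D y -> 0 < tau * nu (shadow_lift i tau D y) 0 i.
Proof.
move=> Oy; have [r rD] := Dr; have [s Ds] := Oy.
set x := shadow_lift _ _ _ _; have bx : boundary K x by exact: boundary_shadow_lift.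
have [n1 nK] := outer_unit_normal_gauss_map vK clK pK bx.
have [e e0 eK] := (nbhs_enormP _ _).1 Ds.
have e2 : 0 < e / 2 by rewrite divr_gt0.
have Kz : K (rV_ins i s y + (e / 2) *: nu x).
  apply: eK; rewrite addrAC subrr add0r enormZ n1 mulr1 gtr0_norm//.
  by rewrite ltr_pdivrMr// ltr_pMr// ltr1n.
have := nK _ Kz; rewrite addrAC rV_insB subrr dotDl dotZl -sqr_enorm n1 expr1n mulr1.
rewrite (dot_rV_del i) rV_ins_eq rV_insK dot0l addr0 => H.
have lt := chord_lt_end oD rD tau2 Ds.
set c := chord_end _ _ _ _ in H lt; set b := nu x 0 i in H *.
rewrite -(pmulr_rgt0 _ (_ : 0 < tau * c - tau * s)) ?subr_gt0//.
rewrite -mulrBr mulrACA tau2 mul1r; apply: lt_le_trans e2 _.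
by rewrite -subr_le0; apply: le_trans H; rewrite le_eqVlt; apply/orP; left; apply/eqP; ring.
Qed.

(** In the direction tau, the line is in the interior of K just before a boundary
    point x with tau * nu_i > 0, by the local equation, and outside K after it, by
    the supporting hyperplane. *)
Lemma shadow_lift_rV_del x : boundary K x -> 0 < tau * nu x 0 i ->
  shadow i D (rV_del i x) /\ shadow_lift i tau D (rV_del i x) = x.
Proof.
move=> bx nx; have [r rD] := Dr.
have [n1 nK] := outer_unit_normal_gauss_map vK clK pK bx.
have [U [g [Ux eqU _]]] := pK bx.
have [oU /class_C2W Cg gn0 _] := eqU.
have nE := gauss_map_local_eq vK clK bx eqU Ux.
have G0 : 0 < enorm (grad g x) by rewrite enorm_gt0; exact: gn0.
have Gx : 0 < tau * grad g x 0 i.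
  by move: nx; rewrite nE /unit_normal mxE mulrCA pmulr_rgt0// invr_gt0.
have Gd : dot (grad g x) (- tau *: delta_mx 0 i) = - (tau * grad g x 0 i).
  by rewrite dotZr dot_delta_r mulNr.
have [d d0 H] : exists2 d, 0 < d & forall t, 0 < t < d ->
    D (rV_ins i (x 0 i - t * tau) (rV_del i x)).
  have [|d d0 H] := @C1_ray R _ U g x (- tau *: delta_mx 0 i) oU Cg Ux.
    by rewrite Gd oppr_eq0 gt_eqF.
  exists d => // t td; have /andP[t0 _] := td; have [Uz] := H t td.
  rewrite (boundary_local_eq clK bx eqU Ux) subr0 Gd normrN (gtr0_norm Gx) ltr_norml => /andP[_ Hz].
  rewrite rV_ins_shift -mulrN -scalerA; apply: interior_local_eq eqU Uz _.
  by move: Hz; lra.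
have Oy : shadow i D (rV_del i x).
  exists (x 0 i - d / 2 * tau); apply: H.
  by rewrite divr_gt0//= ltr_pdivrMr// ltr_pMr// ltr1n.
split => //.
suff cE : chord_end i tau D (rV_del i x) = x 0 i by rewrite /shadow_lift cE rV_delK.
suff : tau * chord_end i tau D (rV_del i x) = tau * x 0 i.
  by move=> /(congr1 ( *%R tau)); rewrite !mulrA tau2 !mul1r.
apply/eqP; rewrite eq_le; apply/andP; split.
  apply/ler_addgt0Pr => e e0.
  have [s Ds cs] := chord_end_adherent rD tau2 Oy e0.
  suff : tau * s <= tau * x 0 i by move: cs; lra.
  have := nK _ (DK Ds); rewrite -[x in _ - x](rV_delK i) rV_insB subrr.
  rewrite (dot_rV_del i) rV_ins_eq rV_insK dot0l addr0 => Hs.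
  rewrite -subr_le0 -mulrBr -(pmulr_lle0 _ nx) mulrACA tau2 mul1r.
  exact: Hs.
rewrite leNgt; apply/negP => lt.
pose t := Num.min (d / 2) (tau * x 0 i - tau * chord_end i tau D (rV_del i x)).
have t0 : 0 < t by rewrite lt_min divr_gt0//= subr_gt0.
have td : t < d.
  apply: (@le_lt_trans _ _ (d / 2)); first by rewrite ge_min lexx.
  by rewrite ltr_pdivrMr// ltr_pMr// ltr1n.
have := chord_lt_end oD rD tau2 (H t _); rewrite t0 td => /(_ isT).
rewrite mulrBr mulrCA tau2 mulr1.
have : t <= tau * x 0 i - tau * chord_end i tau D (rV_del i x) by rewrite ge_min lexx orbT.
by lra.
Qed.

Lemma image_shadow_lift :
  shadow_lift i tau D @` shadow i D = [set x | boundary K x /\ 0 < tau * nu x 0 i].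
Proof.
apply/seteqP; split=> [_ [y Oy <-]|x [bx nx]].
  by split; [exact: boundary_shadow_lift|exact: gauss_map_shadow_lift].
by have [Oy yx] := shadow_lift_rV_del bx nx; exists (rV_del i x).
Qed.

Lemma measurable_boundary : measurable (boundary K).
Proof.
rewrite boundaryE//; apply: measurableD; last by apply: open_measurable_rV.
exact: closed_measurable_rV.
Qed.

Lemma measurable_gauss_map : measurable_fun (boundary K) nu.
Proof.
apply: cvg_measurable_fun_rV; first exact: measurable_boundary.
by move=> x e bx e0; exact: gauss_map_cvg.
Qed.

Lemma measurable_boundary_side : measurable [set x | boundary K x /\ 0 < tau * nu x 0 i].
Proof.
rewrite (_ : [set _ | _] = boundary K `&` (fun x => tau * nu x 0 i) @^-1` `]0, +oo[); last first.
  by apply/seteqP; split=> x /=; rewrite in_itv/= andbT.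
have mt : measurable_fun (boundary K) (fun x => tau * nu x 0 i).
  by apply: measurable_funM => //; apply: measurable_fun_coord; exact: measurable_gauss_map.
by apply: mt; [exact: measurable_boundary|exact: measurable_itv].
Qed.

(** The two sides of the boundary are the graphs of shadow_lift for tau = 1 and for
    tau = -1. *)
Lemma ge0_integral_boundary_side (F : 'rV[R]_m.+1 -> \bar R) : measurable_fun setT F ->
  (forall x, (0 <= F x)%E) ->
  (\int[@hausdorff_measure R m.+1 m]_(x in [set x | boundary K x /\ (0 < tau * nu x 0 i)%R])
     (F x * `|nu x 0 i|%:E) =
   \int[lebesgue_rV R m]_(y in shadow i D) F (shadow_lift i tau D y))%E.
Proof.
move=> mF F0; have [r rD] := Dr.
rewrite -image_shadow_lift; apply: ge0_integral_graph => //.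
- by apply: open_measurable_rV; exact: open_shadow.
- exact: measurable_shadow_lift oD rD tau2.
- by rewrite image_shadow_lift; exact: measurable_boundary_side.
- by move=> y _; rewrite rV_insK.
- rewrite image_shadow_lift; apply: measurable_funS measurable_gauss_map.
    exact: measurable_boundary.
  by move=> x [].
- by rewrite image_shadow_lift => x [bx _]; case: (outer_unit_normal_gauss_map vK clK pK bx).
- rewrite image_shadow_lift => x [_]; apply: contraTneq => ->.
  by rewrite mulr0 ltxx.
- rewrite image_shadow_lift => x x' [bx _] [bx' _].
  have [_] := outer_unit_normal_gauss_map vK clK pK bx; apply.
  by move: bx'; rewrite boundaryE// => -[].
Qed.

End convex_body_boundary.

(** * The fundamental theorem of calculus for unimodal functions *)

Section unimodal_ftc.
Context {R : realType}.
Implicit Types (phi dphi : R -> R).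
Local Notation mu := (@lebesgue_measure R).

(** The strictly increasing function phi s + e * s has derivative dphi + e; let e
    tend to 0. *)
Lemma nondecreasing_derive_ge0 phi dphi (a b u : R) :
  (forall s, a < s < b -> is_derive s 1 phi (dphi s)) ->
  (forall s t, a < s -> s <= t -> t < b -> phi s <= phi t) ->
  a < u < b -> 0 <= dphi u.
Proof.
move=> dp ndp uab; apply/ler_addgt0Pr => e e0.
have de s : a < s < b -> is_derive s 1 (fun t => phi t + e * t) (dphi s + e).
  move=> sab.
  have ids : is_derive s 1 (e *: (id : R^o -> R^o)) (e *: (1 : R^o)) by exact: is_deriveZ.
  apply: is_derive_eq (is_deriveD (dp s sab) ids) _.
  by rewrite /GRing.scale/= mulr1.
have [_ <-] := de u uab; rewrite -derive1E.
apply: (@incr_derive1_ge0 _ _ `]a, b[).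
- rewrite interior_itv// => s /[!inE] /=; rewrite in_itv/= => /de[]//.
- move=> s t; rewrite !inE/= !in_itv/= => /andP[as_ sb] /andP[at_ tb] st.
  by apply: ler_ltD; [apply: ndp => //; exact: ltW|rewrite ltr_pM2l].
- by rewrite interior_itv//= in_itv.
Qed.

Lemma ftc_segment phi dphi (a b : R) : a <= b ->
  (forall s, a <= s <= b -> is_derive s 1 phi (dphi s)) ->
  (forall s, a <= s <= b -> {for s, continuous dphi}) ->
  (\int[mu]_(s in `[a, b]) (dphi s)%:E = (phi b - phi a)%:E)%E.
Proof.
rewrite le_eqVlt => /predU1P[<- _ _|ab dp cdp].
  by rewrite set_itv1 integral_set1 subrr.
have cp s : a <= s <= b -> {for s, continuous phi}.
  by move=> /dp[ds _]; apply: differentiable_continuous; exact/derivable1_diffP.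
rewrite (@continuous_FTC2 _ dphi phi)//.
- apply: continuous_in_subspaceT => s; rewrite inE/= in_itv/=; exact: cdp.
- split.
  + by move=> s; rewrite in_itv/= => /andP[/ltW as_ /ltW sb]; have [|] := dp s; rewrite ?as_.
  + by apply: cvg_at_right_filter; apply: cp; rewrite lexx ltW.
  + by apply: cvg_at_left_filter; apply: cp; rewrite lexx ltW.
- move=> s; rewrite in_itv/= => /andP[/ltW as_ /ltW sb]; rewrite derive1E.
  by have [|_ ->] := dp s; rewrite ?as_.
Qed.

(** The function increases up to a maximum point c and decreases after it, so its
    variation is (phi c - phi a) + (phi c - phi b). *)
Lemma unimodal_variation phi dphi (a b M : R) : a <= b ->
  (forall s, a <= s <= b -> is_derive s 1 phi (dphi s)) ->
  (forall s, a <= s <= b -> {for s, continuous dphi}) ->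
  (forall s t u, a <= s -> s <= u -> u <= t -> t <= b -> Num.min (phi s) (phi t) <= phi u) ->
  (forall s, a <= s <= b -> 0 <= phi s <= M) ->
  (\int[mu]_(s in `[a, b]) `|dphi s|%:E <= (2 * M)%:E)%E.
Proof.
move=> ab dp cdp uni phiM.
have cp s : a <= s <= b -> {for s, continuous phi}.
  by move=> /dp[ds _]; apply: differentiable_continuous; exact/derivable1_diffP.
have mdp : measurable_fun `[a, b] dphi.
  apply: subspace_continuous_measurable_fun => //.
  by apply: continuous_in_subspaceT => s; rewrite inE/= in_itv/=; exact: cdp.
have mabs : measurable_fun `[a, b] (fun s => `|dphi s|%:E).
  by apply/measurable_EFinP; exact: measurableT_comp.
have [|c + cmax] := @EVT_max _ phi a b ab.
  by apply: continuous_in_subspaceT => s; rewrite inE/= in_itv/=; exact: cp.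
rewrite in_itv/= => /andP[ac cb].
have maxc s : a <= s <= b -> phi s <= phi c by move=> sab; apply: cmax; rewrite in_itv.
have inc u : a < u < c -> 0 <= dphi u.
  move=> uac; apply: (@nondecreasing_derive_ge0 phi dphi a c) => //.
    by move=> s /andP[/ltW as_ /ltW sc]; apply: dp; rewrite as_ (le_trans sc).
  move=> s t /ltW as_ st /ltW tc; have := uni s c t as_ st tc cb.
  by rewrite min_l// maxc// as_ (le_trans st)// (le_trans tc).
have dec u : c < u < b -> dphi u <= 0.
  move=> ucb; rewrite -oppr_ge0.
  apply: (@nondecreasing_derive_ge0 (fun s => - phi s) (fun s => - dphi s) c b) => //.
    move=> s /andP[/ltW cs /ltW sb]; apply: is_deriveN; apply: dp.
    by rewrite (le_trans ac)//.
  move=> s t /ltW cs st /ltW tb; rewrite lerN2.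
  have := uni c t s ac cs st tb; rewrite min_r// maxc// tb andbT.
  by rewrite (le_trans ac)// (le_trans cs).
have cM : phi c <= M by have /andP[] := phiM c (introT andP (conj ac cb)).
have intac : (\int[mu]_(s in `[a, c]) `|dphi s|%:E = (phi c - phi a)%:E)%E.
  transitivity (\int[mu]_(s in `[a, c]) (dphi s)%:E)%E; last first.
    apply: ftc_segment => // s /andP[as_ sc].
      by apply: dp; rewrite as_ (le_trans sc).
    by apply: cdp; rewrite as_ (le_trans sc).
  have mac : measurable_fun `]a, c[ dphi.
    apply: measurable_funS mdp => //; apply: subset_itv; rewrite bnd_simp//.
  apply: eq_integral_itv_bounded => //; first exact: measurableT_comp.
  by move=> s; rewrite in_itv/= => /inc s0; rewrite ger0_norm.
have intcb : (\int[mu]_(s in `[c, b]) `|dphi s|%:E = (phi c - phi b)%:E)%E.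
  transitivity (\int[mu]_(s in `[c, b]) (- dphi s)%:E)%E.
    have mac : measurable_fun `]c, b[ dphi.
      by apply: measurable_funS mdp => //; apply: subset_itv; rewrite bnd_simp.
    apply: eq_integral_itv_bounded => //; [exact: measurableT_comp|exact: measurableT_comp|].
    by move=> s; rewrite in_itv/= => /dec s0; rewrite ler0_norm.
  transitivity ((- phi b) - (- phi c))%:E; last by congr EFin; ring.
  apply: (@ftc_segment (fun s => - phi s)) => // s /andP[cs sb].
    by apply: is_deriveN; apply: dp; rewrite (le_trans ac).
  by apply: continuousN; apply: cdp; rewrite (le_trans ac).
apply: (@le_trans _ _ (\int[mu]_(s in `[a, c]) `|dphi s|%:E + \int[mu]_(s in `[c, b]) `|dphi s|%:E)%E).
  have sab : `[a, b] `<=` `[a, c] `|` `[c, b].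
    move=> s; rewrite /= !in_itv/= => /andP[as_ sb].
    by have [sc|/ltW cs] := leP s c; [left; rewrite as_|right; rewrite sb cs].
  have sac : `[a, c] `<=` `[a, b] by apply: subset_itv; rewrite bnd_simp.
  have scb : `]c, b] `<=` `[a, b] by apply: subset_itv; rewrite bnd_simp.
  have E : `[a, b]%classic = `[a, c] `|` `]c, b].
    apply/seteqP; split=> [s|s [/sac|/scb]//].
    rewrite /= !in_itv/= => /andP[as_ sb].
    by have [sc|cs] := leP s c; [left; rewrite as_|right; rewrite sb].
  rewrite {1}E ge0_integral_setU//=.
  - rewrite leeD2l//; apply: ge0_subset_integral => //.
      by apply: measurable_funS mabs => //; apply: subset_itv; rewrite bnd_simp.
    by apply: subset_itv; rewrite bnd_simp.
  - by rewrite -E.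
  - apply/disj_set2P; apply/seteqP; split=> // s []/=; rewrite !in_itv/=.
    by move=> /andP[_ sc] /andP[cs _]; move: (lt_le_trans cs sc); rewrite ltxx.
rewrite intac intcb -EFinD lee_fin.
have /andP[+ _] := phiM a (introT andP (conj (lexx a) ab)).
have /andP[+ _] := phiM b (introT andP (conj ab (lexx b))).
by move: cM; lra.
Qed.

(** The bound on the variation does not depend on the compact subinterval, so it
    passes to the limit and provides the domination that lets the fundamental theorem
    of calculus pass to the limit too. *)
Lemma unimodal_ftc phi dphi (I : set R) (a b : nat -> R) (alpha beta M : R) :
  (forall k, a k <= b k) -> (forall k, a k.+1 <= a k) -> (forall k, b k <= b k.+1) ->
  I = \bigcup_k `[a k, b k]%classic ->
  (forall s, I s -> is_derive s 1 phi (dphi s)) ->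
  (forall s, I s -> {for s, continuous dphi}) ->
  (forall s t u, I s -> I t -> s <= u -> u <= t -> Num.min (phi s) (phi t) <= phi u) ->
  (forall s, I s -> 0 <= phi s <= M) ->
  phi (a k) @[k --> \oo] --> alpha -> phi (b k) @[k --> \oo] --> beta ->
  measurable_fun I dphi /\
  (\int[mu]_(s in I) `|dphi s|%:E <= (2 * M)%:E)%E /\
  (\int[mu]_(s in I) (dphi s)%:E = (beta - alpha)%:E)%E.
Proof.
move=> ab na nb IE dp cdp uni phiM cva cvb.
have sub k s : a k <= s <= b k -> I s by move=> sk; rewrite IE; exists k => //=; rewrite in_itv.
have mI : measurable I by rewrite IE; exact: bigcupT_measurable.
have mdpk k : measurable_fun `[a k, b k] dphi.
  apply: subspace_continuous_measurable_fun => //.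
  apply: continuous_in_subspaceT => s; rewrite inE/= in_itv/= => sk.
  by apply: cdp; exact: (sub k).
have mdp : measurable_fun I dphi by rewrite IE; exact/measurable_fun_bigcup.
have nab : nondecreasing_seq (fun k => `[a k, b k]%classic : set R).
  apply/nondecreasing_seqP => k; apply/subsetPset => s; rewrite /= !in_itv/= => /andP[sa sb].
  by rewrite (le_trans (na k))//= (le_trans sb).
have mabs : measurable_fun I (fun s => `|dphi s|%:E).
  by apply/measurable_EFinP; exact: measurableT_comp.
have cvabs : (\int[mu]_(s in `[a k, b k]) `|dphi s|%:E)%E @[k --> \oo] -->
    (\int[mu]_(s in I) `|dphi s|%:E)%E.
  rewrite [in X in _ --> X]IE.
  have := @ge0_nondecreasing_set_cvg_integral _ (measurableTypeR R) R
    (fun k => `[a k, b k]%classic) (fun s => `|dphi s|%:E) (@lebesgue_measure R) nab.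
  apply => //.
  by move=> k; apply/measurable_EFinP; apply: measurableT_comp => //; exact: mdpk.
have bound : (\int[mu]_(s in I) `|dphi s|%:E <= (2 * M)%:E)%E.
  rewrite -(cvg_lim _ cvabs)//; apply: lime_le.
    by apply/cvg_ex; exists (\int[mu]_(s in I) `|dphi s|%:E)%E.
  apply: nearW => k; apply: (@unimodal_variation phi dphi (a k) (b k) M (ab k)).
  - by move=> s sk; apply: dp; exact: (sub k).
  - by move=> s sk; apply: cdp; exact: (sub k).
  - move=> s t u as_ su ut tb; apply: uni => //; apply: (sub k).
      by rewrite as_ (le_trans su)// (le_trans ut).
    by rewrite tb (le_trans as_)// (le_trans su).
  - by move=> s sk; apply: phiM; exact: (sub k).
split => //; split => //.
pose f_ k : R -> \bar R := (EFin \o dphi) \_ `[a k, b k]%classic.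
have mE : measurable_fun I (EFin \o dphi) by exact/measurable_EFinP.
have iabs : mu.-integrable I (fun s => `|dphi s|%:E).
  apply/integrableP; split => //; apply: le_lt_trans (ltry (2 * M)).
  apply: le_trans bound; rewrite le_eqVlt; apply/orP; left; apply/eqP.
  by apply: eq_integral => s _; rewrite /= normr_id.
have [] := @dominated_convergence _ _ _ mu I mI f_ (EFin \o dphi) (fun s => `|dphi s|%:E) _ mE _ iabs.
- move=> k; apply/(measurable_restrict _ _ _) => //.
  by apply: measurable_funS mE => // s [].
- apply/aeW => s Is; apply: cvg_near_cst.
  move: Is; rewrite IE => -[N _ sN]; exists N => // k /= Nk.
  rewrite /f_ patchE mem_set//.
  by have /subsetPset := nab _ _ Nk; exact.
- apply/aeW => s k Is; rewrite /f_ patchE; case: ifPn => _ //=.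
  by rewrite normr0 lee_fin.
move=> _ _ cvI.
have cvI' : (\int[mu]_(s in I) f_ k s)%E @[k --> \oo] --> (beta - alpha)%:E.
  apply: (@cvg_trans _ ((phi (b k) - phi (a k))%:E @[k --> \oo])).
    apply: near_eq_cvg; apply: nearW => k.
    have <- : (\int[mu]_(s in `[a k, b k]) (dphi s)%:E = (phi (b k) - phi (a k))%:E)%E.
      by apply: ftc_segment => // s sk; [apply: dp|apply: cdp]; exact: (sub k).
    by rewrite -integral_mkcondr setIidr// => s; rewrite /= in_itv/=; exact: sub.
  by apply: cvg_EFin; [exact: nearW|apply: cvgB].
by rewrite -(cvg_lim _ cvI)//; exact: cvg_lim.
Qed.

End unimodal_ftc.

(** * Integration of a partial derivative along lines *)

Section line_integration.
Context {R : realType} {m : nat} (i : 'I_m.+1).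
Variables (D : set 'rV[R]_m.+1) (F dF : 'rV[R]_m.+1 -> R) (M alpha beta : 'rV[R]_m -> R).
Local Notation Om := (shadow i D).
Local Notation mu := (@lebesgue_measure R).
Hypotheses (oD : open D) (mdF : measurable_fun D dF).
Hypotheses (dFD : forall y s, D (rV_ins i s y) ->
  is_derive s 1 (fun t => F (rV_ins i t y)) (dF (rV_ins i s y))).
Hypotheses (cdF : forall y s, D (rV_ins i s y) -> {for s, continuous (fun t => dF (rV_ins i t y))}).
Hypotheses (uniF : forall y s t u, D (rV_ins i s y) -> D (rV_ins i t y) -> s <= u -> u <= t ->
  Num.min (F (rV_ins i s y)) (F (rV_ins i t y)) <= F (rV_ins i u y)).
Hypotheses (FM : forall y s, D (rV_ins i s y) -> 0 <= F (rV_ins i s y) <= M y).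
Hypotheses (mM : measurable_fun Om M)
  (iM : (\int[lebesgue_rV R m]_(y in Om) (M y)%:E < +oo)%E).
Hypotheses (exhaust : forall y, Om y -> exists a b : nat -> R,
  [/\ (forall k, a k <= b k), (forall k, a k.+1 <= a k), (forall k, b k <= b k.+1) &
      chord i D y = \bigcup_k `[a k, b k]%classic] /\
  (F (rV_ins i (a k) y) @[k --> \oo] --> alpha y /\ F (rV_ins i (b k) y) @[k --> \oo] --> beta y)).

Let line y : Om y ->
  (\int[mu]_(s in chord i D y) `|dF (rV_ins i s y)|%:E <= (2 * M y)%:E)%E /\
  (\int[mu]_(s in chord i D y) (dF (rV_ins i s y))%:E = (beta y - alpha y)%:E)%E.
Proof.
move=> Oy; have [a [b [[ab na nb cE] [ca cb]]]] := exhaust Oy.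
have [_ []] := @unimodal_ftc _ (fun s => F (rV_ins i s y)) (fun s => dF (rV_ins i s y))
  (chord i D y) a b (alpha y) (beta y) (M y) ab na nb cE
  (fun s Ds => dFD Ds) (fun s Ds => cdF Ds)
  (fun s t u Ds Dt su ut => uniF Ds Dt su ut) (fun s Ds => FM Ds) ca cb.
by [].
Qed.

Let mD : measurable D. Proof. exact: open_measurable_rV. Qed.
Let mOm : measurable Om. Proof. by apply: open_measurable_rV; exact: open_shadow. Qed.

Let G := (EFin \o dF) \_ D.

Let mG : measurable_fun setT G.
Proof. by apply/(measurable_restrictT _ _).1 => //; exact/measurable_EFinP. Qed.

Let GE (h : \bar R -> \bar R) y : h 0%E = 0%E ->
  (\int[mu]_s h (G (rV_ins i s y)) = \int[mu]_(s in chord i D y) h (dF (rV_ins i s y))%:E)%E.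
Proof.
move=> h0; rewrite [RHS]integral_mkcond; apply: eq_integral => s _.
rewrite /G !patchE; have [/set_mem sD|sD] := boolP (rV_ins i s y \in D); first by rewrite mem_set.
rewrite ifN// ?h0//; apply: contra sD; rewrite !inE //.
Qed.

Let chord0 y : ~ Om y -> chord i D y = set0.
Proof. by move=> nOy; apply/seteqP; split=> // s Ds; apply: nOy; exists s. Qed.

Let integrableG : (lebesgue_rV R m.+1).-integrable setT G.
Proof.
apply/integrableP; split => //.
rewrite (ge0_integral_rV_ins i (f := abse \o G)); last 2 first.
- exact: measurableT_comp.
- by move=> x; exact: abse_ge0.
apply: (@le_lt_trans _ _ (\int[lebesgue_rV R m]_y ((fun y => (2 * M y)%:E) \_ Om) y)%E).
  apply: ge0_le_integral => //.
  - by move=> y _; apply: integral_ge0 => s _; exact: abse_ge0.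
  - apply: (@measurable_fun_fubini_tonelli_G _ _ _ _ R mu
      (fun p => abse (G (rV_ins i p.1 p.2)))) => //.
    by apply: measurableT_comp => //; exact: measurableT_comp (measurable_rV_ins i).
  - apply/(measurable_restrictT _ _).1 => //; apply/measurable_EFinP.
    exact: measurable_funM.
  - move=> y _; rewrite /= (GE (h := abse)) ?abse0// patchE.
    case: ifPn => [/set_mem Oy|]; first by case: (line Oy).
    by rewrite notin_setE => /chord0 ->; rewrite integral_set0.
rewrite -integral_mkcond.
under eq_integral do rewrite EFinM.
rewrite ge0_integralZl//.
- by rewrite lte_mul_pinfty.
- exact/measurable_EFinP.
- by move=> y [s Ds]; rewrite lee_fin; have /andP[F0 FMy] := FM Ds; exact: le_trans FMy.
Qed.

(** On each line unimodal_ftc applies; its bound 2 * M makes dF integrable, and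
    Fubini's theorem assembles the lines. *)
Lemma line_integration :
  (lebesgue_rV R m.+1).-integrable D (EFin \o dF) /\
  (\int[lebesgue_rV R m.+1]_(x in D) (dF x)%:E =
   \int[lebesgue_rV R m]_(y in Om) (beta y - alpha y)%:E)%E.
Proof.
split; first by apply/(integrable_mkcond _ mD).2; exact: integrableG.
rewrite integral_mkcond (integral_rV_ins i)// [RHS]integral_mkcond.
apply: eq_integral => y _; rewrite (GE (h := id))// patchE.
case: ifPn => [/set_mem Oy|]; first by case: (line Oy).
by rewrite notin_setE => /chord0 ->; rewrite integral_set0.
Qed.

End line_integration.

Section exp_neg_theory.
Context {R : realType} {n : nat}.
Variable u : 'rV[R]_n -> \bar R.
Hypothesis uNy : forall x, u x != -oo%E.

Lemma exp_neg_dom x : dom u x -> exp_neg u x = expR (- fine (u x)).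
Proof. by rewrite /dom /exp_neg /= => ux; rewrite -(fineK ux). Qed.

Lemma not_dom x : ~ dom u x -> u x = +oo%E.
Proof. by rewrite /dom/=; have := uNy x; case: (u x). Qed.

Lemma exp_neg_not_dom x : ~ dom u x -> exp_neg u x = 0.
Proof. by move=> /not_dom; rewrite /exp_neg => ->. Qed.

Lemma exp_neg_ge0 x : 0 <= exp_neg u x.
Proof. by rewrite /exp_neg fine_ge0// expeR_ge0. Qed.

Lemma potential_exp_neg : potential (exp_neg u) = u.
Proof.
apply/funext => x; rewrite /potential; have [ux|ux] := pselect (dom u x).
  rewrite exp_neg_dom// (_ : (expR _)%:E = expeR (- (fine (u x))%:E)%E)//.
  by rewrite expeRK oppeK fineK.
rewrite exp_neg_not_dom// (not_dom ux).
by rewrite /= lexx.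
Qed.

(** Convex functions are quasiconvex. *)
Lemma exp_neg_unimodal x y (t : R) : convex_efunction u -> 0 <= t <= 1 ->
  Num.min (exp_neg u x) (exp_neg u y) <= exp_neg u (t *: x + (1 - t) *: y).
Proof.
move=> cu t01; have /andP[t0 t1] := t01.
have [ux|ux] := pselect (dom u x); last first.
  by rewrite exp_neg_not_dom// ge_min exp_neg_ge0.
have [uy|uy] := pselect (dom u y); last first.
  by rewrite [X in Num.min _ X]exp_neg_not_dom// ge_min exp_neg_ge0 orbT.
have := cu x y t t01; rewrite -(fineK ux) -(fineK uy) => cuz.
have uz : dom u (t *: x + (1 - t) *: y).
  rewrite /dom/= fin_numElt ltNye uNy /=; apply: le_lt_trans cuz _.
  by rewrite -!EFinM -EFinD ltry.
move: cuz; rewrite -(fineK uz) -!EFinM -EFinD lee_fin !exp_neg_dom// => cuz.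
rewrite ge_min !ler_expR !lerN2.
have [xy|/ltW yx] := leP (fine (u x)) (fine (u y)).
  apply/orP; right; apply: le_trans cuz _.
  by have := ler_wpM2l t0 xy; lra.
apply/orP; left; apply: le_trans cuz _.
have t1' : 0 <= 1 - t by rewrite subr_ge0.
by have := ler_wpM2l t1' yx; lra.
Qed.

End exp_neg_theory.

(** * The first moment of the moment measure *)

Section moment_measure_integral.
Context {R : realType} {m : nat} (i : 'I_m.+1).
Variables (u : 'rV[R]_m.+1 -> \bar R) (M alpha beta : 'rV[R]_m -> R).
Local Notation D := (dom u)°.
Local Notation Om := (shadow i D).
Local Notation w := (fine \o u).
Local Notation f := (exp_neg u).
Hypotheses (uNy : forall x, u x != -oo%E) (cu : convex_efunction u) (C2 : class_C 2 D w).
Hypotheses (fM : forall y s, D (rV_ins i s y) -> f (rV_ins i s y) <= M y)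
  (mM : measurable_fun Om M) (iM : (\int[lebesgue_rV R m]_(y in Om) (M y)%:E < +oo)%E).
Hypotheses (exhaust : forall y, Om y -> exists a b : nat -> R,
  [/\ (forall k, a k <= b k), (forall k, a k.+1 <= a k), (forall k, b k <= b k.+1) &
      chord i D y = \bigcup_k `[a k, b k]%classic] /\
  (f (rV_ins i (a k) y) @[k --> \oo] --> alpha y /\ f (rV_ins i (b k) y) @[k --> \oo] --> beta y)).

Let oD : open D. Proof. exact: open_interior. Qed.
Let Ddom : D `<=` dom u. Proof. exact: interior_subset. Qed.

Let F x : R := expR (- w x).
Let dF x : R := - (partial i w x * F x).

Let FE x : D x -> F x = f x.
Proof. by move=> /Ddom ux; rewrite /F exp_neg_dom. Qed.

Lemma rV_ins_line (s : R) (y : 'rV[R]_m) : rV_ins i s y = rV_ins i 0 y + s *: delta_mx 0 i.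
Proof. by rewrite -rV_ins_shift rV_ins_eq add0r rV_insK. Qed.

Lemma continuous_rV_ins (y : 'rV[R]_m) : continuous (fun s : R => rV_ins i s y).
Proof.
move=> s A /nbhs_enormP[e e0 eA]; apply/nbhs_ballP; exists e => // t.
rewrite /ball/= => st; apply: eA.
by rewrite rV_insB subrr enorm_rV_ins_line distrC.
Qed.

Let cw x : D x -> {for x, continuous w}.
Proof. by case: C2 => + _; apply. Qed.

Let cpw x j : D x -> {for x, continuous (partial j w)}.
Proof. by case: C2 => _ /(_ j)[_ [+ _]]; apply. Qed.

Let cF x : D x -> {for x, continuous F}.
Proof.
move=> Dx; apply: (@continuous_comp _ _ _ (fun x => - w x) (@expR R)).
  by apply: continuousN; exact: cw.
exact: continuous_expR.
Qed.

Let cdF x : D x -> {for x, continuous dF}.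
Proof. by move=> Dx; apply: continuousN; apply: continuousM; [exact: cpw|exact: cF]. Qed.

Let is_deriveF y (s : R) : D (rV_ins i s y) ->
  is_derive s 1 (fun t => F (rV_ins i t y)) (dF (rV_ins i s y)).
Proof.
move=> Ds.
have dw : is_derive s 1 (fun t => - w (rV_ins i t y)) (- partial i w (rV_ins i s y)).
  apply: is_deriveN.
  have -> : (fun t => w (rV_ins i t y)) = (fun t => w (rV_ins i 0 y + t *: delta_mx 0 i)).
    by apply/funext => t; rewrite -rV_ins_line.
  rewrite (rV_ins_line s y); apply: is_derive_line; rewrite -rV_ins_line.
  by case: C2 => _ /(_ i)[+ _]; apply.
have de := is_derive_expR (- w (rV_ins i s y)).
have := @is_derive1_comp _ (@expR R) (fun t => - w (rV_ins i t y)) s _ _ de dw.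
move=> H; apply: (is_derive_eq H).
by rewrite /dF /F /= mulrN mulrC.
Qed.

Let uniF y s t v : D (rV_ins i s y) -> D (rV_ins i t y) -> s <= v -> v <= t ->
  Num.min (F (rV_ins i s y)) (F (rV_ins i t y)) <= F (rV_ins i v y).
Proof.
move=> Ds Dt sv vt; rewrite (FE Ds) (FE Dt).
have [st|st] := eqVneq s t.
  have -> : v = s by apply/eqP; rewrite eq_le sv andbT st.
  by rewrite (FE Ds) ge_min lexx.
have ts : 0 < t - s by rewrite subr_gt0 lt_neqAle st (le_trans sv).
pose l := (t - v) / (t - s).
have l01 : 0 <= l <= 1.
  by rewrite divr_ge0 ?subr_ge0 ?(le_trans sv)//= ler_pdivrMr// mul1r lerD2l lerN2.
have vE : rV_ins i v y = l *: rV_ins i s y + (1 - l) *: rV_ins i t y.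
  apply/rowP => j; rewrite !mxE; case: unliftP => [k|] _; first by ring.
  by rewrite /l; field; rewrite gt_eqF.
have := exp_neg_unimodal uNy (rV_ins i s y) (rV_ins i t y) cu l01; rewrite -vE.
have [uv|uv] := pselect (dom u (rV_ins i v y)); first by rewrite (exp_neg_dom uv).
rewrite (exp_neg_not_dom uNy uv) leNgt lt_min -(FE Ds) -(FE Dt) /F !expR_gt0.
by [].
Qed.

Let mgrad : measurable_fun D (grad w).
Proof.
apply: measurable_fun_rV => j.
apply: (eq_measurable_fun (partial j w)); first by move=> x _; rewrite mxE.
by apply: continuous_measurable_fun_rV => // x Dx; exact: cpw.
Qed.

Let mf : measurable_fun D f.
Proof.
apply: (eq_measurable_fun F); first by move=> x /set_mem Dx; rewrite FE.
by apply: continuous_measurable_fun_rV => // x Dx; exact: cF.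
Qed.

(** The integrand is the partial derivative of exp (- u) up to sign. The limits of f
    at the ends of the chords, alpha and beta, are along given exhausting sequences
    of segments. *)
Lemma moment_measure_coord :
  integrable (mu f) setT (fun y : 'rV[R]_m.+1 => (y 0 i)%:E) /\
  (\int[mu f]_y (y 0 i)%:E = - \int[lebesgue_rV R m]_(y in Om) (beta y - alpha y)%:E)%E.
Proof.
have mdF : measurable_fun D dF.
  by apply: continuous_measurable_fun_rV => // x Dx; exact: cdF.
have cdFl y s : D (rV_ins i s y) -> {for s, continuous (fun t => dF (rV_ins i t y))}.
  move=> Ds; apply: (@continuous_comp _ _ _ (fun t => rV_ins i t y) dF).
    exact: continuous_rV_ins.
  exact: cdF.
have FM y s : D (rV_ins i s y) -> 0 <= F (rV_ins i s y) <= M y.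
  by move=> Ds; rewrite expR_ge0 FE//= fM.
have ex y : Om y -> exists a b : nat -> R,
  [/\ (forall k, a k <= b k), (forall k, a k.+1 <= a k), (forall k, b k <= b k.+1) &
      chord i D y = \bigcup_k `[a k, b k]%classic] /\
  (F (rV_ins i (a k) y) @[k --> \oo] --> alpha y /\ F (rV_ins i (b k) y) @[k --> \oo] --> beta y).
  move=> /exhaust[a [b [[ab na nb cE] [ca cb]]]]; exists a, b; split => //.
  have Dk k s : a k <= s <= b k -> D (rV_ins i s y).
    move=> sk; suff : chord i D y s by [].
    by rewrite cE; exists k => //=; rewrite in_itv.
  split.
    rewrite (_ : (fun k => F (rV_ins i (a k) y)) = (fun k => f (rV_ins i (a k) y)))//.
    by apply/funext => k; rewrite FE//; apply: (Dk k); rewrite lexx ab.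
  rewrite (_ : (fun k => F (rV_ins i (b k) y)) = (fun k => f (rV_ins i (b k) y)))//.
  by apply/funext => k; rewrite FE//; apply: (Dk k); rewrite lexx ab.
have [idF EdF] := line_integration oD mdF is_deriveF cdFl uniF FM mM iM ex.
have mD : measurable D by exact: open_measurable_rV.
have mcoord : measurable_fun setT (fun y : 'rV[R]_m.+1 => (y 0 i)%:E).
  by apply/measurable_EFinP; exact: measurable_coord.
have dFE x : D x -> ((grad w x 0 i)%:E * (f x)%:E = - (dF x)%:E)%E.
  by move=> Dx; rewrite -EFinM mxE -(FE Dx) -EFinN opprK.
have iN : (lebesgue_rV R m.+1).-integrable D (fun x => (grad w x 0 i)%:E * (f x)%:E)%E.
  apply: (eq_integrable mD (-%E \o (EFin \o dF))); last exact: integrableN.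
  by move=> x /set_mem Dx; rewrite dFE.
have -> : mu f = pushforward_density (lebesgue_rV R m.+1) D f (grad w).
  by rewrite /mu potential_exp_neg.
have [I1 I2] := integrable_pushforward_density mD mf
  (exp_neg_ge0 u) mgrad mcoord iN.
split => //; rewrite I2 -EdF -integralN; last first.
  exact: integrable_add_def.
by apply: eq_integral => x /set_mem Dx; rewrite dFE.
Qed.

End moment_measure_integral.

(** * Superlinear potentials *)

Section full_domain.
Context {R : realType}.

Lemma compact_eball n (r : R) : compact (@eball R n r).
Proof.
apply: bounded_closed_compact; last first.
  apply/closure_id; apply/seteqP; split; first exact: subset_closure.
  move=> x /closure_enormP xr; rewrite /eball/=; apply/ler_addgt0Pr => e e0.
  have [y yr xy] := xr _ e0; have := ler_enormD_dist y x 0.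
  by rewrite !subr0 => /le_trans; apply; rewrite addrC lerD// ltW// -enormN opprB.
exists r; split; first exact: num_real.
move=> M rM x xr /=.
rewrite /Num.norm/= mx_normrE; apply/bigmax_leP; split.
  by apply: le_trans (ltW rM); exact: le_trans (enorm_ge0 x) xr.
move=> [k j] _; rewrite (ord1 k); apply: le_trans (ler_coord_enorm x j) _.
by exact: le_trans xr (ltW rM).
Qed.

(** Outside a ball u x >= |x| by superlinearity, and on the ball exp (|x| - u x) is
    bounded by compactness. *)
Lemma exp_neg_decay n (u : 'rV[R]_n -> \bar R) : class_L' u ->
  exists2 C, 0 <= C & forall x, exp_neg u x <= C * expR (- enorm x).
Proof.
move=> [[uNy _ _ _] uT [cw _] _ superlinear].
have domu x : dom u x by rewrite uT.
have fE x : exp_neg u x = expR (- (fine \o u) x) by rewrite exp_neg_dom.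
have [r Hr] := superlinear [set z | 1 < z] (nbhs_pinfty_gt (num_real 1)).
pose r' := Num.max r 0.
have cg : continuous (fun x => expR (enorm x - (fine \o u) x)).
  move=> x; apply: (@continuous_comp _ _ _ (fun x => enorm x - (fine \o u) x) (@expR R)); last exact: continuous_expR.
  by apply: continuousB; [exact: enorm_continuous|exact: cw].
have [||c _ cmax] := @EVT_max_rV R n (fun x => expR (enorm x - (fine \o u) x)) (eball r') _
    (@compact_eball n r').
- by exists 0; rewrite /eball/= enorm0 le_max lexx orbT.
- exact: continuous_subspaceT.
exists (Num.max 1 (expR (enorm c - (fine \o u) c))); first by rewrite le_max ler01.
move=> x; rewrite fE.
have -> : expR (- (fine \o u) x) = expR (enorm x - (fine \o u) x) * expR (- enorm x).
  by rewrite -expRD; congr expR; ring.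
rewrite ler_wpM2r ?expR_ge0// le_max.
have [xr|rx] := leP (enorm x) r'; first by rewrite cmax ?orbT ?inE.
move: rx; rewrite gt_max => /andP[rx x0]; apply/orP; left.
rewrite -expR0 ler_expR subr_le0.
by have := Hr x rx; rewrite /= ltr_pdivlMr// mul1r => /ltW.
Qed.

Lemma integral_exp_abs_lty (c : R) : 0 < c ->
  (\int[@lebesgue_measure R]_s (expR (- c * `|s|))%:E < +oo)%E.
Proof.
move=> c0.
rewrite ge0_symfun_integralT; last 3 first.
- by move=> s; exact: expR_ge0.
- move=> s; apply: (@continuous_comp _ _ _ (fun s => - c * `|s|) (@expR R)); last exact: continuous_expR.
  by apply: cvgM; [exact: cvg_cst|exact: norm_continuous].
- by move=> s /=; rewrite normrN.
rewrite lte_mul_pinfty//.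
have -> : (\int[@lebesgue_measure R]_(s in [set s | (0 <= s)%R]) (expR (- c * `|s|))%:E =
   c^-1%:E * \int[@lebesgue_measure R]_s (exponential_pdf c s)%:E)%E.
  rewrite -ge0_integralZl//; last 3 first.
  - by apply/measurable_EFinP; exact: measurable_exponential_pdf.
  - by move=> s _; rewrite lee_fin exponential_pdf_ge0 ?ltW.
  - by rewrite lee_fin invr_ge0 ltW.
  rewrite [LHS]integral_mkcond.
 apply: eq_integral => s _; rewrite /exponential_pdf !patchE.
  rewrite set_itvE; case: ifPn => [|_]; last by rewrite mule0.
  by rewrite inE/= => s0; rewrite -EFinM mulrA mulVf ?mul1r ?gt_eqF// ger0_norm.
by rewrite integral_exponential_pdf// mule1 ltry.
Qed.

Lemma measurable_exp_l1 m (c : R) :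
  measurable_fun setT (fun y : 'rV[R]_m => expR (- c * \sum_k `|y 0 k|)).
Proof.
apply: measurableT_comp; first exact: measurable_expR.
apply: measurable_funM => //; apply: measurable_sum => k.
by apply: measurableT_comp => //; exact: measurable_coord.
Qed.

(** The integrand is a product of functions of one coordinate each. *)
Lemma integral_exp_l1_lty m (c : R) : 0 < c ->
  (\int[lebesgue_rV R m]_y (expR (- c * \sum_k `|y 0%R k|))%:E < +oo)%E.
Proof.
move=> c0; elim: m => [|m ih].
  rewrite /= integral_dirac//=; last first.
    by apply/measurable_EFinP; exact: measurable_exp_l1.
  by rewrite diracT mul1e ltry.
rewrite (ge0_integral_rV_ins ord0); last 2 first.
- by apply/measurable_EFinP; exact: measurable_exp_l1.
- by move=> y; rewrite lee_fin expR_ge0.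
have c1 : (\int[@lebesgue_measure R]_s (expR (- c * `|s|))%:E \is a fin_num)%E.
  by rewrite ge0_fin_numE ?integral_exp_abs_lty// integral_ge0// => s _; rewrite lee_fin expR_ge0.
have mabs : measurable_fun setT (fun s : R => (expR (- c * `|s|))%:E).
  apply/measurable_EFinP; apply: measurableT_comp; first exact: measurable_expR.
  by apply: measurable_funM => //; exact: measurable_normr.
under eq_integral => y _.
  under eq_integral => s _.
    rewrite big_ord_recl rV_ins_eq.
    under eq_bigr do rewrite rV_ins_lift.
    rewrite mulrDr expRD mulrC EFinM.
    over.
  rewrite ge0_integralZl//.
  over.
rewrite /= ge0_integralZr//.
- rewrite muleC; apply: lte_mul_pinfty => //.
  by rewrite integral_ge0// => s _; rewrite lee_fin expR_ge0.
- by apply/measurable_EFinP; exact: measurable_exp_l1.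
- by rewrite integral_ge0// => s _; rewrite lee_fin expR_ge0.
Qed.

Lemma sum_abs_le_enorm m (i : 'I_m.+1) (s : R) (y : 'rV[R]_m) :
  \sum_k `|y 0 k| <= m%:R * enorm (rV_ins i s y).
Proof.
rewrite -[X in X%:R]card_ord mulr_natl -sumr_const; apply: ler_sum => k _.
by rewrite -(rV_ins_lift i s y k) ler_coord_enorm.
Qed.

(** Every chord is the whole line, exhausted by the segments [- k, k], and f tends
    to 0 at both ends. The l^1 norm of y is at most m times the Euclidean norm of any
    point above y, which turns the exponential decay into an integrable bound. *)
Lemma moment_measure_full_domain m (i : 'I_m.+1) (u : 'rV[R]_m.+1 -> \bar R) :
  class_L' u ->
  integrable (mu (exp_neg u)) setT (fun y : 'rV[R]_m.+1 => (y 0 i)%:E) /\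
  (\int[mu (exp_neg u)]_y (y 0%R i)%:E = 0)%E.
Proof.
move=> u'; have [[uNy _ cu _] uT C2 _ _] := u'.
have [C C0 fC] := exp_neg_decay u'.
pose c : R := m.+1%:R^-1.
have c0 : 0 < c by rewrite invr_gt0.
pose M (y : 'rV[R]_m) := C * expR (- c * \sum_k `|y 0 k|).
have DT : (dom u)° = setT by rewrite uT interiorT.
have OT : shadow i (dom u)° = setT by rewrite DT; apply/seteqP; split=> // y _; exists 0.
have C2' : class_C 2 (dom u)° (fine \o u) by rewrite DT.
have fM y s : (dom u)° (rV_ins i s y) -> exp_neg u (rV_ins i s y) <= M y.
  move=> _; apply: le_trans (fC _) _; rewrite ler_wpM2l// ler_expR mulNr lerN2.
  rewrite /c mulrC ler_pdivrMr// mulrC.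
  apply: le_trans (sum_abs_le_enorm i s y) _.
  by rewrite ler_wpM2r ?enorm_ge0// ler_nat.
have mM : measurable_fun (shadow i (dom u)°) M.
  by apply: measurable_funTS; apply: measurable_funM => //; exact: measurable_exp_l1.
have iM : (\int[lebesgue_rV R m]_(y in shadow i (dom u)°) (M y)%:E < +oo)%E.
  rewrite OT; under eq_integral do rewrite EFinM.
  rewrite ge0_integralZl//.
  - by apply: lte_mul_pinfty => //; exact: integral_exp_l1_lty.
  - by apply/measurable_EFinP; exact: measurable_exp_l1.
have decay (v : nat -> R) y : (forall k, `|v k| = k%:R) ->
    exp_neg u (rV_ins i (v k) y) @[k --> \oo] --> 0.
  move=> vk; apply: (@squeeze_cvgr _ _ _ _ (fun=> 0) (fun k => C * k.+1%:R^-1)).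
  - apply: nearW => k; rewrite exp_neg_ge0/=; apply: le_trans (fC _) _.
    rewrite ler_wpM2l// expRN lef_pV2 ?posrE ?expR_gt0//.
    apply: le_trans (expR_ge1Dx _); rewrite -natr1 addrC lerD2l -vk.
    by have := ler_coord_enorm (rV_ins i (v k) y) i; rewrite rV_ins_eq.
  - exact: cvg_cst.
  - rewrite -[X in _ --> X](mulr0 C); apply: cvgM; first exact: cvg_cst.
    exact: cvg_harmonic.
have ex y : shadow i (dom u)° y -> exists a b : nat -> R,
  [/\ (forall k, a k <= b k), (forall k, a k.+1 <= a k), (forall k, b k <= b k.+1) &
      chord i (dom u)° y = \bigcup_k `[a k, b k]%classic] /\
  (exp_neg u (rV_ins i (a k) y) @[k --> \oo] --> (0 : R) /\
   exp_neg u (rV_ins i (b k) y) @[k --> \oo] --> (0 : R)).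
  move=> _; exists (fun k => - k%:R), (fun k => k%:R); split; [split|split].
  - by move=> k; rewrite -subr_ge0 opprK addr_ge0.
  - by move=> k; rewrite lerN2 ler_nat.
  - by move=> k; rewrite ler_nat.
  - rewrite DT; apply/seteqP; split=> // s _.
    exists (Num.truncn `|s|).+1 => //=; rewrite in_itv/= -ler_norml.
    by rewrite ltW// truncnS_gt.
  - by apply: decay => k; rewrite normrN normr_nat.
  - by apply: decay => k; rewrite normr_nat.
have [I1 I2] := moment_measure_coord uNy cu C2' fM mM iM ex.
split => //; rewrite I2 (_ : (fun y => _) = cst 0%E) ?integral0 ?oppe0//.
by apply/funext => y; rewrite subrr.
Qed.

End full_domain.

(** * Potentials with a bounded domain *)

Section chord_theory.
Context {R : realType}.

(** If x is the center of a ball in K of radius e, then t x + (1 - t) y is the center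
    of one of radius t e. *)
Lemma convex_interior n (K : set 'rV[R]_n) (x y : 'rV[R]_n) (t : R) :
  convex_set K -> 0 <= t <= 1 -> K° x -> K° y -> K° (t *: x + (1 - t) *: y).
Proof.
move=> vK /andP[t0 t1] Kx Ky.
have [->|tn0] := eqVneq t 0; first by rewrite scale0r add0r subr0 scale1r.
have tp : 0 < t by rewrite lt_neqAle eq_sym tn0.
have [e e0 eK] := (nbhs_enormP _ _).1 Kx.
apply/nbhs_enormP; exists (t * e); first exact: mulr_gt0.
move=> z ze.
have -> : z = t *: (x + t^-1 *: (z - (t *: x + (1 - t) *: y))) + (1 - t) *: y.
  rewrite scalerDr scalerA divff// scale1r addrAC [in RHS]addrC subrK//.
apply: convex_setP => //; first by rewrite t0 t1.
  apply: eK; rewrite addrAC subrr add0r enormZ gtr0_norm ?invr_gt0//.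
  by rewrite mulrC ltr_pdivrMr// mulrC.
exact: interior_subset Ky.
Qed.

(** The margins (B - A) / (k + 3) are less than half the length, so that none of the
    segments is empty. *)
Lemma bigcup_itv_shrink (A B : R) : A < B ->
  let h k := (B - A) / k.+3%:R in
  `]A, B[%classic = \bigcup_k `[A + h k, B - h k]%classic.
Proof.
move=> AB h; have BA : 0 < B - A by rewrite subr_gt0.
apply/seteqP; split=> s; last first.
  move=> [k _] /=; rewrite !in_itv/= => /andP[As sB].
  have hk : 0 < h k by rewrite divr_gt0.
  by rewrite (lt_le_trans _ As) ?ltrDl// (le_lt_trans sB)// ltrBlDr ltrDl.
rewrite /= in_itv/= => /andP[As sB].
pose d := Num.min (s - A) (B - s).
have d0 : 0 < d by rewrite lt_min !subr_gt0 As sB.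
have [k hk] : exists k, h k <= d.
  exists (Num.truncn ((B - A) / d)).
  rewrite /h ler_pdivrMr// mulrC -ler_pdivrMr//.
  apply: ltW; apply: lt_le_trans (truncnS_gt _) _.
  by rewrite ler_nat ltnS !leqW.
exists k => //=; rewrite in_itv/=.
move: hk; rewrite /d le_min => /andP[h1 h2].
by apply/andP; split; [move: h1|move: h2]; lra.
Qed.

End chord_theory.

Section bounded_domain.
Context {R : realType} {m : nat}.
Variable u : 'rV[R]_m.+1 -> \bar R.
Hypothesis u'' : class_L'' u.
Local Notation K := (dom u).
Local Notation D := (K°).
Local Notation f := (exp_neg u).
Local Notation nu := (gauss_map K).

Let uNy : forall x, u x != -oo%E. Proof. by case: u'' => -[]. Qed.
Let cu : convex_efunction u. Proof. by case: u'' => -[]. Qed.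
Let cK : compact K. Proof. by case: u'' => _ [[]]. Qed.
Let vK : convex_set K. Proof. by case: u'' => _ [[]]. Qed.
Let D0 : D !=set0. Proof. by case: u'' => _ []. Qed.
Let pK : C2plus K. Proof. by case: u'' => _ []. Qed.
Let C2 : class_C 2 D (fine \o u). Proof. by case: u'' => _ _ []. Qed.
Let ctu : {within K, continuous u}. Proof. by case: u''. Qed.

Let oD : open D. Proof. exact: open_interior. Qed.
Let DK : D `<=` K. Proof. exact: interior_subset. Qed.
Let clK : closed K := compact_closed_rV cK.
Let Dr : exists r, forall x, D x -> enorm x <= r.
Proof. by have [r rK] := compact_bounded_rV cK; exists r => x /DK; exact: rK. Qed.

(** Continuity up to the boundary of K is what identifies the limits of f at the ends
    of a chord. *)
Let ctf : {within K, continuous (fun x => expR (- (fine \o u) x))}.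
Proof.
apply/subspace_continuousP => x Kx.
have : u y @[y --> within K (nbhs x)] --> (fine (u x))%:E.
  by rewrite fineK//; exact: (subspace_continuousP _ _).1 ctu x Kx.
move=> /fine_cvg cw.
apply: (@cvg_comp _ _ _ (fun x => - (fine \o u) x) (@expR R)); last exact: continuous_expR.
by apply: cvgN.
Qed.

Let f_cvg x e : K x -> 0 < e ->
  exists2 d, 0 < d & forall y, K y -> enorm (y - x) < d -> `|f y - f x| < e.
Proof.
move=> Kx e0.
have := (subspace_continuousP _ _).1 ctf x Kx => /cvgrPdist_lt/(_ e e0).
rewrite near_withinE => /nbhs_enormP[d d0 H]; exists d => // y Ky yx.
by rewrite !exp_neg_dom// distrC; apply: (H y).
Qed.

Let mf : measurable_fun setT f.
Proof.
have -> : f = f \_ K.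
  by apply/funext => x; rewrite patchE; case: ifPn => // /negP; rewrite inE => /(exp_neg_not_dom uNy) ->.
have mK : measurable K by exact: closed_measurable_rV.
apply/(measurable_restrictT _ _).1 => //.
have mc : measurable_fun K (fun x => \row_(_ < 1) f x).
  apply: cvg_measurable_fun_rV => // x e Kx e0.
  have [d d0 H] := f_cvg Kx e0; exists d => // y Ky yx.
  apply: le_lt_trans (ler_enorm_sum _) _.
  by rewrite big_ord1 !mxE; exact: H.
apply: eq_measurable_fun (measurable_fun_coord ord0 mc) => x _.
by rewrite mxE.
Qed.

Let f_bounded : exists C, forall x, f x <= C.
Proof.
have [|x0 _ fmax] := @EVT_max_rV _ _ _ K _ cK ctf.
  by have [x0 /DK Kx0] := D0; exists x0.
exists (expR (- (fine \o u) x0)) => x; have [Kx|Kx] := pselect (K x).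
  by rewrite exp_neg_dom//; apply: fmax; rewrite inE.
by rewrite (exp_neg_not_dom uNy Kx) expR_ge0.
Qed.

Let lift_cvg i tau y (v : nat -> R) : tau * tau = 1 -> shadow i D y ->
  (forall k, D (rV_ins i (v k) y)) -> v @ \oo --> chord_end i tau D y ->
  f (rV_ins i (v k) y) @[k --> \oo] --> f (shadow_lift i tau D y).
Proof.
move=> tau2 Oy Dv vc; apply/cvgrPdist_lt => e e0.
have Kx : K (shadow_lift i tau D y).
  by have := boundary_shadow_lift cK tau2 Oy; rewrite boundaryE// => -[].
have [d d0 H] := f_cvg Kx e0.
have /cvgrPdist_lt/(_ d d0) := vc; apply: filterS => k kd.
rewrite distrC; apply: H; first exact/DK/Dv.
by rewrite rV_insB subrr enorm_rV_ins_line distrC.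
Qed.

Let exhaust i y : shadow i D y -> exists a b : nat -> R,
  [/\ (forall k, a k <= b k), (forall k, a k.+1 <= a k), (forall k, b k <= b k.+1) &
      chord i D y = \bigcup_k `[a k, b k]%classic] /\
  (f (rV_ins i (a k) y) @[k --> \oo] --> f (shadow_lift i (-1) D y) /\
   f (rV_ins i (b k) y) @[k --> \oo] --> f (shadow_lift i 1 D y)).
Proof.
move=> Oy; have [r rD] := Dr.
have m2 : -1 * -1 = 1 :> R by rewrite mulrNN mulr1.
have p2 : 1 * 1 = 1 :> R by rewrite mulr1.
set A := chord_end i (-1) D y; set B := chord_end i 1 D y.
have cE : chord i D y = `]A, B[%classic.
  apply/seteqP; split=> s.
    move=> Ds; have := chord_lt_end oD rD m2 Ds; have := chord_lt_end oD rD p2 Ds.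
    by rewrite !mulN1r !mul1r ltrN2 /= in_itv/= => -> ->.
  rewrite /= in_itv/= => /andP[As sB].
  have sA0 : 0 < s - A by rewrite subr_gt0.
  have Bs0 : 0 < B - s by rewrite subr_gt0.
  have [s1 Ds1] := chord_end_adherent rD m2 Oy sA0; rewrite !mulN1r -/A => s1s.
  have [s2 Ds2] := chord_end_adherent rD p2 Oy Bs0; rewrite !mul1r -/B => s2s.
  have s1s2 : 0 < s2 - s1 by move: s1s s2s; lra.
  (* s1 < s < s2 with both ends in the chord, which is convex. *)
  pose t := (s2 - s) / (s2 - s1).
  have t01 : 0 <= t <= 1.
    rewrite divr_ge0 ?(ltW s1s2)//=; last by move: s2s; lra.
    by rewrite ler_pdivrMr// mul1r; move: s1s; lra.
  rewrite /chord/=.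
  have -> : rV_ins i s y = t *: rV_ins i s1 y + (1 - t) *: rV_ins i s2 y.
    apply/rowP => j; rewrite !mxE; case: unliftP => [k|] _; first by ring.
    by rewrite /t; field; rewrite gt_eqF.
  exact: convex_interior.
have AB : A < B.
  have [s Ds] := Oy; have : chord i D y s by [].
  by rewrite cE /= in_itv/= => /andP[]; exact: lt_trans.
pose h k : R := (B - A) / k.+3%:R.
have BA : 0 < B - A by rewrite subr_gt0.
have h0 : h @ \oo --> 0.
  rewrite -(mulr0 (B - A)); apply: cvgM; first exact: cvg_cst.
  have := @cvg_harmonic R; rewrite -(cvg_shiftn 2); apply: cvg_trans.
  by apply: near_eq_cvg; apply: nearW => k; rewrite /= addn2.
have hS k : h k.+1 <= h k.
  by rewrite /h ler_wpM2l ?(ltW BA)// lef_pV2 ?posrE// ler_nat.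
have hk k : h k <= (B - A) / 2.
  by rewrite /h ler_wpM2l ?(ltW BA)// lef_pV2 ?posrE// ler_nat.
have cE' := cE; rewrite (bigcup_itv_shrink AB) in cE'.
have Dk k s : A + h k <= s <= B - h k -> D (rV_ins i s y).
  move=> sk; suff : chord i D y s by [].
  by rewrite cE'; exists k => //=; rewrite in_itv.
have abk k : A + h k <= B - h k by have := hk k; lra.
exists (fun k => A + h k), (fun k => B - h k); split; [split => //|split].
- by move=> k; rewrite lerD2l.
- by move=> k; rewrite lerD2l lerN2.
- apply: lift_cvg => //; first by move=> k; apply: (Dk k); rewrite lexx abk.
  by rewrite -[X in _ --> X]addr0; apply: cvgD => //; exact: cvg_cst.
- apply: lift_cvg => //; first by move=> k; apply: (Dk k); rewrite lexx abk.
  by rewrite -[X in _ --> X]subr0; apply: cvgB => //; exact: cvg_cst.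
Qed.

Section coordinate.
Variable i : 'I_m.+1.
Local Notation Om := (shadow i D).

Let mOm : measurable Om. Proof. by apply: open_measurable_rV; exact: open_shadow. Qed.

Let cst_Om_lty (C : R) : 0 <= C -> (\int[lebesgue_rV R m]_(y in Om) C%:E < +oo)%E.
Proof.
move=> C0; rewrite integral_cst// lte_mul_pinfty//.
have [r rD] := Dr.
apply: (@le_lt_trans _ _ (lebesgue_rV R m (eball r))).
  apply: le_measure; rewrite ?inE//; first exact: measurable_eball.
  move=> y [s Ds]; rewrite /eball/= -(enorm_rV_ins_shadow i).
  apply: le_trans (rD _ Ds); rewrite /enorm ler_wsqrtr// !dot_rV_ins.
  by rewrite mul0r add0r lerDr -expr2 sqr_ge0.
by have := @lebesgue_rV_eball_fin_num R m r; rewrite ge0_fin_numE.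
Qed.

(** The function f is bounded and so is the shadow, so that a constant dominates. *)
Lemma moment_measure_bounded_domain :
  integrable (mu f) setT (fun y : 'rV[R]_m.+1 => (y 0 i)%:E) /\
  (\int[mu f]_y (y 0%R i)%:E = - \int[lebesgue_rV R m]_(y in Om)
     (f (shadow_lift i 1 D y) - f (shadow_lift i (-1) D y))%:E)%E.
Proof.
have [C fC] := f_bounded.
have C0 : 0 <= C by apply: le_trans (fC 0); exact: exp_neg_ge0.
apply: (@moment_measure_coord _ _ i u (fun=> C)) => //.
- exact: cst_Om_lty.
- exact: exhaust.
Qed.

Let mlift tau : tau * tau = 1 -> measurable_fun Om (fun y => (f (shadow_lift i tau D y))%:E).
Proof.
move=> tau2; have [r rD] := Dr; apply/measurable_EFinP.
by apply: measurableT_comp mf _; exact: measurable_shadow_lift oD rD tau2.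
Qed.

Let integrable_lift tau : tau * tau = 1 ->
  (lebesgue_rV R m).-integrable Om (fun y => (f (shadow_lift i tau D y))%:E).
Proof.
move=> tau2; apply/integrableP; split; first exact: mlift.
have [C fC] := f_bounded.
have C0 : 0 <= C by apply: le_trans (fC 0); exact: exp_neg_ge0.
apply: le_lt_trans (cst_Om_lty C0); apply: ge0_le_integral => //.
- by apply: measurableT_comp => //; exact: mlift.
- by move=> y _; rewrite /= lee_fin ger0_norm ?exp_neg_ge0.
Qed.

Let G x : \bar R := ((nu x 0 i)%:E * (f x)%:E)%E.

Let mb : measurable (boundary K). Proof. exact: measurable_boundary. Qed.

Let mG : measurable_fun (boundary K) G.
Proof.
apply: emeasurable_funM; apply/measurable_EFinP; last exact: measurable_funTS.
by apply: measurable_fun_coord; exact: measurable_gauss_map.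
Qed.

Let side tau (g : 'rV[R]_m.+1 -> \bar R) : tau * tau = 1 ->
  (forall x, g x = (maxe (tau%:E * G x) 0)%E) ->
  (\int[hausdorff_measure m]_(x in boundary K) g x =
   \int[lebesgue_rV R m]_(y in Om) (f (shadow_lift i tau D y))%:E)%E.
Proof.
move=> tau2 gE.
rewrite -(@ge0_integral_boundary_side _ _ i K cK vK pK tau tau2 (EFin \o f)); last 2 first.
- exact/measurable_EFinP.
- by move=> x; rewrite lee_fin exp_neg_ge0.
have tau1 : `|tau| = 1.
  by apply/eqP; rewrite -(@eqrXn2 _ 2)// ?normr_ge0// expr1n -normrX expr2 tau2 normr1.
rewrite integral_mkcond [RHS]integral_mkcond; apply: eq_integral => x _.
rewrite !patchE; have [/set_mem bx|nbx] := boolP (x \in boundary K); last first.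
  by rewrite ifN//; apply: contra nbx; rewrite !inE => -[].
rewrite gE /G -!EFinM -EFin_max mulrA.
have [tn|tn] := ltP 0 (tau * nu x 0 i).
  rewrite mem_set//; congr EFin.
  rewrite max_l; last by rewrite mulr_ge0 ?(ltW tn) ?exp_neg_ge0.
  rewrite mulrC; congr (_ * _).
  by rewrite -[in RHS](mul1r `|_|) -tau1 -normrM gtr0_norm.
rewrite ifN; last by apply/negP; rewrite inE/= => -[_]; rewrite ltNge tn.
by rewrite max_r// mulr_le0_ge0// exp_neg_ge0.
Qed.

Let integralGp :
  (\int[hausdorff_measure m]_(x in boundary K) G^\+ x =
   \int[lebesgue_rV R m]_(y in Om) (f (shadow_lift i 1 D y))%:E)%E.
Proof. by apply: side => [|x]; rewrite ?mulr1// funeposE mul1e. Qed.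

Let integralGn :
  (\int[hausdorff_measure m]_(x in boundary K) G^\- x =
   \int[lebesgue_rV R m]_(y in Om) (f (shadow_lift i (-1) D y))%:E)%E.
Proof. by apply: side => [|x]; rewrite ?mulrNN ?mulr1// funenegE EFinN mulN1e. Qed.

(** The positive part of nu_i f lives on the upper side of the boundary and its
    negative part on the lower side, where the projection has Jacobian |nu_i|. *)
Lemma surface_measure_coord :
  integrable (sigma f) sphere (fun y : 'rV[R]_m.+1 => (y 0 i)%:E) /\
  (\int[sigma f]_(y in sphere) (y 0%R i)%:E = \int[lebesgue_rV R m]_(y in Om)
     (f (shadow_lift i 1 D y) - f (shadow_lift i (-1) D y))%:E)%E.
Proof.
have m2 : -1 * -1 = 1 :> R by rewrite mulrNN mulr1.
have p2 : 1 * 1 = 1 :> R by rewrite mulr1.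
have lty tau : tau * tau = 1 ->
    (\int[lebesgue_rV R m]_(y in Om) (f (shadow_lift i tau D y))%:E < +oo)%E.
  move=> /integrable_lift/integrableP[_]; apply: le_lt_trans.
  rewrite le_eqVlt; apply/orP; left; apply/eqP; apply: eq_integral => y _.
  by rewrite gee0_abs// lee_fin exp_neg_ge0.
have ipos : (hausdorff_measure m).-integrable (boundary K) G^\+%E.
  apply/integrableP; split; first exact: measurable_funepos.
  under eq_integral do rewrite gee0_abs//.
  by rewrite integralGp; exact: lty.
have ineg : (hausdorff_measure m).-integrable (boundary K) G^\-%E.
  apply/integrableP; split; first exact: measurable_funeneg.
  under eq_integral do rewrite gee0_abs//.
  by rewrite integralGn; exact: lty.
have iG : (hausdorff_measure m).-integrable (boundary K) G.
  by rewrite [G]funeposneg; exact: integrableB.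
have EG : (\int[hausdorff_measure m]_(x in boundary K) G x = \int[lebesgue_rV R m]_(y in Om)
     (f (shadow_lift i 1 D y) - f (shadow_lift i (-1) D y))%:E)%E.
  rewrite integralE integralGp integralGn -integralB//; first exact: integrable_lift.
  exact: integrable_lift.
have msphere : measurable (@sphere R m.+1).
  rewrite (_ : sphere = enorm @^-1` [set 1])//.
  by rewrite -[X in measurable X]setTI; exact: measurable_enorm.
pose F : 'rV[R]_m.+1 -> \bar R := (fun y => (y 0 i)%:E) \_ sphere.
have mcoord : measurable_fun setT (fun y : 'rV[R]_m.+1 => (y 0 i)%:E).
  by apply/measurable_EFinP; exact: measurable_coord.
have mF : measurable_fun setT F.
  by apply/(measurable_restrictT _ _).1 => //; exact: measurable_funTS.
have FE x : boundary K x -> (F (nu x) * (f x)%:E = G x)%E.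
  move=> bx; have [n1 _] := outer_unit_normal_gauss_map vK clK pK bx.
  by rewrite /F patchE mem_set.
have sigmaE : sigma f = pushforward_density (hausdorff_measure m) (boundary K) f nu.
  by rewrite /sigma potential_exp_neg.
have mfb : measurable_fun (boundary K) f by exact: measurable_funTS.
have iF : (hausdorff_measure m).-integrable (boundary K) (fun x => F (nu x) * (f x)%:E)%E.
  by apply: eq_integrable iG => // x /set_mem bx; rewrite FE.
have mnu := measurable_gauss_map cK vK pK.
have [I1 I2] := integrable_pushforward_density mb mfb (exp_neg_ge0 u) mnu mF iF.
have [M ME] := pushforward_density_measureE (hausdorff_measure m) mb mfb (exp_neg_ge0 u) mnu.
rewrite sigmaE -ME in I1 I2 *; split.
  by apply/(integrable_mkcond _ msphere).2.
rewrite integral_mkcond I2 -EG; apply: eq_integral => x /set_mem bx.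
exact: FE.
Qed.

End coordinate.

End bounded_domain.

(** * Cancellation of the moments *)

Theorem proposition7p2 (R : realType) (n : nat) (hn : (0 < n)%N) :
  (forall f : 'rV[R]_n -> R, class_A' f ->
     vintegrable (mu f) setT /\ vintegral (mu f) setT = 0) /\
  (forall f : 'rV[R]_n -> R, class_A'' f ->
     [/\ vintegrable (mu f) setT, vintegrable (sigma f) sphere &
         vintegral (mu f) setT + vintegral (sigma f) sphere = 0]).
Proof.
case: n hn => [//|m] _; split=> f [u uL <-].
  split=> [i|]; first by have [] := moment_measure_full_domain i uL.
  by apply/rowP => i; rewrite !mxE; have [_ ->] := moment_measure_full_domain i uL.
split=> [i|i|].
- by have [] := moment_measure_bounded_domain uL i.
- by have [] := surface_measure_coord uL i.
apply/rowP => i; rewrite !mxE.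
have [_ ->] := moment_measure_bounded_domain uL i.
have [_ ->] := surface_measure_coord uL i.
by rewrite fineN addNr.
Qed.
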